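(* Let $p\in[2,\infty)$ and let $\mu$ be a Borel probability measure on a compact set $\Omega$. There is a number $C=C(p)$, depending only on $p$, such that, if $L$ is an $N$-dimensional subspace of $L^p(\mu)\cap C(\Omega)$ such that $$\|f\|_\infty\le MN^{1/2}\|f\|_2\quad\forall f\in L,$$ then for every integer $m\ge2$ $$\mathbb{E}\sup_{f\in B_p(L)}\Bigl|\frac1m\sum_{j=1}^m|f(X_j)|^p-\|f\|_p^p\Bigr|\le C\Bigl(\frac{\log m}{m}M^pN^{p/2}+\Bigl[\frac{\log m}{m}M^pN^{p/2}\Bigr]^{1/2}\Bigr),$$ where $B_p(L):=\{f\in L:\|f\|_p\le1\}$ and $X_1,\dots,X_m$ are independent random points of $\Omega$ distributed according to $\mu$. In particular, for every $\varepsilon\in(0,1)$ and every $\delta\in(0,1)$ there is a big enough constant $c=c(p,\varepsilon,\delta)$ such that for every integer $m\ge cM^pN^{p/2}\log(4M^2N)$ one has $$(1-\varepsilon)\|f\|_p^p\le\frac1m\sum_{j=1}^m|f(X_j)|^p\le(1+\varepsilon)\|f\|_p^p\quad\forall f\in L$$ with probability greater than $1-\delta$, for any such subspace $L$.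
   Context: $\|f\|_r:=\bigl(\int_\Omega|f|^r\,d\mu\bigr)^{1/r}$ for $r\in[1,\infty)$ and $\|f\|_\infty:=\sup_{x\in\Omega}|f(x)|$. *)

(* Defs.v *)
From HB Require Import structures.
From mathcomp Require Import all_boot all_order all_algebra.
From mathcomp Require Import all_classical all_reals all_analysis.

Set Implicit Arguments.
Unset Strict Implicit.
Unset Printing Implicit Defensive.

Import Order.TTheory GRing.Theory Num.Theory.
Import numFieldNormedType.Exports.

Local Open Scope classical_set_scope.
Local Open Scope ring_scope.

Notation borelType Omega := (g_sigma_algebraType (@open Omega)).

(* The genuine supremum over all points; the library's ['N[mu]_+oo[f]] is the
   essential supremum with respect to [mu]. *)
Definition sup_norm (T : Type) (R : realType) (f : T -> R) : \bar R :=
  ereal_sup [set (`|f x|)%:E | x in [set: T]].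

Definition lin_comb (T : Type) (R : realType) (N : nat)
    (e : 'I_N -> T -> R) (a : 'I_N -> R) : T -> R :=
  fun x => \sum_(i < N) a i * e i x.

Definition lin_free (T : Type) (R : realType) (N : nat)
    (e : 'I_N -> T -> R) : Prop :=
  forall a : 'I_N -> R, (forall x, lin_comb e a x = 0) -> forall i, a i = 0.

(* [L] is a linear subspace, of dimension [N], of the space of all functions
   [T -> R]: it has a basis of [N] elements. *)
Definition subspace_of_dim (T : Type) (R : realType) (N : nat)
    (L : set (T -> R)) : Prop :=
  exists e : 'I_N -> T -> R, lin_free e /\ L = range (lin_comb e).

Definition Lp_unit_ball d (T : measurableType d) (R : realType)
    (mu : {measure set T -> \bar R}) (p : R) (L : set (T -> R)) :
    set (T -> R) :=
  [set f | L f /\ ('N[mu]_(p%:E)[EFin \o f] <= 1)%E].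

(* Elements of [L] are functions, not classes modulo [mu]-a.e. equality. The
   dimension is the same for both readings, since by the last condition an
   element of [L] that vanishes [mu]-a.e. is zero. *)
Definition nikolskii_subspace (R : realType) (Omega : ptopologicalType)
    (mu : probability (borelType Omega) R) (p : R) (N : nat) (M : R)
    (L : set (Omega -> R)) : Prop :=
  [/\ subspace_of_dim N L,
      forall f, L f -> continuous f /\ f \in Lfun mu p%:E &
      forall f, L f ->
        (sup_norm f <= (M * Num.sqrt N%:R)%:E * 'N[mu]_(2%:E)[EFin \o f])%E].

Definition mutually_independent d d' (T : measurableType d)
    (T' : measurableType d') (R : realType) (P : probability T R)
    (I : finType) (X : I -> T -> T') : Prop :=
  forall (J : {set I}) (A : I -> set T'),
    (forall i, measurable (A i)) ->
    P (\bigcap_(i in [set` J]) (X i @^-1` A i)) =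
    (\prod_(i in J) P (X i @^-1` A i))%E.

Definition iid_sample d d' (T : measurableType d) (T' : measurableType d')
    (R : realType) (P : probability T R) (mu : probability T' R) (m : nat)
    (X : 'I_m -> {RV P >-> T'}) : Prop :=
  mutually_independent P (fun j => X j : T -> T') /\
  forall j (A : set T'), measurable A -> distribution P (X j) A = mu A.

Definition empirical_moment (S T : Type) (R : realType) (p : R) (m : nat)
    (X : 'I_m -> S -> T) (f : T -> R) (s : S) : R :=
  m%:R^-1 * \sum_(j < m) `|f (X j s)| `^ p.

(* Main.v *)
Require Import Defs.
From HB Require Import structures.
From mathcomp Require Import all_boot all_order all_algebra.
From mathcomp Require Import all_classical all_reals all_analysis.
From mathcomp Require Import measurable_realfun ring lra.

Set Implicit Arguments.
Unset Strict Implicit.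
Unset Printing Implicit Defensive.

Import Order.TTheory GRing.Theory Num.Theory.
Import numFieldNormedType.Exports.

Local Open Scope classical_set_scope.
Local Open Scope ring_scope.

(** Idea. In an orthonormal basis of [L], the Nikolskii inequality says that the
vectors [x_j = (e_i(X_j))_i] have Euclidean length at most [K = M sqrt N], and
[||f||_p <= 1] implies [||f||_2 <= 1]. Symmetrization reduces the expectation
of the supremum [V] to a process [sum_j +-|<a, x_j>|^p] with random signs, whose
natural distance is that of the vectors [sgn(<a, x_j>)|<a, x_j>|^p].

That process is chained over nets that are chosen greedily, at scale [rho], with
respect to the minimum of the energy [|a|_2^2 + ||f_a||_p^p] over the
[rho]-neighbourhood of [a]. Since [p >= 2], Clarkson's inequality makes the energy
uniformly convex: near-minimizers of the energy in a common neighbourhood are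
within [delta] of each other in [l_2], where [delta^2] is the increment of the
minimal energy between two scales, and these increments telescope along a chain.
The number of separated points in a Euclidean ball of radius [delta] is estimated
by steering a random walk towards each of them: a random walk with a drift of size
[delta] has a density with second moment at most [exp(delta^2)].

The resulting bound [C sqrt(K^p m (1 + V) log m)] for given points involves [V]
itself, because [sum_j |<a, x_j>|^p <= m (1 + V) ||f_a||_p^p]; averaging over the
points and solving for the expectation of [V] gives the first part. The second
part is Markov's inequality. *)

(** * Powers, signs and packing *)

(** The difficulty is to lose only one logarithm. About ln m scales matter, and bounding the packing
    numbers at each of them with the radius of the whole unit ball would cost a factor (ln m)^(3/2)
    in the process. With the local increment D of the minimal energy in place of that radius, a
    scale costs a multiple of sqrt(D (1 + D ln m)) <= D sqrt(ln m) + 1 / sqrt(ln m); the increments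
    have a bounded sum, so all scales together cost sqrt(ln m).

    These increments depend on the point that is approximated, so a union bound over whole nets is
    too crude. Each link of a chain gets a weight from its rank in the order of minimal energies.
    The net point chosen for t has minimal energy at most that of t, so only competitors not above t
    enter the rank, and for those convexity gives the local bound.

    The distance is built on sgn(u)|u|^p and not on |u|^p because monotonicity keeps its balls
    stable under midpoints, up to a factor, as the convexity argument requires. *)

Section scalar_inequalities.
Variable R : realType.
Implicit Types x y z u v p q s t : R.

Lemma expR_le_quad x : x <= 2^-1 -> expR x <= 1 + x + 2 * x ^+ 2.
Proof.
move=> x2; have x1 : 0 < 1 - x by lra.
have h : expR x <= (1 - x)^-1.
  rewrite -[expR x]invrK -expRN lef_pV2 ?posrE ?expR_gt0//.
  by have := expR_ge1Dx (- x); lra.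
apply: (le_trans h); rewrite -[leLHS]mul1r ler_pdivrMr//.
have : 0 <= x ^+ 2 * (1 - 2 * x) by rewrite mulr_ge0 ?sqr_ge0//; lra.
nra.
Qed.

Lemma cosh_le x : expR x + expR (- x) <= 2 * expR (2 * x ^+ 2).
Proof.
wlog x0 : x / 0 <= x => [hw|].
  have [/hw//|x0] := leP 0 x.
  by have := hw (- x); rewrite opprK sqrrN addrC; apply; lra.
have [x1|x1] := leP x 2^-1.
  have h1 := expR_le_quad x1.
  have h2 : expR (- x) <= 1 + - x + 2 * (- x) ^+ 2 by apply: expR_le_quad; lra.
  have := expR_ge1Dx (2 * x ^+ 2); rewrite sqrrN in h2; lra.
have : expR (- x) <= expR x by rewrite ler_expR; lra.
have : expR x <= expR (2 * x ^+ 2) by rewrite ler_expR; nra.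
lra.
Qed.

Lemma sqr_le_cosh x : x ^+ 2 <= 2 * (expR x + expR (- x)).
Proof.
wlog x0 : x / 0 <= x => [hw|].
  have [/hw//|x0] := leP 0 x.
  by have := hw (- x); rewrite opprK sqrrN addrC; apply; lra.
have := expR_ge1Dxn 1 x0; have := expR_ge0 (- x).
by rewrite (_ : 2`!%:R = 2)//; lra.
Qed.

(** Young's inequality for the product of [z] and 1, with exponents [p] and [p / (p - 1)]. *)
Lemma powR_bernoulli z p : 0 <= z -> 1 <= p -> 1 + p * (z - 1) <= z `^ p.
Proof.
move=> z0; rewrite le_eqVlt => /predU1P[<-|p1].
  by rewrite powRr1//; lra.
have p0 : 0 < p by lra.
have q0 : 0 < p / (p - 1) by rewrite divr_gt0//; lra.
have := @conjugate_powR R z 1 p (p / (p - 1)) z0 ler01 p0 q0.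
rewrite mulr1 powR1 mul1r invf_div => h.
have {}h : z <= z `^ p / p + (p - 1) / p.
  by apply: h; field; rewrite gt_eqF.
rewrite -mulrDl ler_pdivlMr// in h; nra.
Qed.

Lemma powR_sub_le p x y : 1 <= p -> 0 <= y <= x ->
  x `^ p - y `^ p <= p * (x - y) * x `^ (p - 1).
Proof.
move=> p1 /andP[y0 yx]; have p0 : 0 < p by lra.
have [x0|x0] := eqVneq x 0.
  have y00 : y = 0 by lra.
  by rewrite y00 x0 !subrr mulr0 mul0r.
have xgt0 : 0 < x by rewrite lt_def x0; lra.
have z0 : 0 <= y / x by rewrite divr_ge0//; lra.
have := powR_bernoulli z0 p1.
have -> : y `^ p = (y / x) `^ p * x `^ p by rewrite -powRM ?divfK//; lra.
have -> : x - y = x * (1 - y / x) by rewrite mulrBr mulr1 mulrC divfK.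
have e : x * x `^ (p - 1) = x `^ p by rewrite mulr_powRB1//; lra.
have := powR_gt0 p xgt0; rewrite mulrA mulrAC -mulrA [p * x]mulrC -!mulrA.
set w := y / x; set P := x `^ p => P0 h.
rewrite (_ : _ * (_ * _) = p * (1 - w) * P); last by rewrite /P -e; ring.
nra.
Qed.

(** The odd version of the power. It is monotone, which [sdist_mid] relies on, and its increments
    dominate those of the even power ([dist_powR_norm_spow]), whose process is the one to be
    bounded. *)
Definition spow p u : R := Num.sg u * `|u| `^ p.

Lemma spow_ge0 p u : 0 <= u -> p != 0 -> spow p u = u `^ p.
Proof.
move=> u0 p0; rewrite /spow; have [->|u1] := eqVneq u 0.
  by rewrite sgr0 mul0r powR0.
by rewrite gtr0_sg ?mul1r ?ger0_norm// lt_def u1.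
Qed.

Lemma spowN p u : spow p (- u) = - spow p u.
Proof. by rewrite /spow sgrN normrN mulNr. Qed.

Lemma norm_spow p u : p != 0 -> `|spow p u| = `|u| `^ p.
Proof.
move=> p0; have [u0|/ltW u0] := leP 0 u.
  by rewrite spow_ge0// !ger0_norm// powR_ge0.
rewrite -{1}[u]opprK spowN normrN spow_ge0 ?oppr_ge0//.
by rewrite ger0_norm ?powR_ge0// ler0_norm.
Qed.

Lemma spow_mono p u v : 0 < p -> u <= v -> spow p u <= spow p v.
Proof.
move=> p0 uv; have pn0 : p != 0 by rewrite gt_eqF.
have [u0|/ltW u0] := leP 0 u.
  rewrite !spow_ge0//; last lra.
  by apply: ge0_ler_powR; rewrite ?nnegrE//; lra.
have [v0|/ltW v0] := leP 0 v.
  rewrite (spow_ge0 v0)// -[u]opprK spowN spow_ge0 ?oppr_ge0//.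
  by rewrite (@le_trans _ _ 0) ?oppr_le0 ?powR_ge0.
rewrite -[u]opprK -[v]opprK !(spowN p (- _)) lerN2 !spow_ge0 ?oppr_ge0//.
by apply: ge0_ler_powR; rewrite ?nnegrE ?oppr_ge0 ?lerN2//; lra.
Qed.

(** By symmetry [v <= u] and [0 <= v + u], so that [u] has the larger modulus. For [v >= 0] this is
    the tangent bound [powR_sub_le]; for [v < 0] the powers of the moduli add up, and in each of
    them one factor is kept and the rest is bounded by the power [p - 1] of [u]. *)
Lemma spow_lip p u v : 1 <= p ->
  `|spow p u - spow p v| <= p * `|u - v| * Num.max `|u| `|v| `^ (p - 1).
Proof.
move=> p1; have p0 : 0 < p by lra.
have pn0 : p != 0 by rewrite gt_eqF.
wlog uv : u v / v <= u => [hw|].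
  have [/hw//|/ltW/hw] := leP v u.
  by rewrite distrC [`|v - u|]distrC maxC.
rewrite [X in X <= _]ger0_norm ?subr_ge0 ?spow_mono// [`|u - v|]ger0_norm ?subr_ge0//.
wlog v0 : u v uv / 0 <= v + u => [hw|].
  have [v0|v0] := leP 0 (v + u); first exact: hw.
  have := hw (- v) (- u); rewrite !spowN !normrN maxC.
  have -> : - v - - u = u - v by ring.
  have -> : - spow p v - - spow p u = spow p u - spow p v by ring.
  by apply; lra.
have u0 : 0 <= u by lra.
have [v1|/ltW v1] := leP 0 v.
  rewrite !spow_ge0// !ger0_norm// max_l// powR_sub_le//; lra.
rewrite spow_ge0// -{1}[v]opprK spowN spow_ge0 ?oppr_ge0// opprK.
rewrite ger0_norm// ler0_norm// max_l; last lra.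
have e (w : R) : 0 <= w -> w `^ p = w * w `^ (p - 1) by move=> w0; rewrite mulr_powRB1.
rewrite !e ?oppr_ge0//.
have h1 : (- v) `^ (p - 1) <= u `^ (p - 1).
  by apply: ge0_ler_powR; rewrite ?nnegrE; lra.
have h2 := powR_ge0 u (p - 1).
have : (- v) * (- v) `^ (p - 1) <= (- v) * u `^ (p - 1) by rewrite ler_wpM2l//; lra.
have : (u - v) * u `^ (p - 1) <= p * ((u - v) * u `^ (p - 1)).
  by rewrite ler_peMl// mulr_ge0//; lra.
lra.
Qed.

Lemma dist_powR_norm_spow p u v : p != 0 ->
  `| `|u| `^ p - `|v| `^ p| <= `|spow p u - spow p v|.
Proof. by move=> p0; rewrite -!norm_spow// ler_dist_dist. Qed.

(** The squared Lipschitz factor has exponent [2 * p - 2], split as [(p - 2) + p]: the first part is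
    bounded uniformly by [K], the second is kept because sums of p-th powers over the sample are
    under control. *)
Lemma spow_lip2 p u v K : 2 <= p -> `|u| <= K -> `|v| <= K ->
  (spow p u - spow p v) ^+ 2 <=
  p ^+ 2 * K `^ (p - 2) * ((u - v) ^+ 2 * (`|u| `^ p + `|v| `^ p)).
Proof.
move=> p2 uK vK; have h := @spow_lip p u v (le_trans (ler1n _ 2) p2).
rewrite -real_normK ?num_real// -[(u - v) ^+ 2]real_normK ?num_real//.
set M := Num.max _ _ in h.
have M0 : 0 <= M by rewrite le_max normr_ge0.
have hM : M `^ p <= `|u| `^ p + `|v| `^ p.
  by rewrite /M; case: (leP `|u| `|v|) => _; rewrite ?lerDl ?lerDr powR_ge0.
have hK : M `^ (p - 2) <= K `^ (p - 2).
  apply: ge0_ler_powR; rewrite ?nnegrE//; first lra.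
  - exact: le_trans uK.
  - by rewrite ge_max uK vK.
apply: (@le_trans _ _ ((p * `|u - v| * M `^ (p - 1)) ^+ 2)).
  by rewrite ler_sqr ?nnegrE// !mulr_ge0 ?powR_ge0//; lra.
have e : (M `^ (p - 1)) ^+ 2 = M `^ (p - 2) * M `^ p.
  rewrite -powR_mulrn ?powR_ge0// -powRrM -powRD.
    by congr (_ `^ _); ring.
  by apply/implyP => /eqP h0; exfalso; lra.
rewrite !exprMn e.
have : M `^ (p - 2) * M `^ p <= K `^ (p - 2) * (`|u| `^ p + `|v| `^ p).
  by rewrite ler_pM ?powR_ge0.
have := sqr_ge0 `|u - v|; have := sqr_ge0 p => a b c.
rewrite [leRHS](_ : _ = p ^+ 2 * `|u - v| ^+ 2 *
  (K `^ (p - 2) * (`|u| `^ p + `|v| `^ p))); last by ring.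
by rewrite ler_wpM2l// mulr_ge0.
Qed.

Lemma powR_superadd q s t : 1 <= q -> 0 <= s -> 0 <= t ->
  s `^ q + t `^ q <= (s + t) `^ q.
Proof.
move=> q1 s0 t0.
have e (w : R) : 0 <= w -> w `^ q = w * w `^ (q - 1).
  by move=> w0; rewrite mulr_powRB1//; lra.
rewrite !e ?addr_ge0// mulrDl.
have h (w : R) : 0 <= w -> w <= s + t -> w `^ (q - 1) <= (s + t) `^ (q - 1).
  by move=> w0 wst; apply: ge0_ler_powR; rewrite ?nnegrE; lra.
by apply: lerD; apply: ler_wpM2l => //; apply: h => //; lra.
Qed.

(** Both values lie above the tangent at the midpoint, and its linear terms cancel in the sum. *)
Lemma powR_midpoint q s t : 1 <= q -> 0 <= s -> 0 <= t ->
  ((s + t) / 2) `^ q <= (s `^ q + t `^ q) / 2.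
Proof.
move=> q1 s0 t0.
have [m0|m0] := eqVneq (s + t) 0.
  rewrite m0 mul0r powR0; last by apply/eqP; lra.
  by rewrite divr_ge0// addr_ge0// powR_ge0.
have mgt0 : 0 < (s + t) / 2 by rewrite divr_gt0// lt_def m0 addr_ge0.
have h (w : R) : 0 <= w -> ((s + t) / 2) `^ q * (1 + q * (w / ((s + t) / 2) - 1)) <= w `^ q.
  move=> w0.
  have -> : w `^ q = ((s + t) / 2) `^ q * (w / ((s + t) / 2)) `^ q.
    rewrite -powRM; [|exact: ltW|by rewrite divr_ge0// ltW].
    by rewrite mulrC divfK// gt_eqF.
  by rewrite ler_wpM2l ?powR_ge0// powR_bernoulli// divr_ge0// ltW.
have e : s / ((s + t) / 2) + t / ((s + t) / 2) = 2 by field.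
have := lerD (h s s0) (h t t0); rewrite -mulrDr.
rewrite (_ : 1 + q * _ + (1 + q * _) =
  2 + q * (s / ((s + t) / 2) + t / ((s + t) / 2) - 2)); last by ring.
rewrite e subrr mulr0 addr0; lra.
Qed.

Lemma powR_normM2 p u : `|u| `^ p = (u ^+ 2) `^ (p / 2).
Proof.
rewrite -real_normK ?num_real// -powR_mulrn// -powRrM; congr (_ `^ _).
by rewrite mulrCA divff ?mulr1// pnatr_eq0.
Qed.

(** Work with squares and the exponent [p / 2 >= 1]: superadditivity, the parallelogram identity,
    then convexity. *)
Lemma clarkson p u v : 2 <= p ->
  `|(u + v) / 2| `^ p + `|(u - v) / 2| `^ p <= (`|u| `^ p + `|v| `^ p) / 2.
Proof.
move=> p2; rewrite !powR_normM2; have q1 : 1 <= p / 2 by lra.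
apply: le_trans (powR_superadd q1 (sqr_ge0 _) (sqr_ge0 _)) _.
apply: le_trans (powR_midpoint q1 (sqr_ge0 _) (sqr_ge0 _)).
by rewrite (_ : _ + _ = (u ^+ 2 + v ^+ 2) / 2)//; field.
Qed.

Lemma powR_normD_le p u v : 1 <= p ->
  `|u + v| `^ p <= 2 `^ p * (`|u| `^ p + `|v| `^ p).
Proof.
move=> p1; have := powR_midpoint p1 (normr_ge0 u) (normr_ge0 v).
have h : `|u + v| `^ p <= 2 `^ p * ((`|u| + `|v|) / 2) `^ p.
  rewrite -powRM// ?divr_ge0// ?addr_ge0// mulrC divfK//.
  by apply: ge0_ler_powR; rewrite ?nnegrE ?addr_ge0 ?ler_normD//; lra.
move=> k; apply: (le_trans h); rewrite ler_wpM2l ?powR_ge0//.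
have := powR_ge0 `|u| p; have := powR_ge0 `|v| p; lra.
Qed.

End scalar_inequalities.

(** Cauchy-Schwarz, from Lagrange's identity. *)
Lemma sqr_sum_le (R : realType) (I : finType) (x y : I -> R) :
  (\sum_i x i * y i) ^+ 2 <= (\sum_i x i ^+ 2) * (\sum_i y i ^+ 2).
Proof.
have : 0 <= \sum_i \sum_j (x i * y j - x j * y i) ^+ 2.
  by apply: sumr_ge0 => i _; apply: sumr_ge0 => j _; exact: sqr_ge0.
have e (f g : I -> R) : (\sum_i f i) * (\sum_i g i) = \sum_i \sum_j f i * g j.
  by rewrite big_distrl; apply: eq_bigr => i _; rewrite big_distrr.
have E1 := e (fun i => x i ^+ 2) (fun i => y i ^+ 2).
have E2 := e (fun i => y i ^+ 2) (fun i => x i ^+ 2).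
have E3 := e (fun i => x i * y i) (fun i => x i * y i).
suff -> : \sum_i \sum_j (x i * y j - x j * y i) ^+ 2 =
    \sum_i \sum_j x i ^+ 2 * y j ^+ 2 + \sum_i \sum_j y i ^+ 2 * x j ^+ 2
    - 2 * \sum_i \sum_j x i * y i * (x j * y j).
  by rewrite -E1 -E2 -E3; nra.
rewrite mulr_sumr -big_split -sumrB; apply: eq_bigr => i _ /=.
rewrite mulr_sumr -big_split -sumrB; apply: eq_bigr => j _ /=; ring.
Qed.

(** * Independent signs, unbiased and biased *)

Section random_signs.
Variables (R : realType) (I : finType).
Implicit Types (b c : I -> R) (F G : {ffun I -> bool} -> R).

Definition sgb (s : bool) : R := if s then 1 else -1.

(* Expectation over independent signs, the [i]-th of which has mean [b i]. *)
Definition bmean b F : R :=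
  \sum_(s : {ffun I -> bool}) (\prod_i ((1 + b i * sgb (s i)) / 2)) * F s.

Definition rad F : R := bmean (fun=> 0) F.

Lemma bmean_prod b (g : I -> bool -> R) :
  bmean b (fun s => \prod_i g i (s i)) =
  \prod_i ((1 + b i) / 2 * g i true + (1 - b i) / 2 * g i false).
Proof.
transitivity (\prod_i \sum_(s : bool) ((1 + b i * sgb s) / 2) * g i s).
  rewrite bigA_distr_bigA/=; apply: eq_bigr => s _.
  by rewrite -big_split.
by apply: eq_bigr => i _; rewrite big_bool/= mulr1 mulrN1.
Qed.

Lemma bmean1 b : bmean b (fun=> 1) = 1.
Proof.
transitivity (bmean b (fun s => \prod_i (fun _ _ => 1) i (s i))).
  by apply: eq_bigr => s _; rewrite big1_eq.
by rewrite (bmean_prod b (fun _ _ => 1)) big1// => i _; field.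
Qed.

Lemma bmeanD b F G : bmean b (fun s => F s + G s) = bmean b F + bmean b G.
Proof. by rewrite /bmean -big_split/=; apply: eq_bigr => s _; rewrite mulrDr. Qed.

Lemma bmeanZ b a F : bmean b (fun s => a * F s) = a * bmean b F.
Proof. by rewrite /bmean big_distrr/=; apply: eq_bigr => s _; rewrite mulrCA. Qed.

Lemma bmean_cst b a : bmean b (fun=> a) = a.
Proof.
rewrite -[RHS]mulr1 -[X in _ = _ * X](bmean1 b) -bmeanZ.
by apply: eq_bigr => s _; rewrite mulr1.
Qed.

Lemma bmean_sum b (J : finType) (P : pred J) (F : J -> {ffun I -> bool} -> R) :
  bmean b (fun s => \sum_(j | P j) F j s) = \sum_(j | P j) bmean b (F j).
Proof.
by rewrite /bmean exchange_big/=; apply: eq_bigr => s _; rewrite big_distrr.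
Qed.

Lemma sgb_weight_ge0 (a : R) s : `|a| <= 1 -> 0 <= (1 + a * sgb s) / 2.
Proof. by rewrite ler_norml => /andP[? ?]; case: s => /=; lra. Qed.

Lemma bmean_le b F G : (forall i, `|b i| <= 1) -> (forall s, F s <= G s) ->
  bmean b F <= bmean b G.
Proof.
move=> b1 FG; apply: ler_sum => s _; apply: ler_wpM2l => //.
by apply: prodr_ge0 => i _; exact: sgb_weight_ge0.
Qed.

Lemma rad_le F G : (forall s, F s <= G s) -> rad F <= rad G.
Proof. by apply: bmean_le => i; rewrite normr0. Qed.

Lemma rad_ge0 F : (forall s, 0 <= F s) -> 0 <= rad F.
Proof.
by move=> F0; rewrite -[X in X <= _](bmean_cst (fun=> 0) 0); exact: rad_le.
Qed.

Lemma radE F : rad F = \sum_s (2^-1) ^+ #|I| * F s.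
Proof.
apply: eq_bigr => s _; congr (_ * _).
rewrite -prodr_const; apply: eq_bigr => i _.
by rewrite mul0r addr0 mul1r.
Qed.

(** The terms [c i * (sgb (s i) - b i)] are centred and at most 1/2 in modulus, since [c i] is at
    most 1/4; so [expR_le_quad] applies, the linear terms average out, and the variance factor
    [1 - b i ^+ 2] is at most 1. *)
Lemma bmean_exp_le b c : (forall i, `|b i| <= 1) -> (forall i, `|c i| <= 4^-1) ->
  bmean b (fun s => expR (\sum_i c i * (sgb (s i) - b i))) <=
  expR (2 * \sum_i c i ^+ 2).
Proof.
move=> hb hc.
under [X in bmean _ X]funext => s do rewrite expR_sum.
rewrite (bmean_prod b (fun i s => expR (c i * (sgb s - b i)))).
rewrite mulr_sumr expR_sum; apply: ler_prod => i _; apply/andP; split.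
  move: (hb i); rewrite ler_norml => /andP[? ?].
  by rewrite addr_ge0// mulr_ge0 ?expR_ge0//; lra.
have := expR_ge1Dx (2 * c i ^+ 2).
move: (hb i) (hc i); rewrite !ler_norml => /andP[b1 b2] /andP[c1 c2] e /=.
have h1 : expR (c i * (1 - b i)) <=
  1 + c i * (1 - b i) + 2 * (c i * (1 - b i)) ^+ 2 by apply: expR_le_quad; nra.
have h2 : expR (c i * (-1 - b i)) <=
  1 + c i * (-1 - b i) + 2 * (c i * (-1 - b i)) ^+ 2 by apply: expR_le_quad; nra.
apply: le_trans e.
have h3 := ler_wpM2l (_ : 0 <= (1 + b i) / 2) h1.
have h4 := ler_wpM2l (_ : 0 <= (1 - b i) / 2) h2.
apply: le_trans (lerD (h3 _) (h4 _)) _; [lra|lra|].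
have : 0 <= c i ^+ 2 * b i ^+ 2 by rewrite mulr_ge0 ?sqr_ge0.
nra.
Qed.

Lemma rad_exp_le c :
  rad (fun s => expR (\sum_i c i * sgb (s i))) <= expR (2 * \sum_i c i ^+ 2).
Proof.
rewrite /rad; under [X in bmean _ X]funext => s do rewrite expR_sum.
rewrite (bmean_prod _ (fun i s => expR (c i * sgb s))).
rewrite mulr_sumr expR_sum; apply: ler_prod => i _ /=; rewrite mulr1 mulrN1.
have := expR_ge0 (c i); have := expR_ge0 (- c i); have := cosh_le (c i).
by move=> *; apply/andP; split; lra.
Qed.

(* The density of the biased signs with respect to the unbiased ones has second
   moment [\prod_i (1 + b i ^+ 2)]; apply Cauchy-Schwarz. *)
Lemma bmean_sqr_le b (A : pred {ffun I -> bool}) :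
  bmean b (fun s => (A s)%:R) ^+ 2 <=
  rad (fun s => (A s)%:R) * expR (\sum_i b i ^+ 2).
Proof.
have -> : bmean b (fun s => (A s)%:R) =
    rad (fun s => (\prod_i (1 + b i * sgb (s i))) * (A s)%:R).
  rewrite radE; apply: eq_bigr => s _.
  by rewrite big_split/= prodr_const -mulrA mulrCA.
pose w : R := (2^-1) ^+ #|I|.
have w0 : 0 <= w by rewrite exprn_ge0.
rewrite !radE -/w.
pose x (s : {ffun I -> bool}) : R := Num.sqrt w * \prod_i (1 + b i * sgb (s i)).
pose y (s : {ffun I -> bool}) : R := Num.sqrt w * (A s)%:R.
have -> : \sum_(s : {ffun I -> bool}) w * ((\prod_i (1 + b i * sgb (s i))) * (A s)%:R) =
    \sum_s x s * y s.
  by apply: eq_bigr => s _; rewrite /x /y mulrACA -expr2 sqr_sqrtr.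
apply: le_trans (sqr_sum_le x y) _; rewrite mulrC ler_pM//.
- by apply: sumr_ge0 => s _; exact: sqr_ge0.
- by apply: sumr_ge0 => s _; exact: sqr_ge0.
- apply: ler_sum => s _; rewrite /y exprMn sqr_sqrtr//.
  by case: (A s); rewrite ?expr1n ?expr0n.
have -> : \sum_s x s ^+ 2 = rad (fun s => \prod_i (1 + b i * sgb (s i)) ^+ 2).
  rewrite radE; apply: eq_bigr => s _.
  by rewrite /x exprMn sqr_sqrtr// prodrXl.
rewrite /rad (bmean_prod _ (fun i s => (1 + b i * sgb s) ^+ 2)) expR_sum.
apply: ler_prod => i _; rewrite /= mulr1 mulrN1.
have := expR_ge1Dx (b i ^+ 2); have := sqr_ge0 (1 + b i).
by have := sqr_ge0 (1 - b i) => *; apply/andP; split; nra.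
Qed.

End random_signs.

(** * Packing numbers from steered random walks *)

Definition dot (R : realType) (N : nat) (a b : 'I_N -> R) : R :=
  \sum_(i < N) a i * b i.

Section packing.
Variables (R : realType) (m N : nat) (x : 'I_m -> 'I_N -> R) (om : 'I_m -> R).
Variables (K s S : R).
Hypotheses (K0 : 0 < K) (s0 : 0 < s) (S0 : 0 < S) (m0 : (0 < m)%N).
Hypothesis xK : forall j, \sum_i x j i ^+ 2 <= K ^+ 2.
Hypotheses (om0 : forall j, 0 <= om j) (omS : \sum_j om j <= S).

Let l8 : R := ln (8 * m%:R).

Let l8_gt0 : 0 < l8.
Proof.
rewrite ln_gt0//; have : 1 <= m%:R :> R by rewrite ler1n.
lra.
Qed.

(** The walk makes [q] steps of length [s / Num.sqrt q%:R] along each of the [N] axes. With the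
    means [v i / (s * Num.sqrt q%:R)] it ends at [v] on average; [walk v w j] is the deviation of
    its endpoint from [v], tested against [x j]. *)
Let walk (v : 'I_N -> R) (q : nat) (w : {ffun 'I_N * 'I_q -> bool}) j : R :=
  s / Num.sqrt q%:R * (\sum_k x j k.1 * sgb R (w k)) - dot v (x j).

(** Each of the two closeness conditions fails with probability at most 1/4: the uniform one by
    exponential tails and a union bound over [2 * m] events, the weighted one by Markov's
    inequality. The lower bounds on [Num.sqrt q%:R] make single steps small enough for
    [bmean_exp_le]. *)
Let walk_close (v : 'I_N -> R) (q : nat) : (0 < q)%N ->
  (forall i, `|v i / (s * Num.sqrt q%:R)| <= 1) -> 4 <= Num.sqrt q%:R :> R ->
  4 * Num.sqrt l8 <= Num.sqrt q%:R ->
  2^-1 <= bmean (fun k => v k.1 / (s * Num.sqrt q%:R)) (fun w : {ffun 'I_N * 'I_q -> bool} =>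
    ([forall j, `|walk v w j| <= 3 * s * K * Num.sqrt l8] &&
     (\sum_j om j * walk v w j ^+ 2 <= 16 * expR 2 * s ^+ 2 * K ^+ 2 * S))%:R).
Proof.
move=> q0 hb q4 ql; pose U := @walk v q; rewrite -/U.
set b := fun k : 'I_N * 'I_q => v k.1 / (s * Num.sqrt q%:R).
have {}hb k : `|b k| <= 1 by exact: hb.
set u := 3 * s * K * Num.sqrt l8; set t := 16 * _ * _ * _ * _.
have sq0 : 0 < Num.sqrt q%:R :> R by rewrite sqrtr_gt0 ltr0n.
have sqq : Num.sqrt q%:R ^+ 2 = q%:R :> R by rewrite sqr_sqrtr.
have sl0 : 0 < Num.sqrt l8 by rewrite sqrtr_gt0.
have sumq (f : 'I_N -> R) : \sum_(k : 'I_N * 'I_q) f k.1 = q%:R * \sum_i f i.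
  rewrite -(pair_big xpredT xpredT (fun i _ => f i))/= mulr_sumr.
  by apply: eq_bigr => i _; rewrite sumr_const card_ord mulr_natl.
have UE w j l : l * U w j =
    \sum_k (l * (s / Num.sqrt q%:R) * x j k.1) * (sgb R (w k) - b k).
  rewrite /U /walk /b mulrBr [RHS](eq_bigr (fun k =>
    l * (s / Num.sqrt q%:R) * (x j k.1 * sgb R (w k))
    - l / q%:R * (v k.1 * x j k.1))); last first.
    move=> k _; rewrite (_ : l / q%:R = l / Num.sqrt q%:R ^+ 2); last by rewrite sqq.
    by field; rewrite !gt_eqF.
  rewrite sumrB -!mulr_sumr (sumq (fun i => v i * x j i)) /dot.
  congr (_ - _); first by rewrite [LHS]mulrA.
  by rewrite [RHS]mulrA divfK// pnatr_eq0 -lt0n.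
have xjK j i : `|x j i| <= K.
  rewrite -ler_sqr ?nnegrE ?normr_ge0 ?(ltW K0)// real_normK ?num_real//.
  apply: le_trans (xK j); rewrite (bigD1 i)//= lerDl sumr_ge0// => k _.
  exact: sqr_ge0.
have expU j (l : R) : `|l| * (s * K) * 4 <= Num.sqrt q%:R ->
    bmean b (fun w => expR (l * U w j)) <= expR (2 * (l ^+ 2 * (s * K) ^+ 2)).
  move=> hl; under [X in bmean _ X]funext => w do rewrite UE.
  apply: le_trans (bmean_exp_le hb _) _.
    move=> k; rewrite !normrM normfV (gtr0_norm sq0) (gtr0_norm s0).
    apply: (@le_trans _ _ (`|l| * (s / Num.sqrt q%:R) * K)).
      by rewrite ler_wpM2l// mulr_ge0// ltW// divr_gt0.
    rewrite mulrAC mulrA ler_pdivrMr// mulrC; lra.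
  rewrite ler_expR ler_wpM2l//.
  under eq_bigr => k _ do rewrite exprMn.
  rewrite -mulr_sumr (sumq (fun i => x j i ^+ 2)).
  rewrite mulrA (_ : (l * _) ^+ 2 * _ = (l * s) ^+ 2); last first.
    by rewrite -[X in _ * X]sqq -exprMn -mulrA divfK// gt_eqF.
  by rewrite !exprMn -mulrA ler_wpM2l ?sqr_ge0// ler_wpM2l ?sqr_ge0.
have sK0 : 0 < s * K by rewrite mulr_gt0.
have U2 j : bmean b (fun w => U w j ^+ 2) <= 4 * expR 2 * (s * K) ^+ 2.
  have e1 : ((s * K)^-1) ^+ 2 * (s * K) ^+ 2 = 1 by rewrite -exprMn mulVf ?expr1n ?gt_eqF.
  have h1 : bmean b (fun w => expR ((s * K)^-1 * U w j)) <= expR 2.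
    have := @expU j ((s * K)^-1); rewrite e1 mulr1; apply.
    by rewrite gtr0_norm ?invr_gt0// mulVf ?gt_eqF// mul1r.
  have h2 : bmean b (fun w => expR (- (s * K)^-1 * U w j)) <= expR 2.
    have := @expU j (- (s * K)^-1); rewrite sqrrN e1 mulr1; apply.
    by rewrite normrN gtr0_norm ?invr_gt0// mulVf ?gt_eqF// mul1r.
  apply: (@le_trans _ _ (bmean b (fun w => (2 * (s * K) ^+ 2) *
     (expR ((s * K)^-1 * U w j) + expR (- (s * K)^-1 * U w j))))).
    apply: bmean_le => // w; have := sqr_le_cosh ((s * K)^-1 * U w j).
    rewrite exprMn exprVn ler_pdivrMl ?exprn_gt0// mulNr; nra.
  rewrite bmeanZ bmeanD; have := sqr_ge0 (s * K); nra.
have t0 : 0 < t by rewrite /t !mulr_gt0 ?exprn_gt0 ?expR_gt0.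
pose V w := \sum_j om j * U w j ^+ 2.
have V0 w : 0 <= V w by apply: sumr_ge0 => j _; rewrite mulr_ge0 ?sqr_ge0.
have EV : bmean b (fun w => t^-1 * V w) <= 4^-1.
  rewrite bmeanZ bmean_sum ler_pdivrMl// /t.
  apply: (@le_trans _ _ (\sum_j om j * (4 * expR 2 * (s * K) ^+ 2))).
    by apply: ler_sum => j _; rewrite bmeanZ ler_wpM2l.
  rewrite -mulr_suml.
  apply: (@le_trans _ _ (S * (4 * expR 2 * (s * K) ^+ 2))).
    by apply: ler_wpM2r => //; have := expR_ge0 (2 : R); have := sqr_ge0 (s * K); nra.
  by rewrite exprMn le_eqVlt; apply/orP; left; apply/eqP; field.
(* With this parameter each of the two tails of [U w j] has the exponent [2 * l8 - 3 * l8 = - l8],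
   hence probability at most [1 / (8 * m)]. *)
pose l := Num.sqrt l8 / (s * K).
have l0 : 0 < l by rewrite divr_gt0.
have lu : l * u = 3 * l8.
  rewrite /l /u -[in RHS](sqr_sqrtr (ltW l8_gt0)); field.
  by rewrite !gt_eqF.
have ll : l ^+ 2 * (s * K) ^+ 2 = l8.
  by rewrite -exprMn divfK ?gt_eqF// sqr_sqrtr// ltW.
have E8 : expR (- l8) = (8 * m%:R)^-1.
  by rewrite expRN lnK// posrE mulr_gt0// ltr0n.
have ET j : bmean b (fun w => expR (l * U w j - l * u) + expR (- l * U w j - l * u))
    <= 4^-1 * m%:R^-1.
  rewrite bmeanD.
  have h1 : bmean b (fun w => expR (l * U w j - l * u)) <= expR (- l8).
    under [X in bmean _ X]funext => w do rewrite addrC expRD.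
    rewrite bmeanZ -ler_pdivlMl ?expR_gt0// -expRN -expRD.
      apply: le_trans (expU _ _ _) _.
        by rewrite gtr0_norm// /l divfK ?gt_eqF//; lra.
      by rewrite ll lu ler_expR; lra.
  have h2 : bmean b (fun w => expR (- l * U w j - l * u)) <= expR (- l8).
    under [X in bmean _ X]funext => w do rewrite addrC expRD.
    rewrite bmeanZ -ler_pdivlMl ?expR_gt0// -expRN -expRD.
      apply: le_trans (expU _ _ _) _.
        by rewrite normrN gtr0_norm// /l divfK ?gt_eqF//; lra.
      by rewrite sqrrN ll lu ler_expR; lra.
  rewrite E8 invfM in h1 h2.
  rewrite (_ : 4^-1 = 8^-1 + 8^-1 :> R); last by field.
  by rewrite mulrDl lerD.
have ETs : bmean b (fun w => \sum_j
    (expR (l * U w j - l * u) + expR (- l * U w j - l * u))) <= 4^-1.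
  rewrite bmean_sum; apply: (@le_trans _ _ (\sum_(j < m) 4^-1 * m%:R^-1)).
    by apply: ler_sum => j _; exact: ET.
  rewrite sumr_const card_ord -mulrnAr -[m%:R^-1 *+ m]mulr_natl mulfV ?mulr1//.
  by rewrite pnatr_eq0 -lt0n.
(* The indicator of success is at least 1 minus the sum of the Markov majorants of the two
   failures. *)
apply: (@le_trans _ _ (bmean b (fun w => 1 + (-1) * (t^-1 * V w +
    \sum_j (expR (l * U w j - l * u) + expR (- l * U w j - l * u)))))).
  rewrite bmeanD bmeanZ bmeanD bmean1; lra.
apply: bmean_le => // w.
have V1 : 0 <= t^-1 * V w by rewrite mulr_ge0// invr_ge0 ltW.
have T0 j : 0 <= expR (l * U w j - l * u) + expR (- l * U w j - l * u).
  by rewrite addr_ge0 ?expR_ge0.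
have T1 : 0 <= \sum_j (expR (l * U w j - l * u) + expR (- l * U w j - l * u)).
  by apply: sumr_ge0 => j _; exact: T0.
case: (boolP (_ && _)) => [_|]; first by rewrite /=; lra.
rewrite negb_and => /orP[|].
  rewrite negb_forall => /existsP[j]; rewrite -ltNge => uj.
  suff : 1 <= \sum_j (expR (l * U w j - l * u) + expR (- l * U w j - l * u)).
    by rewrite /=; lra.
  rewrite (bigD1 j)//=.
  apply: (@le_trans _ _ (expR (l * U w j - l * u) + expR (- l * U w j - l * u))).
    have e1 := expR_ge0 (l * U w j - l * u).
    have e2 := expR_ge0 (- l * U w j - l * u).
    have [Uj|Uj] := leP 0 (U w j).
      rewrite ger0_norm// in uj.
      have : 1 <= expR (l * U w j - l * u).
        by rewrite -expR0 ler_expR -mulrBr mulr_ge0; [|lra|lra].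
      lra.
    rewrite ltr0_norm// in uj.
    have : 1 <= expR (- l * U w j - l * u).
      by rewrite -expR0 ler_expR mulNr -mulrN -mulrBr mulr_ge0; [|lra|lra].
    lra.
  by rewrite lerDl sumr_ge0.
rewrite -ltNge => tV.
suff : 1 <= t^-1 * V w by rewrite /=; lra.
by rewrite ler_pdivlMl// mulr1 ltW.
Qed.

(** Steered towards [v a], the walk ends close to [v a] with probability at least 1/2, so by
    [bmean_sqr_le] the unbiased walk does so with probability at least [expR (- (D / s ^+ 2)) / 4].
    Separated points have disjoint events, whose probabilities sum to at most 1. The constants 6 and
    64 are 2 and 4 times those of [walk_close]. *)
Lemma packing_bound (n : nat) (v : 'I_n -> 'I_N -> R) (D : R) :
  (forall a, \sum_i v a i ^+ 2 <= D) ->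
  (forall a b, a != b ->
    (forall j, `|dot (v a) (x j) - dot (v b) (x j)| <= 6 * s * K * Num.sqrt l8) ->
    64 * expR 2 * s ^+ 2 * K ^+ 2 * S <
      \sum_j om j * (dot (v a) (x j) - dot (v b) (x j)) ^+ 2) ->
  n%:R <= 4 * expR (D / s ^+ 2).
Proof.
move=> vD sep.
case: n v vD sep => [|n] v vD sep; first by rewrite mulr_ge0 ?expR_ge0.
have D0 : 0 <= D.
  by apply: le_trans (vD ord0); rewrite sumr_ge0// => i _; exact: sqr_ge0.
have Ds0 : 0 <= D / s ^+ 2 by rewrite divr_ge0 ?sqr_ge0.
(* Many short steps: [q] has to make every bias at most 1 and to meet the size conditions of
   [walk_close]. *)
have [q hq] : exists q : nat, 16 * (1 + l8) + D / s ^+ 2 <= q%:R.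
  exists (Num.bound (16 * (1 + l8) + D / s ^+ 2)).
  by rewrite ltW// archi_boundP//; have := l8_gt0; lra.
have qR : 0 < q%:R :> R by have := l8_gt0; lra.
have q0 : (0 < q)%N by rewrite ltr0n in qR.
have sq0 : 0 < Num.sqrt q%:R :> R by rewrite sqrtr_gt0.
have sqq : Num.sqrt q%:R ^+ 2 = q%:R :> R by rewrite sqr_sqrtr// ltW.
have q4 : 4 <= Num.sqrt q%:R :> R.
  by rewrite -ler_sqr ?nnegrE ?sqrtr_ge0// sqq; have := l8_gt0; lra.
have ql : 4 * Num.sqrt l8 <= Num.sqrt q%:R.
  rewrite -ler_sqr ?nnegrE ?mulr_ge0 ?sqrtr_ge0// sqq exprMn sqr_sqrtr ?ltW//.
  by have := l8_gt0; lra.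
pose b a (k : 'I_N * 'I_q) := v a k.1 / (s * Num.sqrt q%:R).
have ssq0 : 0 < s * Num.sqrt q%:R by rewrite mulr_gt0.
have hb a i : `|v a i / (s * Num.sqrt q%:R)| <= 1.
  rewrite normrM normfV (gtr0_norm ssq0) ler_pdivrMr// mul1r.
  rewrite -ler_sqr ?nnegrE ?normr_ge0 ?(ltW ssq0)// real_normK ?num_real// exprMn sqq.
  have : v a i ^+ 2 <= D.
    apply: le_trans (vD a); rewrite (bigD1 i)//= lerDl sumr_ge0// => k _.
    exact: sqr_ge0.
  have : D <= s ^+ 2 * q%:R.
    by rewrite mulrC -ler_pdivrMr ?exprn_gt0//; have := l8_gt0; lra.
  lra.
have b2 a : \sum_k b a k ^+ 2 <= D / s ^+ 2.
  rewrite -(pair_big xpredT xpredT (fun i _ => (v a i / (s * Num.sqrt q%:R)) ^+ 2))/=.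
  rewrite (eq_bigr (fun i => v a i ^+ 2 / s ^+ 2)).
    by rewrite -mulr_suml ler_wpM2r// invr_ge0 sqr_ge0.
  move=> i _; rewrite sumr_const card_ord -[LHS]mulr_natr -[X in _ * X]sqq.
  by field; rewrite !gt_eqF.
pose U a := @walk (v a) q.
pose A a : pred {ffun 'I_N * 'I_q -> bool} := fun w =>
  [forall j, `|U a w j| <= 3 * s * K * Num.sqrt l8] &&
     (\sum_j om j * U a w j ^+ 2 <= 16 * expR 2 * s ^+ 2 * K ^+ 2 * S).
have PA a : 2^-1 <= bmean (b a) (fun w => (A a w)%:R).
  exact: (@walk_close (v a) q q0 (hb a) q4 ql).
have dis a c w : A a w -> A c w -> a = c.
  move=> /andP[/forallP Aa1 Aa2] /andP[/forallP Ac1 Ac2].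
  apply/eqP; case: eqVneq => // ac; exfalso.
  have dU j : dot (v a) (x j) - dot (v c) (x j) = U c w j - U a w j.
    by rewrite /U /walk; ring.
  suff : \sum_j om j * (dot (v a) (x j) - dot (v c) (x j)) ^+ 2 <=
    64 * expR 2 * s ^+ 2 * K ^+ 2 * S.
    rewrite leNgt => /negP; apply; apply: (sep a c ac) => j.
    rewrite dU; apply: le_trans (ler_normB _ _) _.
    by have := Aa1 j; have := Ac1 j; lra.
  apply: (@le_trans _ _ (\sum_j (2 * (om j * U a w j ^+ 2) + 2 * (om j * U c w j ^+ 2)))).
    apply: ler_sum => j _; rewrite dU.
    have : 0 <= om j * (U c w j + U a w j) ^+ 2 by rewrite mulr_ge0// sqr_ge0.
    lra.
  rewrite big_split/= -!mulr_sumr; lra.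
have PA0 a : 4^-1 <= rad (fun w => (A a w)%:R : R) * expR (D / s ^+ 2).
  have h1 := bmean_sqr_le (b a) (A a).
  have h2 : rad (fun w => (A a w)%:R : R) * expR (\sum_k b a k ^+ 2) <=
     rad (fun w => (A a w)%:R : R) * expR (D / s ^+ 2).
    rewrite ler_wpM2l ?ler_expR//.
    exact: rad_ge0.
  have := PA a; nra.
have : \sum_(a < n.+1) rad (fun w => (A a w)%:R : R) <= 1.
  rewrite -(bmean_sum _ xpredT) -[X in _ <= X](@bmean1 R ('I_N * 'I_q)%type (fun=> 0)).
  apply: rad_le => w.
  case: (pickP (fun a => A a w)) => [a Aa|none].
    rewrite (bigD1 a)//= Aa big1 ?addr0// => c ca.
    by case: (boolP (A c w)) => // /dis /(_ Aa) cea; rewrite cea eqxx in ca.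
  by rewrite big1// => a _; rewrite none.
have : \sum_(a < n.+1) 4^-1 <=
    (\sum_(a < n.+1) rad (fun w => (A a w)%:R : R)) * expR (D / s ^+ 2).
  by rewrite mulr_suml; apply: ler_sum => a _; exact: PA0.
rewrite sumr_const card_ord -[_ *+ n.+1]mulr_natr => h1 h2.
have : (\sum_(a < n.+1) rad (fun w => (A a w)%:R : R)) * expR (D / s ^+ 2) <=
  expR (D / s ^+ 2) by rewrite ler_piMl ?expR_ge0.
lra.
Qed.

End packing.

(** * Greedy nets and sums over ranks *)

Section greedy_nets.
Variables (R : realType) (J : finType).

(** Take a minimiser of [phi], discard everything close to it, and repeat. An element is discarded
    by a centre that was minimal while the element was still present; hence the inequality between
    the values of [phi]. *)
Lemma greedy_net (cl : rel J) (phi : J -> R) : reflexive cl -> symmetric cl ->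
  exists A : {set J},
    (forall x y, x \in A -> y \in A -> x != y -> ~~ cl x y) /\
    (forall t, exists2 y, y \in A & cl t y /\ phi y <= phi t).
Proof.
move=> clxx clC.
suff H n (B : {set J}) : (#|B| <= n)%N -> exists A : {set J}, [/\ A \subset B,
    (forall x y, x \in A -> y \in A -> x != y -> ~~ cl x y) &
    (forall t, t \in B -> exists2 y, y \in A & cl t y /\ phi y <= phi t)].
  have [A [_ h1 h2]] := H _ [set: J]%SET (leqnn _).
  by exists A; split => // t; apply: h2; rewrite inE.
elim: n B => [|n IH] B.
  rewrite leqn0 cards_eq0 => /eqP ->; exists finset.set0; split => //.
  - by move=> x y; rewrite inE.
  - by move=> x; rewrite inE.
have [-> _|[b bB]] := set_0Vmem B.
  exists finset.set0; split => //; first by move=> x y; rewrite inE.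
  by move=> x; rewrite inE.
move=> Bn; have [y0 y0B y0min] := @arg_minP _ _ J b (mem B) phi bB.
have [|A [AB A1 A2]] := IH [set t in B | ~~ cl t y0].
  rewrite -ltnS; apply: leq_trans Bn; apply: proper_card; apply/properP; split.
    by apply/fintype.subsetP => t; rewrite inE => /andP[].
  by exists y0 => //; rewrite inE clxx andbF.
exists (y0 |: A); split.
- rewrite finset.subUset finset.sub1set (y0B : y0 \in B) /=; apply: (fintype.subset_trans AB).
  by apply/fintype.subsetP => t; rewrite inE => /andP[].
- have Ay t : t \in A -> ~~ cl t y0.
    by move=> /(fintype.subsetP AB); rewrite inE => /andP[].
  move=> x y; rewrite !inE => /predU1P[->|xA] /predU1P[->|yA]; rewrite ?eqxx//.
  + by rewrite clC => _; exact: Ay.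
  + by move=> _; exact: Ay.
  + exact: A1.
- move=> t tB; case: (boolP (cl t y0)) => [ty|ty].
    by exists y0; rewrite ?setU11//; split => //; exact: y0min.
  have [|y yA [h1 h2]] := A2 t; first by rewrite inE tB.
  by exists y => //; rewrite inE yA orbT.
Qed.

(** In the order of [phi] the ranks are at least 1, 2, 3 and so on, ties only increasing them, so
    the sum is at most that of the inverse squares. The induction removes a maximiser, whose rank is
    the full cardinality, and carries the sharper bound [2 - n.+1%:R^-1]. *)
Lemma sum_rank_le2 (A : {set J}) (phi : J -> R) :
  \sum_(y in A) (#|[set z in A | phi z <= phi y]|%:R ^+ 2)^-1 <= 2 :> R.
Proof.
suff H n (B : {set J}) : #|B| = n.+1 ->
    \sum_(y in B) (#|[set z in B | phi z <= phi y]|%:R ^+ 2)^-1 <= 2 - n.+1%:R^-1 :> R.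
  case: (set_0Vmem A) => [->|[a aA]]; first by rewrite big_set0.
  have A0 : (0 < #|A|)%N by apply/card_gt0P; exists a.
  apply: (le_trans (H #|A|.-1 A _)); first by rewrite prednK.
  by rewrite gerBl.
elim: n B => [|n IH] B Bn.
  have /eqP/cards1P[a ->] := Bn; rewrite big_set1.
  rewrite (_ : [set z in _ | _] = [set a]%SET); last first.
    by apply/setP => z; rewrite !inE; case: eqP => // ->; rewrite lexx.
  by rewrite cards1 expr1n invr1; lra.
have [b bB] : exists b, b \in B by apply/card_gt0P; rewrite Bn.
have [y yB ymax] := @arg_maxP _ _ J b (mem B) phi bB.
have {}yB : y \in B by [].
have cardBy : #|B :\ y| = n.+1.
  by apply/eqP; rewrite -eqSS -Bn (cardsD1 y B) yB.
rewrite (big_setD1 y yB)/=.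
rewrite (_ : [set z in B | phi z <= phi y] = B); last first.
  by apply/setP => z; rewrite !inE andb_idr// => /ymax.
rewrite Bn.
have h : \sum_(z in B :\ y) (#|[set z0 in B | phi z0 <= phi z]|%:R ^+ 2)^-1 <=
    \sum_(z in B :\ y) (#|[set z0 in B :\ y | phi z0 <= phi z]|%:R ^+ 2)^-1 :> R.
  apply: ler_sum => z zB.
  have z0 : (0 < #|[set z0 in B :\ y | (phi z0 <= phi z)%R]|)%N.
    by apply/card_gt0P; exists z; rewrite inE zB lexx.
  have sub : (#|[set z0 in B :\ y | (phi z0 <= phi z)%R]| <=
      #|[set z0 in B | (phi z0 <= phi z)%R]|)%N.
    apply: subset_leq_card; apply/fintype.subsetP => t.
    by rewrite !inE => /andP[/andP[_ ->] ->].
  rewrite lef_pV2 ?posrE ?exprn_gt0 ?ltr0n//; last exact: leq_trans sub.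
  by rewrite ler_sqr ?nnegrE ?ler0n// ler_nat.
apply: le_trans (lerD (lexx _) (le_trans h (IH _ cardBy))) _.
have n1 : 0 < n.+1%:R :> R by rewrite ltr0n.
rewrite -(natr1 n.+1); set q : R := n.+1%:R in n1 *.
have q1 : 0 < q + 1 by lra.
rewrite -subr_ge0 (_ : _ - _ = q^-1 * (q + 1)^-1 ^+ 2); last first.
  by field; rewrite !gt_eqF.
by rewrite mulr_ge0 ?invr_ge0 ?sqr_ge0// ltW.
Qed.

End greedy_nets.

(** * Chaining with weighted links *)

Lemma sqrtrD_le (R : realType) (a b : R) : 0 <= a -> 0 <= b ->
  Num.sqrt (a + b) <= Num.sqrt a + Num.sqrt b.
Proof.
move=> a0 b0; rewrite -ler_sqr ?nnegrE ?addr_ge0 ?sqrtr_ge0//.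
rewrite sqrrD !sqr_sqrtr ?addr_ge0//.
by rewrite lerD2r lerDl mulrn_wge0// mulr_ge0 ?sqrtr_ge0.
Qed.

Lemma sqrtr_sum_le (R : realType) n (a : nat -> R) : (forall k, 0 <= a k) ->
  Num.sqrt (\sum_(k < n) a k) <= \sum_(k < n) Num.sqrt (a k).
Proof.
move=> a0; elim: n => [|n IH]; first by rewrite !big_ord0 sqrtr0.
rewrite !big_ord_recr/=; apply: le_trans (sqrtrD_le _ _) _ => //.
  exact: sumr_ge0.
by rewrite lerD2r.
Qed.

Lemma ln_inv_le (R : realType) (a b : R) : 0 < b -> expR (- a) <= b -> ln b^-1 <= a.
Proof.
by move=> b0; rewrite -[X in _ <= X -> _]lnK ?posrE// ler_expR lnV ?posrE// lerNl.
Qed.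

Section chaining.
Variables (R : realType) (m : nat) (J : finType) (c : J -> 'I_m -> R).
Variables (d : J -> J -> R) (rho0 : R) (phi g : nat -> J -> R).
Hypotheses (rho0_gt0 : 0 < rho0) (dxx : forall x, d x x = 0).
Hypotheses (dC : forall x y, d x y = d y x).
Hypothesis dtri : forall x y z, d x z <= d x y + d y z.
Hypothesis cd : forall x y, \sum_j (c x j - c y j) ^+ 2 <= d x y ^+ 2.
Hypothesis c_le : forall x, \sum_j c x j ^+ 2 <= rho0 ^+ 2.
Hypothesis diam : forall x y, d x y <= rho0.

Definition chain_radius k : R := rho0 * 8^-1 ^+ k.
Local Notation rho := chain_radius.

Hypothesis g_ge0 : forall k t, 0 <= g k t.
(** The bound may vary with [t], and it counts only points whose value of [phi k.+1] does not exceed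
    that of [t]. Entropy numbers uniform in [t] would not give a sum that is bounded along each
    chain. *)
Hypothesis entropy : forall k t x (Y : {set J}), d x t <= rho k ->
  (forall y, y \in Y -> d x y <= 2 * rho k /\ phi k.+1 y <= phi k.+1 t) ->
  (forall y z, y \in Y -> z \in Y -> y != z -> rho k.+1 < d y z) ->
  #|Y|%:R <= expR (g k t).

Let Z t (s : {ffun 'I_m -> bool}) : R := \sum_j c t j * sgb R (s j).

Let rho_gt0 k : 0 < rho k.
Proof. by rewrite mulr_gt0// exprn_gt0. Qed.

Let rhoS k : rho k.+1 = rho k / 8.
Proof. by rewrite /rho exprSr mulrA. Qed.

Let d_ge0 x y : 0 <= d x y.
Proof. by have := dtri x y x; rewrite dxx (dC y x); lra. Qed.

Let netP k : exists A : {set J},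
    (forall x y, x \in A -> y \in A -> x != y -> rho k < d x y) /\
    (forall t, exists2 y, y \in A & d t y <= rho k /\ phi k y <= phi k t).
Proof.
have [||A [A1 A2]] := @greedy_net R J (fun x y => d x y <= rho k) (phi k).
- by move=> x; rewrite dxx ltW.
- by move=> x y; rewrite dC.
by exists A; split => // x y xA yA xy; rewrite ltNge A1.
Qed.

Let net k : {set J} := projT1 (cid (netP k)).
Let net_sep k x y : x \in net k -> y \in net k -> x != y -> rho k < d x y.
Proof. exact: (projT2 (cid (netP k))).1. Qed.
Let net_cov k t : exists2 y, y \in net k & d t y <= rho k /\ phi k y <= phi k t.
Proof. exact: (projT2 (cid (netP k))).2. Qed.
Let proj k t : J := sval (cid2 (net_cov k t)).
Let proj_net k t : proj k t \in net k.
Proof. by rewrite /proj; case: cid2. Qed.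
Let proj_d k t : d t (proj k t) <= rho k.
Proof. by rewrite /proj; case: cid2 => ? ? []. Qed.
Let proj_phi k t : phi k (proj k t) <= phi k t.
Proof. by rewrite /proj; case: cid2 => ? ? []. Qed.

Let adm k x y := [&& x \in net k, y \in net k.+1 & d x y <= 2 * rho k].
Let cnt k x y := #|[set z | adm k x z & phi k.+1 z <= phi k.+1 y]|.

(* Sub-probability weights on the nets; the reciprocal weight of a link controls
   the number of links of at least that weight. *)
Let W := fix W k y : R := if k is k'.+1 then
  \sum_(x | adm k' x y) W k' x / (2 * (cnt k' x y)%:R ^+ 2)
  else (y \in net 0%N)%:R.
Let w k x y : R := W k x / (2 * (cnt k x y)%:R ^+ 2).

Let W_ge0 k x : 0 <= W k x.
Proof.
elim: k x => [|k IH] x /=; first by rewrite ler0n.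
by apply: sumr_ge0 => y _; rewrite divr_ge0// mulr_ge0 ?sqr_ge0.
Qed.

Let w_ge0 k x y : 0 <= w k x y.
Proof. by rewrite divr_ge0// mulr_ge0 ?sqr_ge0. Qed.

(** Points of the net at level 0 are more than [rho0] apart, which is the bound for the diameter; so
    all chains start at the same point. *)
Let net0_eq x y : x \in net 0%N -> y \in net 0%N -> x = y.
Proof.
move=> xN yN; apply/eqP; case: eqVneq => // xy.
by have := net_sep xN yN xy; have := diam x y; rewrite /rho expr0 mulr1; lra.
Qed.

(** The shares handed out by one [x] sum to at most 1 by [sum_rank_le2]; this is what the factor 2
    in the weights is for. *)
Let W_sum k : \sum_x W k x <= 1.
Proof.
elim: k => [|k IH] /=.
  case: (pickP (fun x => x \in net 0%N)) => [x0 x0N|none].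
    rewrite (bigD1 x0)//= x0N big1 ?addr0// => y yx.
    by case: (boolP (y \in _)) => // /net0_eq /(_ x0N) e; rewrite e eqxx in yx.
  by rewrite big1// => y _; rewrite (none y).
rewrite (exchange_big_dep xpredT)//=.
apply: le_trans IH; apply: ler_sum => x _.
under eq_bigr => y _ do rewrite invfM mulrA.
rewrite -mulr_sumr -[X in _ <= X]mulr1 -mulrA ler_wpM2l//.
rewrite ler_pdivrMl// mulr1.
have := sum_rank_le2 [set y | adm k x y] (phi k.+1).
apply: le_trans; rewrite le_eqVlt; apply/orP; left; apply/eqP.
apply: eq_big => [y|y _]; first by rewrite inE.
by congr (_ %:R ^+ 2)^-1; rewrite /cnt; apply: eq_card => z; rewrite !inE.
Qed.

Let adm_proj k t : adm k (proj k t) (proj k.+1 t).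
Proof.
rewrite /adm !proj_net/=; apply: le_trans (dtri _ t _) _.
have := proj_d k t; have := proj_d k.+1 t; rewrite rhoS dC.
by have := rho_gt0 k; rewrite [d t (proj k t)]dC; lra.
Qed.

Let cnt_gt0 k t : (0 < cnt k (proj k t) (proj k.+1 t))%N.
Proof.
by apply/card_gt0P; exists (proj k.+1 t); rewrite inE adm_proj lexx.
Qed.

(** Here the greedy choice of the nets enters: [phi k.+1] at the net point of [t] is at most its
    value at [t], so [entropy] at [t] covers all the links that are counted. *)
Let cnt_le k t : (cnt k (proj k t) (proj k.+1 t))%:R <= expR (g k t).
Proof.
apply: (@entropy k t (proj k t)); first by rewrite dC proj_d.
- move=> y; rewrite inE => /andP[/and3P[_ _ ?] h]; split => //.
  exact: le_trans h (proj_phi _ _).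
- move=> y z; rewrite !inE => /andP[/and3P[_ ? _] _] /andP[/and3P[_ ? _] _].
  exact: net_sep.
Qed.

Let w_proj k t : expR (- \sum_(l < k.+1) (1 + 2 * g l t)) <= w k (proj k t) (proj k.+1 t).
Proof.
have step l : expR (- \sum_(i < l) (1 + 2 * g i t)) <= W l (proj l t) ->
    expR (- \sum_(i < l.+1) (1 + 2 * g i t)) <= w l (proj l t) (proj l.+1 t).
  move=> h; rewrite big_ord_recr/= opprD expRD /w ler_pM ?expR_ge0//.
  rewrite expRN lef_pV2 ?posrE ?expR_gt0// ?mulr_gt0// ?exprn_gt0 ?ltr0n//.
  rewrite expRD ler_pM// ?sqr_ge0//; first by have := expR_ge1Dx (1 : R); lra.
  rewrite mulr_natl mulr2n expRD -expr2 ler_sqr ?nnegrE ?ler0n ?expR_ge0//.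
suff : expR (- \sum_(i < k) (1 + 2 * g i t)) <= W k (proj k t) by exact: step.
elim: k => [|k IH]; first by rewrite big_ord0 oppr0 expR0/= proj_net.
apply: le_trans (step _ IH) _.
rewrite /= (bigD1 (proj k t)) ?adm_proj//= lerDl sumr_ge0// => x _.
exact: w_ge0.
Qed.

(** Chosen so that the tail of a link, of order [expR (- (alpha k x y ^+ 2 / 8))], is at most its
    weight, which makes the tails summable over all links; the summand 1 keeps [alpha] at least 1,
    as [rad_pos_part] requires. *)
Let alpha k x y := Num.sqrt (8 * ln (w k x y)^-1 + 1).

Let alpha_proj k t : alpha k (proj k t) (proj k.+1 t) <=
  1 + \sum_(l < k.+1) (3 + 4 * Num.sqrt (g l t)).
Proof.
have w0 := lt_le_trans (expR_gt0 _) (w_proj k t).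
have h := ln_inv_le w0 (w_proj k t).
rewrite /alpha; apply: (@le_trans _ _ (Num.sqrt (1 + \sum_(l < k.+1) (8 + 16 * g l t)))).
  rewrite ler_sqrt ?addr_ge0 ?sumr_ge0//; last first.
    by move=> l _; rewrite addr_ge0// mulr_ge0.
  rewrite addrC lerD2l; apply: (@le_trans _ _ (8 * \sum_(l < k.+1) (1 + 2 * g l t))).
    by rewrite ler_wpM2l.
  by rewrite mulr_sumr; apply: ler_sum => l _; lra.
apply: le_trans (sqrtrD_le _ _) _ => //.
  by apply: sumr_ge0 => l _; rewrite addr_ge0// mulr_ge0.
rewrite sqrtr1 lerD2l.
apply: le_trans (@sqrtr_sum_le R k.+1 (fun l => 8 + 16 * g l t) _) _.
  by move=> l; rewrite addr_ge0// mulr_ge0.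
apply: ler_sum => l _; apply: le_trans (sqrtrD_le _ _) _ => //; first by rewrite mulr_ge0.
rewrite sqrtrM// lerD//.
  by rewrite -ler_sqr ?nnegrE ?sqrtr_ge0// sqr_sqrtr//; lra.
rewrite (_ : 16 = 4 ^+ 2 :> R); last by ring.
by rewrite sqrtr_sqr ger0_norm.
Qed.

(** The total overshoot of all links of level [k] dominates the overshoot along any chain, so one
    expectation per level suffices. Links of weight 0 are left out; by [w_proj] no chain uses
    them. *)
Let excess k s : R := \sum_(e : J * J | adm k e.1 e.2 && (0 < w k e.1 e.2))
  Num.max 0 (`|Z e.2 s - Z e.1 s| - 2 * rho k * alpha k e.1 e.2).

(** The positive part of [z - sig * a] is at most [l^-1 * expR (l * (z - sig * a))], and
    [l = a / (4 * sig)] minimises the resulting exponent [2 * l ^+ 2 * sig ^+ 2 - l * sig * a]. *)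
Let rad_pos_part x y (sig a : R) : 0 < sig -> 1 <= a -> d x y <= sig ->
  rad (fun s => Num.max 0 (`|Z y s - Z x s| - sig * a)) <=
  8 * sig * expR (- (a ^+ 2 / 8)).
Proof.
move=> sig0 a1 dxy; pose l := a / (4 * sig).
have l0 : 0 < l by rewrite divr_gt0; lra.
have ZB s : Z y s - Z x s = \sum_j (c y j - c x j) * sgb R (s j).
  by rewrite /Z -sumrB; apply: eq_bigr => j _; rewrite mulrBl.
have E (e : R) : e ^+ 2 = l ^+ 2 ->
    rad (fun s => expR (e * (Z y s - Z x s))) <= expR (a ^+ 2 / 8).
  move=> e2; under [X in rad X]funext => s do rewrite ZB mulr_sumr.
  under [X in rad X]funext => s do under eq_bigr => j _ do rewrite mulrA.
  apply: le_trans (rad_exp_le _) _; rewrite ler_expR.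
  under eq_bigr => j _ do rewrite exprMn e2.
  rewrite -mulr_sumr; have h1 := cd y x.
  have h2 : d y x ^+ 2 <= sig ^+ 2 by rewrite (dC y x) ler_sqr ?nnegrE ?d_ge0 ?(ltW sig0).
  have h3 : l ^+ 2 * \sum_j (c y j - c x j) ^+ 2 <= l ^+ 2 * sig ^+ 2.
    by rewrite ler_wpM2l ?sqr_ge0//; lra.
  have h4 : l ^+ 2 * sig ^+ 2 = a ^+ 2 / 16 by rewrite /l; field; rewrite gt_eqF.
  lra.
apply: (@le_trans _ _ (rad (fun s => (l^-1 * expR (- (a ^+ 2 / 4))) *
   (expR (l * (Z y s - Z x s)) + expR (- l * (Z y s - Z x s)))))).
  apply: rad_le => s; set z := Z y s - Z x s.
  have e0 := expR_ge0 (l * z); have e1 := expR_ge0 (- l * z).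
  rewrite ge_max mulr_ge0 ?mulr_ge0 ?expR_ge0 ?addr_ge0 ?invr_ge0 ?(ltW l0)//=.
  rewrite -mulrA ler_pdivlMl//.
  have lsa : l * (sig * a) = a ^+ 2 / 4 by rewrite /l; field; rewrite gt_eqF.
  rewrite mulrBr lsa mulrDr -!expRD.
  have e2 := expR_ge1Dx (- (a ^+ 2 / 4) + l * z).
  have e3 := expR_ge1Dx (- (a ^+ 2 / 4) + - l * z).
  have := expR_ge0 (- (a ^+ 2 / 4) + l * z).
  have := expR_ge0 (- (a ^+ 2 / 4) + - l * z).
  by case: (ler0P z) => _; lra.
rewrite /rad bmeanZ bmeanD -!/(rad _).
have h1 := E l erefl; have h2 := E (- l) (sqrrN _).
have k0 : 0 <= l^-1 * expR (- (a ^+ 2 / 4)) by rewrite mulr_ge0 ?expR_ge0 ?invr_ge0// ltW.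
apply: le_trans (ler_wpM2l k0 (lerD h1 h2)) _.
rewrite (_ : - (a ^+ 2 / 4) = - (a ^+ 2 / 8) + - (a ^+ 2 / 8)); last by field.
rewrite expRD (expRN (a ^+ 2 / 8)); set q := expR (a ^+ 2 / 8).
have q0 : 0 < q by exact: expR_gt0.
rewrite [X in X <= _](_ : _ = 8 * sig * q^-1 * a^-1); last first.
  by rewrite /l; field; rewrite !gt_eqF//; lra.
by rewrite ler_piMr ?mulr_ge0 ?invr_ge0 ?(ltW q0) ?(ltW sig0)// invf_le1//; lra.
Qed.

Let rad_excess k : rad (excess k) <= 16 * rho k.
Proof.
rewrite /rad bmean_sum -!/(rad _).
apply: (@le_trans _ _ (\sum_(e : J * J | adm k e.1 e.2 && (0 < w k e.1 e.2))
    16 * rho k * w k e.1 e.2)).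
  apply: ler_sum => -[x y] /= /andP[/and3P[xN yN dxy] w0].
  have adxy : adm k x y by rewrite /adm xN yN.
  have w1 : ln (w k x y)^-1 >= 0.
    rewrite lnV ?posrE// oppr_ge0 ln_le0//.
    apply: (@le_trans _ _ (W k.+1 y)).
      rewrite /= (bigD1 x adxy)/= lerDl sumr_ge0// => z _; exact: w_ge0.
    apply: le_trans (W_sum k.+1).
    by rewrite [leRHS](bigD1 y)//= lerDl; apply: sumr_ge0 => z _; exact: (W_ge0 k.+1).
  have r0 := rho_gt0 k.
  have a1 : 1 <= alpha k x y.
    by rewrite -[X in X <= _]sqrtr1 ler_sqrt; lra.
  have := @rad_pos_part x y (2 * rho k) (alpha k x y) _ a1 dxy.
  rewrite sqr_sqrtr; last lra.
  move=> /(_ _)/le_trans; apply; first lra.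
  rewrite (_ : - _ = - ln (w k x y)^-1 + - 8^-1); last by field.
  rewrite expRD lnV ?posrE// opprK lnK ?posrE//.
  have : expR (- 8^-1) <= 1 :> R by rewrite expR_le1; lra.
  have : 0 <= rho k * w k x y by rewrite mulr_ge0// ltW.
  by nra.
rewrite -mulr_sumr -[X in _ <= X]mulr1 ler_wpM2l ?(mulr_ge0 _ (ltW (rho_gt0 k)))//.
apply: le_trans (W_sum k.+1) => /=.
rewrite (exchange_big_dep xpredT)//= pair_big_dep/=.
rewrite [leRHS](bigID (fun e : J * J => 0 < w k e.1 e.2))/= lerDl.
by apply: sumr_ge0 => e _; exact: w_ge0.
Qed.

Let Z_dist_le x y s : `|Z x s - Z y s| <= Num.sqrt m%:R * d x y.
Proof.
have -> : Z x s - Z y s = \sum_j (c x j - c y j) * sgb R (s j).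
  by rewrite /Z -sumrB; apply: eq_bigr => j _; rewrite mulrBl.
rewrite -ler_sqr ?nnegrE ?mulr_ge0 ?sqrtr_ge0// real_normK ?num_real//.
apply: le_trans (sqr_sum_le _ _) _; rewrite exprMn sqr_sqrtr// mulrC.
rewrite ler_pM ?sumr_ge0//; try by move=> *; rewrite sqr_ge0.
rewrite (eq_bigr (fun=> 1)) ?sumr_const ?card_ord// => j _.
by case: (s j); rewrite /= ?sqrrN expr1n.
Qed.

Let rad_normZ x : rad (fun s => `|Z x s|) <= 2 * expR 2 * rho0.
Proof.
apply: (@le_trans _ _ (rad (fun s => rho0 *
    (expR (rho0^-1 * Z x s) + expR (- rho0^-1 * Z x s))))).
  apply: rad_le => s; rewrite -ler_pdivrMl//.
  have e1 := expR_ge1Dx (rho0^-1 * Z x s).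
  have e2 := expR_ge1Dx (- rho0^-1 * Z x s).
  have := expR_ge0 (rho0^-1 * Z x s); have := expR_ge0 (- rho0^-1 * Z x s).
  by case: (ler0P (Z x s)) => _; lra.
rewrite /rad bmeanZ bmeanD -!/(rad _).
have E (e : R) : e ^+ 2 = rho0 ^- 2 -> rad (fun s => expR (e * Z x s)) <= expR 2.
  move=> e2; under [X in rad X]funext => s do rewrite /Z mulr_sumr.
  under [X in rad X]funext => s do under eq_bigr => j _ do rewrite mulrA.
  apply: le_trans (rad_exp_le _) _; rewrite ler_expR -[X in _ <= X]mulr1 ler_wpM2l//.
  under eq_bigr => j _ do rewrite exprMn e2.
  by rewrite -mulr_sumr ler_pdivrMl ?exprn_gt0// mulr1.
have h1 : rad (fun s => expR (rho0^-1 * Z x s)) <= expR 2 by apply: E; rewrite exprVn.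
have h2 : rad (fun s => expR (- rho0^-1 * Z x s)) <= expR 2.
  by apply: E; rewrite sqrrN exprVn.
by have := ler_wpM2l (ltW rho0_gt0) (lerD h1 h2); lra.
Qed.

Let sum_rho n : \sum_(k < n) rho k <= 2 * rho0.
Proof.
suff : \sum_(k < n) rho k + 8 / 7 * rho n = 8 / 7 * rho0.
  by have := rho_gt0 n; have := rho0_gt0; lra.
elim: n => [|n IH]; first by rewrite big_ord0 /rho expr0; ring.
by rewrite big_ord_recr/= rhoS -IH; field.
Qed.

(** Exchange the sums: the radii from level [l] on add up to at most [8 / 7 * rho l]. Thus a weight
    that pays for all earlier levels costs only a constant factor. *)
Let sum_rho_partial n (a : nat -> R) : (forall k, 0 <= a k) ->
  \sum_(k < n) rho k * (\sum_(l < k.+1) a l) <= 8 / 7 * \sum_(k < n) rho k * a k.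
Proof.
move=> a0.
suff : \sum_(k < n) rho k * (\sum_(l < k.+1) a l) + 8 / 7 * rho n * \sum_(l < n) a l
    = 8 / 7 * \sum_(k < n) rho k * a k.
  have : 0 <= rho n * \sum_(l < n) a l by rewrite mulr_ge0 ?sumr_ge0// ltW.
  lra.
elim: n => [|n IH]; first by rewrite !big_ord0; ring.
rewrite big_ord_recr/= [in RHS]big_ord_recr/= mulrDr -IH rhoS.
by rewrite [\sum_(l < n.+1) a l]big_ord_recr/=; field.
Qed.

Let chain_sum n s t : `|Z t s| <= `|Z (proj 0%N t) s| +
  \sum_(k < n) (excess k s + 2 * rho k * alpha k (proj k t) (proj k.+1 t)) +
  Num.sqrt m%:R * rho n.
Proof.
have -> : Z t s = Z (proj 0%N t) s +
    \sum_(k < n) (Z (proj k.+1 t) s - Z (proj k t) s) + (Z t s - Z (proj n t) s).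
  elim: n => [|n IH]; first by rewrite big_ord0; ring.
  by rewrite {1}IH big_ord_recr/=; ring.
apply: le_trans (ler_normD _ _) _; apply: lerD; last first.
  by apply: le_trans (Z_dist_le _ _ _) _; rewrite ler_wpM2l ?sqrtr_ge0.
apply: le_trans (ler_normD _ _) _; rewrite lerD2l.
apply: le_trans (ler_norm_sum _ _ _) _; apply: ler_sum => k _.
have w0 := lt_le_trans (expR_gt0 _) (w_proj k t).
rewrite -lerBlDr /excess (bigD1 (proj k t, proj k.+1 t))/= ?adm_proj ?w0//.
set M := Num.max 0 _; apply: (@le_trans _ _ M); first by rewrite le_max lexx orbT.
by rewrite lerDl sumr_ge0// => e _; rewrite le_max lexx.
Qed.

(** The supremum over [J] is expressed by a selector [tau] that may depend on the signs in any way,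
    so that it can pick a maximiser. The last term is the error of stopping the chains at level
    [n]. *)
Lemma chaining_bound (n : nat) (B : R) (tau : {ffun 'I_m -> bool} -> J) :
  (forall t, \sum_(k < n) rho k * Num.sqrt (g k t) <= B) ->
  rad (fun s => `|\sum_j c (tau s) j * sgb R (s j)|) <=
  (2 * expR 2 + 60) * rho0 + 20 * B + Num.sqrt m%:R * rho n.
Proof.
move=> hB; pose x0 := proj 0%N (tau [ffun=> true]).
have projE t : proj 0%N t = x0 by apply: net0_eq; exact: proj_net.
have G t : \sum_(k < n) 2 * rho k * alpha k (proj k t) (proj k.+1 t) <=
    20 * rho0 + 20 * B.
  apply: (@le_trans _ _ (\sum_(k < n) 2 * rho k *
      (1 + \sum_(l < k.+1) (3 + 4 * Num.sqrt (g l t))))).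
    by apply: ler_sum => k _; rewrite ler_wpM2l// mulr_ge0// ltW.
  have e1 : \sum_(k < n) 2 * rho k * (1 + \sum_(l < k.+1) (3 + 4 * Num.sqrt (g l t))) =
      2 * \sum_(k < n) rho k +
      2 * \sum_(k < n) rho k * \sum_(l < k.+1) (3 + 4 * Num.sqrt (g l t)).
    by rewrite !mulr_sumr -big_split; apply: eq_bigr => k _; rewrite /=; ring.
  have e2 : \sum_(k < n) rho k * (3 + 4 * Num.sqrt (g k t)) =
      3 * \sum_(k < n) rho k + 4 * \sum_(k < n) rho k * Num.sqrt (g k t).
    by rewrite !mulr_sumr -big_split; apply: eq_bigr => k _; rewrite /=; ring.
  have h1 := @sum_rho_partial n (fun l => 3 + 4 * Num.sqrt (g l t)).
  have {h1} := h1 (fun k => addr_ge0 (ler0n R 3) (mulr_ge0 (ler0n R 4) (sqrtr_ge0 _))).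
  rewrite e1 e2.
  have := hB t; have := sum_rho n; have := rho0_gt0.
  have : 0 <= \sum_(k < n) rho k * Num.sqrt (g k t).
    by apply: sumr_ge0 => k _; rewrite mulr_ge0 ?sqrtr_ge0// ltW.
  lra.
apply: (@le_trans _ _ (rad (fun s => `|Z x0 s| + (\sum_(k < n) excess k s +
    (20 * rho0 + 20 * B + Num.sqrt m%:R * rho n))))).
  apply: rad_le => s; have := chain_sum n s (tau s); rewrite projE big_split/=.
  by have := G (tau s); rewrite -/(Z (tau s) s); lra.
rewrite /rad bmeanD bmeanD bmean_cst (bmean_sum _ xpredT) -!/(rad _).
have h : \sum_(k < n) rad (excess k) <= 32 * rho0.
  apply: (@le_trans _ _ (\sum_(k < n) 16 * rho k)).
    by apply: ler_sum => k _; exact: rad_excess.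
  by rewrite -mulr_sumr; have := sum_rho n; lra.
by have := rad_normZ x0; have := rho0_gt0; lra.
Qed.

End chaining.

Lemma sqr_le (R : realType) (a b : R) : 0 <= a -> a <= b -> a ^+ 2 <= b ^+ 2.
Proof. by move=> a0 ab; rewrite ler_sqr ?nnegrE//; exact: le_trans ab. Qed.

Lemma l2_triangle (R : realType) (I : finType) (a b : I -> R) :
  Num.sqrt (\sum_i (a i + b i) ^+ 2) <=
  Num.sqrt (\sum_i a i ^+ 2) + Num.sqrt (\sum_i b i ^+ 2).
Proof.
have s0 (f : I -> R) : 0 <= \sum_i f i ^+ 2 by apply: sumr_ge0 => i _; exact: sqr_ge0.
rewrite -ler_sqr ?nnegrE ?addr_ge0 ?sqrtr_ge0// sqrrD !sqr_sqrtr ?s0//.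
have -> : \sum_i (a i + b i) ^+ 2 =
    \sum_i a i ^+ 2 + (\sum_i a i * b i) *+ 2 + \sum_i b i ^+ 2.
  by rewrite -sumrMnl -!big_split/=; apply: eq_bigr => i _; rewrite sqrrD.
rewrite lerD2r lerD2l lerMn2r/= -sqrtrM ?s0//.
apply: le_trans (ler_norm _) _.
rewrite -sqrtr_sqr ler_sqrt ?mulr_ge0 ?s0//; exact: sqr_sum_le.
Qed.

Section dot_theory.
Variables (R : realType) (N : nat).
Implicit Types a b y : 'I_N -> R.

Lemma dotDl a b y : dot (fun i => a i + b i) y = dot a y + dot b y.
Proof. by rewrite /dot -big_split/=; apply: eq_bigr => i _; rewrite mulrDl. Qed.

Lemma dotBl a b y : dot (fun i => a i - b i) y = dot a y - dot b y.
Proof. by rewrite /dot -sumrB/=; apply: eq_bigr => i _; rewrite mulrBl. Qed.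

Lemma dotZl (l : R) a y : dot (fun i => a i * l) y = dot a y * l.
Proof. by rewrite /dot mulr_suml; apply: eq_bigr => i _; rewrite mulrAC. Qed.

Lemma dot_mid a b y : dot (fun i => (a i + b i) / 2) y = (dot a y + dot b y) / 2.
Proof. by rewrite (dotZl 2^-1 (fun i => a i + b i)) dotDl. Qed.

Lemma dot_half_sub a b y :
  dot (fun i => (a i - b i) / 2) y = (dot a y - dot b y) / 2.
Proof. by rewrite (dotZl 2^-1 (fun i => a i - b i)) dotBl. Qed.

End dot_theory.

(** * Chaining on the unit ball of a uniformly convex energy *)

Section convex_process.
Variables (R : realType) (p : R) (m N : nat) (x : 'I_m -> 'I_N -> R).
Variables (nn : ('I_N -> R) -> R) (K S : R).
Hypotheses (p2 : 2 <= p) (m2 : (2 <= m)%N) (K0 : 0 < K) (S0 : 0 < S).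
Hypothesis xK : forall j, \sum_i x j i ^+ 2 <= K ^+ 2.
Hypothesis nn_ge0 : forall a, 0 <= nn a.
Hypothesis nn_clarkson : forall a b,
  nn (fun i => (a i + b i) / 2) + nn (fun i => (a i - b i) / 2) <= (nn a + nn b) / 2.
Hypothesis nn_l2 : forall a, nn a <= 1 -> \sum_i a i ^+ 2 <= 1.
Hypothesis nnS : forall a, \sum_j `|dot a (x j)| `^ p <= S * nn a.

Definition ev a j := dot a (x j).
Definition spow_ev a j := spow p (ev a j).
Definition sdist a b := Num.sqrt (\sum_j (spow_ev a j - spow_ev b j) ^+ 2).
(** A bound for the Euclidean norm of the vector of p-th powers on the unit ball: of the two factors
    [p] in the exponent, one is bounded by [K] and the other is summed by [nnS]. Twice this bounds
    the diameter for [sdist]. *)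
Definition scale := Num.sqrt (K `^ p * S).
Definition energy (a : 'I_N -> R) := \sum_i a i ^+ 2 + nn a.

Let p0 : 0 < p. Proof. by have := p2; lra. Qed.
Let pn0 : p != 0. Proof. by rewrite gt_eqF. Qed.

Let Kp0 : 0 < K `^ p. Proof. exact: powR_gt0. Qed.

Let scale_gt0 : 0 < scale. Proof. by rewrite sqrtr_gt0 mulr_gt0. Qed.

Let scale2 : scale ^+ 2 = K `^ p * S.
Proof. by rewrite sqr_sqrtr// mulr_ge0// ltW. Qed.

Let ev_le a j : nn a <= 1 -> `|ev a j| <= K.
Proof.
move=> a1; rewrite -ler_sqr ?nnegrE ?(ltW K0)// real_normK ?num_real//.
apply: le_trans (sqr_sum_le _ _) _; rewrite -[leRHS]mul1r.
apply: ler_pM; rewrite ?sumr_ge0//; try by move=> *; rewrite sqr_ge0.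
exact: nn_l2.
Qed.

Let energy_ge0 (a : 'I_N -> R) : 0 <= energy a.
Proof. by rewrite addr_ge0// sumr_ge0// => i _; exact: sqr_ge0. Qed.

Let energy_le2 a : nn a <= 1 -> energy a <= 2.
Proof. by move=> a1; have := nn_l2 a1; rewrite /energy; lra. Qed.

Let nn_mid a b : nn a <= 1 -> nn b <= 1 -> nn (fun i => (a i + b i) / 2) <= 1.
Proof. by have := nn_clarkson a b; have := nn_ge0 (fun i => (a i - b i) / 2); lra. Qed.

Let energy_mid (a b : 'I_N -> R) :
  energy (fun i => (a i + b i) / 2) + energy (fun i => (a i - b i) / 2) <= (energy a + energy b) / 2.
Proof.
have h := nn_clarkson a b.
have e : \sum_i ((a i + b i) / 2) ^+ 2 + \sum_i ((a i - b i) / 2) ^+ 2 =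
    (\sum_i a i ^+ 2 + \sum_i b i ^+ 2) / 2.
  by rewrite -!big_split/= mulr_suml; apply: eq_bigr => i _; field.
rewrite /energy; lra.
Qed.

Let sdist_ge0 a b : 0 <= sdist a b. Proof. exact: sqrtr_ge0. Qed.

Let sdist2 a b : sdist a b ^+ 2 = \sum_j (spow_ev a j - spow_ev b j) ^+ 2.
Proof. by rewrite sqr_sqrtr// sumr_ge0// => j _; exact: sqr_ge0. Qed.

Let sdistxx a : sdist a a = 0.
Proof. by rewrite /sdist big1 ?sqrtr0// => j _; rewrite subrr expr0n. Qed.

Let sdistC a b : sdist a b = sdist b a.
Proof. by rewrite /sdist; congr Num.sqrt; apply: eq_bigr => j _; rewrite -sqrrN opprB. Qed.

Let sdist_tri a b c : sdist a c <= sdist a b + sdist b c.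
Proof.
have := l2_triangle (fun j => spow_ev a j - spow_ev b j) (fun j => spow_ev b j - spow_ev c j).
by under eq_bigr => j _ do rewrite addrA subrK.
Qed.

Let sum_ev2p a : nn a <= 1 -> \sum_j (`|ev a j| `^ p) ^+ 2 <= scale ^+ 2.
Proof.
move=> a1; rewrite scale2; apply: (@le_trans _ _ (\sum_j K `^ p * `|ev a j| `^ p)).
  apply: ler_sum => j _; rewrite expr2 ler_wpM2r ?powR_ge0//.
  by apply: ge0_ler_powR; rewrite ?nnegrE ?(ltW p0) ?(ltW K0)// ev_le.
rewrite -mulr_sumr ler_wpM2l ?(ltW Kp0)//; apply: le_trans (nnS a) _.
by rewrite ler_piMr// ltW.
Qed.

Let sdist_diam a b : nn a <= 1 -> nn b <= 1 -> sdist a b <= 2 * scale.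
Proof.
move=> a1 b1; apply: le_trans (sdist_tri a (fun=> 0) b) _.
have h c : nn c <= 1 -> sdist c (fun=> 0) <= scale.
  move=> c1; rewrite -ler_sqr ?nnegrE ?(ltW scale_gt0)// sdist2.
  apply: le_trans (sum_ev2p c1); apply: ler_sum => j _.
  have -> : spow_ev (fun=> 0) j = 0.
    by rewrite /spow_ev /ev /dot big1 ?/spow ?sgr0 ?mul0r// => i _; rewrite mul0r.
  by rewrite subr0 -(norm_spow (ev c j) pn0) real_normK ?num_real.
by have := h a a1; have := h b b1; rewrite (sdistC _ b); lra.
Qed.

(* Monotonicity of [spow p] makes balls of [sdist] convex up to a factor. *)
Let sdist_mid a b c : sdist (fun i => (a i + b i) / 2) c ^+ 2 <= sdist a c ^+ 2 + sdist b c ^+ 2.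
Proof.
rewrite !sdist2 -big_split/=; apply: ler_sum => j _.
rewrite /spow_ev /ev dot_mid; set u := dot a _; set v := dot b _; set w := spow p (dot c _).
wlog uv : u v / u <= v => [hw|].
  have [/hw//|/ltW/hw] := leP u v.
  by rewrite [v + u]addrC [X in _ <= X -> _]addrC.
have h1 : spow p u <= spow p ((u + v) / 2) by apply: spow_mono => //; lra.
have h2 : spow p ((u + v) / 2) <= spow p v by apply: spow_mono => //; lra.
have [h|h] := leP w (spow p ((u + v) / 2)).
  have := sqr_ge0 (spow p u - w).
  have : (spow p ((u + v) / 2) - w) ^+ 2 <= (spow p v - w) ^+ 2.
    by rewrite ler_sqr ?nnegrE; lra.
  lra.
have := sqr_ge0 (spow p v - w).
have : (w - spow p ((u + v) / 2)) ^+ 2 <= (w - spow p u) ^+ 2.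
  by rewrite ler_sqr ?nnegrE; lra.
rewrite -[(w - _) ^+ 2]sqrrN opprB -[(w - spow p u) ^+ 2]sqrrN opprB; lra.
Qed.

Definition near_ball r a := [set y | nn y <= 1 /\ sdist a y <= r].
(** The infimum runs over the whole unit ball near [a], not only over the finite family to be
    chained, because midpoints must be admissible competitors. *)
Definition min_energy r a := inf [set energy y | y in near_ball r a].

Let min_energy_le r a y : nn y <= 1 -> sdist a y <= r -> min_energy r a <= energy y.
Proof.
move=> y1 ay; apply: ge_inf; last by exists y.
by exists 0 => _ [z _ <-]; exact: energy_ge0.
Qed.

Let min_energy_ge0 r a : 0 <= r -> nn a <= 1 -> 0 <= min_energy r a.
Proof.
move=> r0 a1; apply: lb_le_inf; first by exists (energy a), a; rewrite // /near_ball /= sdistxx.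
by move=> _ [z _ <-]; exact: energy_ge0.
Qed.

Let min_energy_le2 r a : 0 <= r -> nn a <= 1 -> min_energy r a <= 2.
Proof.
by move=> r0 a1; apply: le_trans (energy_le2 a1); apply: min_energy_le; rewrite ?sdistxx.
Qed.

Let min_energy_mono r r' a : 0 <= r -> r <= r' -> nn a <= 1 -> min_energy r' a <= min_energy r a.
Proof.
move=> r0 rr' a1; apply: lb_le_inf; first by exists (energy a), a; rewrite // /near_ball /= sdistxx.
by move=> _ [z [z1 az] <-]; apply: min_energy_le => //; exact: le_trans rr'.
Qed.

Let min_energy_near r a eta : 0 <= r -> nn a <= 1 -> 0 < eta ->
  exists y, [/\ nn y <= 1, sdist a y <= r & energy y <= min_energy r a + eta].
Proof.
move=> r0 a1 eta0.
have h : has_inf [set energy y | y in near_ball r a].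
  split; first by exists (energy a), a; rewrite // /near_ball /= sdistxx.
  by exists 0 => _ [z _ <-]; exact: energy_ge0.
have [_ [y [y1 ay] <-] hy] := inf_adherent eta0 h.
by exists y; split => //; exact: ltW.
Qed.

Definition log8m : R := ln (8 * m%:R).

Let m_ge2 : 2 <= m%:R :> R. Proof. by rewrite ler_nat. Qed.

Let log8m_ge1 : 1 <= log8m.
Proof.
rewrite -ler_expR lnK ?posrE; last by have := m_ge2; lra.
have := m_ge2; have : expR 1 <= 16 :> R; last lra.
have -> : expR 1 = expR 4^-1 ^+ 4 :> R by rewrite -expRM_natl; congr expR; field.
have h0 := expR_ge0 (4^-1 : R).
have h : expR 4^-1 <= 2 :> R by have := @expR_le_quad R 4^-1; nra.
have : expR 4^-1 ^+ 4 <= 2 ^+ 4 :> R by rewrite ler_pXn2r// nnegrE.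
by lra.
Qed.

(** In [CpE] the factor [p ^+ 2] comes from [spow_lip2] and the outer power of 2 from
    [powR_normD_le]; 128 is twice the 64 of [packing_bound], and 72 is twice the square of its 6. *)
Variable Cp : R.
Hypothesis CpE : Cp = p ^+ 2 * 2 `^ p * (128 * expR 2 + 72 * 2 `^ p).

Let Cp0 : 0 < Cp.
Proof.
have h := @powR_gt0 R 2 p ltac:(lra); have e := expR_gt0 (2 : R).
rewrite CpE; apply: mulr_gt0; last by lra.
by apply: mulr_gt0 => //; exact: exprn_gt0.
Qed.

(** 2048 is [4 * 512]: 512 comes from the step size in [entropy_bound], and 4 from doubling
    half-differences before squaring. *)
Variable Dp : R.
Hypothesis DpE : Dp = 2048 * Cp.

Let Dp0 : 0 < Dp.
Proof. by rewrite DpE; have := Cp0; lra. Qed.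

Local Notation rho := (chain_radius (2 * scale)).

Let rho_gt0 k : 0 < rho k.
Proof. by rewrite /chain_radius mulr_gt0 ?exprn_gt0// mulr_gt0. Qed.

Let rhoS k : rho k.+1 = rho k / 8.
Proof. by rewrite /chain_radius exprSr mulrA. Qed.

Let chain_radiusE k : rho k = 2 * scale * 8^-1 ^+ k. Proof. by []. Qed.

Let chain_radius0 : rho 0%N = 2 * scale.
Proof. by rewrite /chain_radius expr0 mulr1. Qed.

Let log8m_def : log8m = ln (8 * m%:R). Proof. by []. Qed.

Let scale_def : scale = Num.sqrt (K `^ p * S). Proof. by []. Qed.

Local Opaque sdist scale min_energy log8m chain_radius.

Let pos512 (a b q : R) : 0 < a -> 0 < b -> 0 < q -> 0 < 512 * a * b ^+ 2 * q.
Proof.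
move=> a0 b0 q0; apply: mulr_gt0 q0; apply: mulr_gt0; [lra|exact: exprn_gt0].
Qed.

Let separation_arith (r d0 d1 d2 d3 e : R) : 0 < r -> r / 8 < d0 ->
  d0 <= d1 + d2 -> d2 <= e + d3 -> d1 <= r / 8 / 8 -> d3 <= r / 8 / 8 ->
  e ^+ 2 <= r ^+ 2 / 512 -> False.
Proof.
move=> r0 h1 h2 h3 h4 h5 h6; have h7 : (r / 16) ^+ 2 <= e ^+ 2.
  by apply: sqr_le; lra.
have : 0 < r ^+ 2 by exact: exprn_gt0.
rewrite exprMn in h7; lra.
Qed.

Section entropy.
Variables (J : finType) (t : J -> 'I_N -> R) (eta : R).
Hypotheses (t1 : forall y, nn (t y) <= 1) (eta0 : 0 < eta).

(** The inner radius [rho k.+2] is an eighth of the separation at level [k.+1], so moving points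
    that far keeps them apart. The outer radius [8 * rho k] is large enough to contain the midpoints
    of the moved points. The slack [eta] allows for infima that are only approached. *)
Definition gap k y := min_energy (rho k.+2) (t y) + eta - min_energy (8 * rho k) (t y).

Let gap_gt0 k y : 0 < gap k y.
Proof.
have := @min_energy_mono (rho k.+2) (8 * rho k) (t y); rewrite !rhoS.
have := rho_gt0 k; rewrite /gap !rhoS => r0 h.
have : min_energy (8 * rho k) (t y) <= min_energy (rho k / 8 / 8) (t y) by apply: h => //; lra.
by have := eta0; lra.
Qed.

Definition entropy_bd k y : R := 2 + Dp * (scale ^+ 2 * (gap k y * (1 + log8m * gap k y)) / rho k ^+ 2).

Let entropy_bd_ge0 k y : 0 <= entropy_bd k y.
Proof.
have d0 := gap_gt0 k y; have l1 := log8m_ge1.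
have h : 0 <= gap k y * (1 + log8m * gap k y) by nra.
have c0 : 0 <= Dp by exact: ltW.
apply: addr_ge0 => //; apply: mulr_ge0 => //; apply: divr_ge0; last exact: sqr_ge0.
by apply: mulr_ge0 => //; exact: sqr_ge0.
Qed.

(** In [spow_lip2] the p-th powers at [z] and [z'] are compared with those at the fixed point [z1].
    The part weighted by [z1] is controlled by the weighted sum of [packing_bound]; in the remainder
    the square is bounded uniformly, at the price of [log8m], and the p-th powers of the differences
    sum to at most a multiple of [S * D]. *)
Let sdist_close z z' z1 s D : nn z <= 1 -> nn z' <= 1 -> nn z1 <= 1 -> 0 < s ->
  \sum_j `|ev z j - ev z1 j| `^ p <= 2 `^ p * (S * D) ->
  \sum_j `|ev z' j - ev z1 j| `^ p <= 2 `^ p * (S * D) ->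
  (forall j, `|ev z j - ev z' j| <= 6 * s * K * Num.sqrt log8m) ->
  \sum_j `|ev z1 j| `^ p * (ev z j - ev z' j) ^+ 2 <= 64 * expR 2 * s ^+ 2 * K ^+ 2 * S ->
  0 <= D ->
  sdist z z' ^+ 2 <= Cp * scale ^+ 2 * s ^+ 2 * (1 + log8m * D).
Proof.
move=> hz hz' hz1 s0 hD hD' hsup hw D0; rewrite sdist2.
have pp0 := @powR_gt0 R 2 p ltac:(lra).
have kp : K `^ (p - 2) * K ^+ 2 = K `^ p.
  rewrite -powR_mulrn ?(ltW K0)// -powRD ?subrK//.
  by rewrite (negbTE pn0).
pose A j := `|ev z1 j| `^ p * (ev z j - ev z' j) ^+ 2.
pose B j := `|ev z j - ev z1 j| `^ p + `|ev z' j - ev z1 j| `^ p.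
have hj j : (spow_ev z j - spow_ev z' j) ^+ 2 <= p ^+ 2 * K `^ (p - 2) *
    (2 `^ p * (2 * A j + 36 * s ^+ 2 * K ^+ 2 * log8m * B j)).
  apply: le_trans (spow_lip2 p2 (ev_le j hz) (ev_le j hz')) _.
  apply: ler_wpM2l; first by rewrite mulr_ge0 ?sqr_ge0 ?powR_ge0.
  have h1 : `|ev z j| `^ p <= 2 `^ p * (`|ev z1 j| `^ p + `|ev z j - ev z1 j| `^ p).
    rewrite -{1}[ev z j](subrK (ev z1 j)) addrC; apply: powR_normD_le.
    by have := p2; lra.
  have h2 : `|ev z' j| `^ p <= 2 `^ p * (`|ev z1 j| `^ p + `|ev z' j - ev z1 j| `^ p).
    rewrite -{1}[ev z' j](subrK (ev z1 j)) addrC; apply: powR_normD_le.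
    by have := p2; lra.
  have h3 : (ev z j - ev z' j) ^+ 2 <= 36 * s ^+ 2 * K ^+ 2 * log8m.
    rewrite -real_normK ?num_real//.
    have e : (6 * s * K * Num.sqrt log8m) ^+ 2 = 36 * s ^+ 2 * K ^+ 2 * log8m.
      rewrite !exprMn sqr_sqrtr; last by have := log8m_ge1; lra.
      by ring.
    rewrite -e ler_sqr ?nnegrE//.
    by rewrite !mulr_ge0 ?sqrtr_ge0 ?(ltW s0) ?(ltW K0).
  have h4 : 0 <= (ev z j - ev z' j) ^+ 2 by exact: sqr_ge0.
  apply: le_trans (ler_wpM2l h4 (lerD h1 h2)) _.
  have -> : (ev z j - ev z' j) ^+ 2 * (2 `^ p * (`|ev z1 j| `^ p + `|ev z j - ev z1 j| `^ p)
     + 2 `^ p * (`|ev z1 j| `^ p + `|ev z' j - ev z1 j| `^ p)) =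
     2 `^ p * (2 * A j + (ev z j - ev z' j) ^+ 2 * B j) by rewrite /A /B; ring.
  rewrite ler_wpM2l ?(ltW pp0)// lerD2l ler_wpM2r//.
  by rewrite addr_ge0 ?powR_ge0.
apply: le_trans (ler_sum _ (fun j _ => hj j)) _.
rewrite -!mulr_sumr big_split/= -!mulr_sumr.
have sB : \sum_j B j <= 2 * (2 `^ p * (S * D)) by rewrite big_split/=; lra.
have q0 : 0 <= 36 * s ^+ 2 * K ^+ 2 * log8m.
  have -> : 36 * s ^+ 2 * K ^+ 2 * log8m = (6 * s * K) ^+ 2 * log8m by ring.
  by apply: mulr_ge0; [exact: sqr_ge0|have := log8m_ge1; lra].
have h5 := ler_wpM2l q0 sB.
have h6 : 2 * \sum_j A j + 36 * s ^+ 2 * K ^+ 2 * log8m * \sum_j B j <=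
    s ^+ 2 * K ^+ 2 * S * ((128 * expR 2 + 72 * 2 `^ p) * (1 + log8m * D)).
  apply: (@le_trans _ _ (s ^+ 2 * K ^+ 2 * S * (128 * expR 2 + 72 * 2 `^ p * (log8m * D)))).
    by move: hw; rewrite -/(A _) => hw; rewrite mulrDr; lra.
  apply: ler_wpM2l.
    by apply: mulr_ge0; [apply: mulr_ge0; exact: sqr_ge0|exact: ltW].
  have e0 := expR_gt0 (2 : R).
  have : 0 <= log8m * D by rewrite mulr_ge0//; have := log8m_ge1; lra.
  nra.
have h7 : 0 <= p ^+ 2 * K `^ (p - 2) by rewrite mulr_ge0 ?sqr_ge0 ?powR_ge0.
apply: le_trans (ler_wpM2l h7 (ler_wpM2l (ltW pp0) h6)) _.
rewrite scale2 -kp CpE le_eqVlt; apply/orP; left; apply/eqP; ring.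
Qed.

(** Each point of [Y] is moved to a near-minimiser of the energy close by. Convexity makes the moved
    points mutually close, both in the Euclidean norm and in [nn], while they stay separated in
    [sdist]; [sdist_close] turns this into the separation that [packing_bound] needs. *)
Let entropy_bound k y x0 (Y : {set J}) : sdist (t x0) (t y) <= rho k ->
  (forall u, u \in Y -> sdist (t x0) (t u) <= 2 * rho k /\
     min_energy (rho k.+2) (t u) <= min_energy (rho k.+2) (t y)) ->
  (forall u v, u \in Y -> v \in Y -> u != v -> rho k.+1 < sdist (t u) (t v)) ->
  #|Y|%:R <= expR (entropy_bd k y).
Proof.
move=> x0y hY sepY; have rk := rho_gt0 k.
have near u := @min_energy_near (rho k.+2) (t u) eta (ltW (rho_gt0 _)) (t1 u) eta0.
have [z zP] := choice near.
have z1 u : nn (z u) <= 1 by have [] := zP u.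
have zd u : sdist (t u) (z u) <= rho k.+2 by have [] := zP u.
have zPsi u : energy (z u) <= min_energy (rho k.+2) (t u) + eta by have [] := zP u.
have zy u : u \in Y -> sdist (z u) (t y) <= 4 * rho k.
  move=> uY; have [h1 _] := hY u uY.
  have h2 := sdist_tri (z u) (t u) (t y); have h3 := sdist_tri (t u) (t x0) (t y).
  have h4 := zd u; rewrite !rhoS in h4.
  rewrite (sdistC (z u) (t u)) in h2; rewrite (sdistC (t u) (t x0)) in h3.
  move: h1 h2 h3 h4 x0y rk; generalize (sdist (t x0) (t u)) (sdist (z u) (t y))
    (sdist (t u) (z u)) (sdist (t u) (t y)) (sdist (t x0) (t y)) (rho k).
  by move=> *; lra.
(* The midpoint lies within [8 * rho k] of [t y], so its energy is at least the minimum there,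
   whereas both endpoints have energy at most [min_energy (rho k.+2) (t y) + eta]; [energy_mid]
   leaves at most the gap for the half-difference. *)
have dl u v : u \in Y -> v \in Y -> energy (fun i => (z u i - z v i) / 2) <= gap k y.
  move=> uY vY; have := energy_mid (z u) (z v).
  have : min_energy (8 * rho k) (t y) <= energy (fun i => (z u i + z v i) / 2).
    apply: min_energy_le; first exact: nn_mid.
    have r8 : 0 <= 8 * rho k by apply: mulr_ge0 => //; exact: ltW.
    rewrite sdistC -ler_sqr ?nnegrE ?sdist_ge0//; apply: le_trans (sdist_mid _ _ _) _.
    have h1 : sdist (z u) (t y) ^+ 2 <= (4 * rho k) ^+ 2.
      by apply: sqr_le => //; exact: zy.
    have h2 : sdist (z v) (t y) ^+ 2 <= (4 * rho k) ^+ 2.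
      by apply: sqr_le => //; exact: zy.
    move: h1 h2; generalize (sdist (z u) (t y) ^+ 2) (sdist (z v) (t y) ^+ 2) (rho k).
    by move=> a b r; have := sqr_ge0 r; lra.
  have := zPsi u; have := zPsi v; have [_] := hY u uY; have [_] := hY v vY.
  rewrite /gap; generalize (min_energy (rho k.+2) (t v)) (min_energy (rho k.+2) (t y))
    (min_energy (rho k.+2) (t u)) (energy (z v)) (energy (z u)) (min_energy (8 * rho k) (t y))
    (energy (fun i => (z u i + z v i) / 2)) (energy (fun i => (z u i - z v i) / 2)).
  by move=> *; lra.
have [->|[u1 u1Y]] := set_0Vmem Y; first by rewrite cards0 expR_ge0.
set D := gap k y in dl *; have D0 : 0 < D by exact: gap_gt0.
have Q0 : 0 < 1 + log8m * D by have := log8m_ge1; nra.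
(* With the step size [s] below, points that are not separated for [packing_bound] satisfy
   [sdist ^+ 2 <= rho k ^+ 2 / 512] by [sdist_close], which [separation_arith] excludes. *)
have [q qE] : exists q, q = 512 * Cp * scale ^+ 2 * (1 + log8m * D) by eexists.
have c0 : 0 < q by rewrite qE; exact: (pos512 Cp0 scale_gt0 Q0).
pose s := rho k / Num.sqrt q.
have s0 : 0 < s by rewrite divr_gt0// sqrtr_gt0.
have s2 : s ^+ 2 = rho k ^+ 2 / q.
  by rewrite /s exprMn exprVn sqr_sqrtr// ltW.
have evB u v j : dot (fun i => (z u i - z v i) / 2) (x j) = (ev (z u) j - ev (z v) j) / 2.
  exact: dot_half_sub.
have hp u : u \in Y -> \sum_j `|ev (z u) j - ev (z u1) j| `^ p <= 2 `^ p * (S * D).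
  move=> uY; have h := nnS (fun i => (z u i - z u1 i) / 2).
  have h2 : nn (fun i => (z u i - z u1 i) / 2) <= D.
    apply: le_trans (dl u u1 uY u1Y); rewrite /energy lerDr.
    by apply: sumr_ge0 => i _; exact: sqr_ge0.
  apply: (@le_trans _ _ (2 `^ p * \sum_j `|dot (fun i => (z u i - z u1 i) / 2) (x j)| `^ p)).
    rewrite mulr_sumr; apply: ler_sum => j _; rewrite evB.
    by rewrite -powRM// normrM [`|2^-1|]ger0_norm// mulrC divfK.
  rewrite ler_wpM2l ?powR_ge0//; apply: (le_trans h).
  by rewrite ler_wpM2l// ltW.
(* The family is centred at one of its own points [z u1], so that its squared radius is at most four
   times the gap; the same point supplies the weights. *)
pose v (a : 'I_#|Y|) i := z (enum_val a) i - z u1 i.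
have m0 : (0 < m)%N by exact: leq_trans m2.
have := @packing_bound R m N x (fun j => `|ev (z u1) j| `^ p) K s S K0 s0 S0 m0 xK.
move=> /(_ (fun j => powR_ge0 _ _) _ #|Y| v (4 * D)) H.
apply: (@le_trans _ _ (4 * expR (4 * D / s ^+ 2))).
  apply: H.
  - apply: le_trans (nnS _) _; rewrite ler_piMr// ltW//.
  - move=> a; have h := dl (enum_val a) u1 (enum_valP a) u1Y.
    have : \sum_i ((z (enum_val a) i - z u1 i) / 2) ^+ 2 <= D.
      by apply: le_trans h; rewrite /energy lerDl.
    have -> : \sum_i v a i ^+ 2 = 4 * \sum_i ((z (enum_val a) i - z u1 i) / 2) ^+ 2.
      by rewrite mulr_sumr; apply: eq_bigr => i _; rewrite /v; field.
    lra.
  - move=> a b ab hsup; rewrite ltNge; apply/negP => hw.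
    pose u := enum_val a; pose u' := enum_val b.
    have uY : u \in Y by exact: enum_valP.
    have u'Y : u' \in Y by exact: enum_valP.
    have uu' : u != u' by apply: contra ab => /eqP /enum_val_inj ->.
    have vE j : dot (v a) (x j) - dot (v b) (x j) = ev (z u) j - ev (z u') j.
      by rewrite /v !dotBl /ev; ring.
    have hsup' j : `|ev (z u) j - ev (z u') j| <= 6 * s * K * Num.sqrt log8m.
      by rewrite -vE.
    have hw' : \sum_j `|ev (z u1) j| `^ p * (ev (z u) j - ev (z u') j) ^+ 2 <=
        64 * expR 2 * s ^+ 2 * K ^+ 2 * S.
      by under eq_bigr => j _ do rewrite -vE.
    have := sdist_close (z1 u) (z1 u') (z1 u1) s0 (hp u uY) (hp u' u'Y) hsup' hw' (ltW D0).
    have -> : Cp * scale ^+ 2 * s ^+ 2 * (1 + log8m * D) = rho k ^+ 2 / 512.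
      by rewrite s2 qE; field; rewrite !gt_eqF.
    have h1 := sepY u u' uY u'Y uu'.
    have h2 := sdist_tri (t u) (z u) (t u'); have h3 := sdist_tri (z u) (z u') (t u').
    have h4 := zd u; have h5 := zd u'; rewrite (sdistC (z u') (t u')) in h3.
    rewrite !rhoS in h1 h4 h5.
    exact: separation_arith rk h1 h2 h3 h4 h5.
(* The prefactor 4 of [packing_bound] is absorbed by the summand 2 of [entropy_bd]. *)
have h4 : 4 <= expR 2 :> R.
  rewrite (_ : 2 = 1 + 1 :> R)// expRD; have := expR_ge1Dx (1 : R); nra.
rewrite /entropy_bd expRD ler_pM ?expR_ge0// ler_expR s2 le_eqVlt; apply/orP; left; apply/eqP.
by rewrite -/D DpE qE; field; rewrite !gt_eqF.
Qed.

(** [gap * (1 + log8m * gap)] is at most the square of [Num.sqrt log8m * gap + (Num.sqrt log8m)^-1].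
    The first term is linear in the gap, hence summable over the levels; the second is harmless for
    at most [log8m] levels. *)
Let sqrt_gg k y : rho k * Num.sqrt (entropy_bd k y) <=
  2 * rho k + Num.sqrt (Dp) * scale * (Num.sqrt log8m * gap k y + (Num.sqrt log8m)^-1).
Proof.
have rk := rho_gt0 k; have d0 := gap_gt0 k y; have l1 := log8m_ge1.
have sl : Num.sqrt log8m ^+ 2 = log8m by rewrite sqr_sqrtr//; lra.
have sl0 : 0 < Num.sqrt log8m by rewrite sqrtr_gt0; lra.
have scp : Num.sqrt (Dp) ^+ 2 = Dp by rewrite sqr_sqrtr// ltW.
have r0 : 0 <= Num.sqrt log8m * gap k y + (Num.sqrt log8m)^-1.
  by rewrite addr_ge0 ?invr_ge0 ?mulr_ge0// ltW.
set Q := Num.sqrt log8m * gap k y + (Num.sqrt log8m)^-1 in r0 *.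
have hQ : gap k y * (1 + log8m * gap k y) <= Q ^+ 2.
  have -> : Q ^+ 2 = log8m * gap k y ^+ 2 + 2 * gap k y + log8m^-1.
    by rewrite /Q -[log8m in RHS]sl; field; rewrite gt_eqF.
  have : 0 <= log8m^-1 by rewrite invr_ge0; lra.
  nra.
have b0 : 0 <= Num.sqrt (Dp) * scale * Q by rewrite !mulr_ge0 ?sqrtr_ge0.
rewrite -ler_sqr ?nnegrE ?addr_ge0 ?mulr_ge0 ?sqrtr_ge0 ?(ltW rk)// exprMn.
rewrite sqr_sqrtr//.
have e1 : rho k ^+ 2 * entropy_bd k y = 2 * rho k ^+ 2 +
    Dp * scale ^+ 2 * (gap k y * (1 + log8m * gap k y)).
  by rewrite /entropy_bd; field; rewrite gt_eqF.
rewrite e1; set b := Num.sqrt Dp * scale * Q in b0 *.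
have e2 : b ^+ 2 = Dp * scale ^+ 2 * Q ^+ 2 by rewrite /b !exprMn scp.
have -> : (2 * rho k + b) ^+ 2 = 4 * rho k ^+ 2 + 4 * (rho k * b) + b ^+ 2 by ring.
rewrite e2.
have h1 : Dp * scale ^+ 2 * (gap k y * (1 + log8m * gap k y)) <=
    Dp * scale ^+ 2 * Q ^+ 2.
  apply: ler_wpM2l => //; apply: mulr_ge0; [exact: ltW|exact: sqr_ge0].
have h2 : 0 <= rho k * b by apply: mulr_ge0 => //; exact: ltW.
have h3 : 0 <= rho k ^+ 2 by exact: sqr_ge0.
lra.
Qed.

(** The radii [rho k.+2] and [8 * rho k] are three levels apart, so the sum telescopes with stride
    three. Three end terms remain, each at most 2, and the slacks add at most 1. *)
Let sum_del n y : n%:R * eta <= 1 -> \sum_(k < n) gap k y <= 7.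
Proof.
move=> ne; pose F i := min_energy (rho i * 8) (t y).
have FE k : min_energy (rho k.+2) (t y) = F k.+3.
  by rewrite /F [rho k.+3]rhoS divfK.
have F2 k : F k <= 2 by apply: min_energy_le2 => //; rewrite mulr_ge0// ltW.
have F0 k : 0 <= F k by apply: min_energy_ge0 => //; rewrite mulr_ge0// ltW.
suff -> : \sum_(k < n) gap k y =
    n%:R * eta + (F n + F n.+1 + F n.+2) - (F 0%N + F 1%N + F 2%N).
  have := F2 n; have := F2 n.+1; have := F2 n.+2.
  have := F0 0%N; have := F0 1%N; have := F0 2%N; lra.
elim: n {ne} => [|n IH]; first by rewrite big_ord0; ring.
rewrite big_ord_recr/= IH /gap FE [8 * _]mulrC -/(F n) -natr1; ring.
Qed.

Lemma signed_process_bound_aux n (tau : {ffun 'I_m -> bool} -> J) :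
  n%:R * eta <= 1 -> n%:R <= log8m -> m%:R <= 8 ^+ n :> R ->
  rad (fun s => `|\sum_j `|dot (t (tau s)) (x j)| `^ p * sgb R (s j)|) <=
  (2 * (2 * expR 2 + 61) + 160 + 160 * Num.sqrt (Dp)) * scale * Num.sqrt log8m.
Proof.
move=> ne nl m8.
have rho0 : 0 < 2 * scale by rewrite mulr_gt0.
have sl1 : 1 <= Num.sqrt log8m by rewrite -[leLHS]sqrtr1 ler_sqrt//; have := log8m_ge1; lra.
have sl0 : 0 < Num.sqrt log8m by lra.
pose c y j := `|dot (t y) (x j)| `^ p.
have H := @chaining_bound R m J c (fun u v => sdist (t u) (t v)) (2 * scale)
  (fun k y => min_energy (rho k.+1) (t y)) entropy_bd rho0.
have {}H := H (fun u => sdistxx (t u)) (fun u v => sdistC (t u) (t v))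
  (fun u v w => sdist_tri (t u) (t v) (t w)).
set B := 4 * (2 * scale) + Num.sqrt (Dp) * scale * (8 * Num.sqrt log8m).
apply: le_trans (H _ _ _ _ _ n B tau _) _.
- move=> u v; rewrite sdist2; apply: ler_sum => j _.
  rewrite -[leLHS]real_normK ?num_real// -[leRHS]real_normK ?num_real//.
  by rewrite ler_sqr ?nnegrE ?normr_ge0//; exact: dist_powR_norm_spow pn0.
- move=> u; apply: le_trans (sum_ev2p (t1 u)) _.
  by rewrite ler_sqr ?nnegrE ?mulr_ge0 ?(ltW scale_gt0)//; have := scale_gt0; lra.
- by move=> u v; exact: sdist_diam.
- exact: entropy_bd_ge0.
- by move=> k y u Y h1 h2 h3; exact: entropy_bound h1 h2 h3.
- move=> y; apply: (@le_trans _ _ (\sum_(k < n) (2 * rho k +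
    Num.sqrt (Dp) * scale * (Num.sqrt log8m * gap k y + (Num.sqrt log8m)^-1)))).
    by apply: ler_sum => k _; exact: sqrt_gg.
  rewrite big_split/=; have -> : \sum_(k < n) 2 * rho k = 2 * \sum_(k < n) rho k.
    by rewrite mulr_sumr.
  have -> : \sum_(k < n) Num.sqrt Dp * scale * (Num.sqrt log8m * gap k y + (Num.sqrt log8m)^-1) =
      Num.sqrt Dp * scale * (Num.sqrt log8m * \sum_(k < n) gap k y + (Num.sqrt log8m)^-1 *+ n).
    by rewrite -mulr_sumr big_split/= -mulr_sumr sumr_const card_ord.
  have sr : \sum_(k < n) rho k <= 2 * (2 * scale).
    suff : \sum_(k < n) rho k + 8 / 7 * rho n = 8 / 7 * (2 * scale).
      by have := rho_gt0 n; have := scale_gt0; lra.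
    elim: n {ne nl m8} => [|n IH].
      by rewrite big_ord0 chain_radius0; ring.
    by rewrite big_ord_recr/= rhoS -IH; field.
  have sd := sum_del y ne.
  have sn : (Num.sqrt log8m)^-1 *+ n <= Num.sqrt log8m.
    rewrite -[_ *+ n]mulr_natl ler_pdivrMr// -expr2 sqr_sqrtr//.
    by have := log8m_ge1; lra.
  rewrite lerD//; first lra.
  rewrite ler_wpM2l ?mulr_ge0 ?sqrtr_ge0 ?(ltW scale_gt0)//.
  by have := ler_wpM2l (ltW sl0) sd; lra.
(* As [m <= 8 ^ n], the last radius is at most [2 * scale / m], so stopping there costs at most
   [2 * scale]. *)
have sm : Num.sqrt m%:R * chain_radius (2 * scale) n <= 2 * scale.
  rewrite chain_radiusE exprVn mulrCA ler_piMr ?(ltW rho0)//.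
  rewrite ler_pdivrMr ?exprn_gt0// mul1r; apply: le_trans m8.
  rewrite -[leRHS]sqr_sqrtr ?ler0n// expr2 ler_peMl ?sqrtr_ge0//.
  by rewrite -[leLHS]sqrtr1 ler_sqrt//; have := m_ge2; lra.
have h : scale <= scale * Num.sqrt log8m by rewrite ler_peMr// ltW.
have e0 := expR_gt0 (2 : R).
have h2 : expR 2 * scale <= expR 2 * (scale * Num.sqrt log8m) by rewrite ler_wpM2l// ltW.
rewrite /B; lra.
Qed.

End entropy.

Lemma signed_process_bound (J : finType) (t : J -> 'I_N -> R)
    (tau : {ffun 'I_m -> bool} -> J) : (forall y, nn (t y) <= 1) ->
  rad (fun s => `|\sum_j `|dot (t (tau s)) (x j)| `^ p * sgb R (s j)|) <=
  (2 * (2 * (2 * expR 2 + 61) + 160 + 160 * Num.sqrt (Dp))) *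
  Num.sqrt (K `^ p * S) * Num.sqrt (ln m%:R).
Proof.
move=> t1; have m1 := m_ge2.
have lm0 : 0 <= ln m%:R :> R by rewrite ln_ge0//; lra.
(* About [ln m] levels: enough for [m <= 8 ^ n], but no more than [ln (8 * m)]. *)
have [n [n1 n2]] : exists n : nat, ln (m%:R : R) <= n%:R /\ n%:R <= ln (m%:R : R) + 1.
  exists (Num.trunc (ln (m%:R : R))).+1; have /andP[h1 h2] := truncn_itv lm0.
  by split; [exact: ltW|rewrite -natr1 lerD2r].
have l8E : log8m = ln 8 + ln m%:R by rewrite log8m_def lnM// posrE; lra.
have ln2 : ln 8 = 3 * ln 2 :> R.
  have -> : 8 = 2 ^+ 3 :> R by ring.
  by rewrite lnXn// mulr_natl.
have lnm : ln 2 <= ln m%:R :> R by rewrite ler_ln ?posrE//; lra.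
have e2 : 2 <= expR 1 :> R by have := expR_ge1Dx (1 : R); lra.
have ln8 : 1 <= ln 8 :> R.
  rewrite -ler_expR lnK ?posrE//.
  have -> : expR 1 = expR 4^-1 ^+ 4 :> R by rewrite -expRM_natl; congr expR; field.
  have h0 : 0 <= expR 4^-1 :> R by exact: expR_ge0.
  have h : expR 4^-1 <= 11 / 8 :> R by have := @expR_le_quad R 4^-1; nra.
  apply: (@le_trans _ _ ((11 / 8) ^+ 4)); last by lra.
  by rewrite ler_pXn2r// nnegrE; lra.
have nl : n%:R <= log8m by rewrite l8E; lra.
have m8 : m%:R <= 8 ^+ n :> R.
  rewrite -[leLHS]lnK ?posrE; last lra.
  rewrite -[leRHS]lnK ?posrE ?exprn_gt0// ler_expR lnXn// -[_ *+ n]mulr_natr.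
  by apply: (le_trans n1); rewrite ler_peMl.
have eta0 : 0 < n.+1%:R^-1 :> R by rewrite invr_gt0 ltr0n.
have ne : n%:R * n.+1%:R^-1 <= 1 :> R.
  by rewrite ler_pdivrMr ?ltr0n// mul1r ler_nat.
apply: le_trans (signed_process_bound_aux t1 eta0 tau ne nl m8) _.
rewrite -scale_def; set C := _ + _ + 160 * _.
have C0 : 0 <= C.
  by rewrite !addr_ge0// mulr_ge0 ?sqrtr_ge0// addr_ge0// mulr_ge0// expR_ge0.
(* [ln 8 = 3 * ln 2] is at most [3 * ln m] because [m >= 2]. *)
have h : Num.sqrt log8m <= 2 * Num.sqrt (ln m%:R).
  rewrite -ler_sqr ?nnegrE ?mulr_ge0 ?sqrtr_ge0// exprMn !sqr_sqrtr//.
    by rewrite l8E; lra.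
  by have := log8m_ge1; lra.
by have := ler_wpM2l (mulr_ge0 C0 (ltW scale_gt0)) h; lra.
Qed.

End convex_process.

(** * Symmetrization *)

Section bounded_functions.
Context d (T : measurableType d) (R : realType) (mu : probability T R).

Lemma bounded_integrable (f : T -> R) B : measurable_fun setT f ->
  (forall x, `|f x| <= B) -> mu.-integrable setT (EFin \o f).
Proof.
move=> mf fB; apply: measurable_bounded_integrable => //.
- by rewrite [X in (X < _)%E]probability_setT ltry.
- exists B; split; first exact: num_real.
  by move=> x Bx t _ /=; rewrite (le_trans (fB _))// ltW.
Qed.

Lemma Rintegral_prob_cst (c : R) : \int[mu]_x c = c.
Proof. by rewrite Rintegral_cst// [X in fine X]probability_setT mulr1. Qed.

Lemma Rintegral_sum (I : finType) (f : I -> T -> R) :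
  (forall i, mu.-integrable setT (EFin \o f i)) ->
  \int[mu]_x (\sum_i f i x) = \sum_i \int[mu]_x f i x.
Proof.
move=> fi; rewrite /Rintegral; under eq_integral do rewrite -sumEFin.
rewrite integral_sum// sum_fine// => i _; exact: (integrable_fin_num measurableT (fi i)).
Qed.

Lemma integrable_fsum (I : finType) (f : I -> T -> R) :
  (forall i, mu.-integrable setT (EFin \o f i)) ->
  mu.-integrable setT (EFin \o (fun x => \sum_i f i x)).
Proof.
move=> fi; rewrite (_ : _ \o _ = fun x => \sum_i (f i x)%:E)%E.
  by apply: integrable_sum => // i _; exact: fi.
by apply/funext => x /=; rewrite sumEFin.
Qed.

Lemma integrable_EFinD (f g : T -> R) :
  mu.-integrable setT (EFin \o f) -> mu.-integrable setT (EFin \o g) ->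
  mu.-integrable setT (EFin \o (fun x => f x + g x)).
Proof. exact: integrableD. Qed.

Lemma integrable_EFinZ c (f : T -> R) : mu.-integrable setT (EFin \o f) ->
  mu.-integrable setT (EFin \o (fun x => c * f x)).
Proof. exact: integrableZl. Qed.

Lemma Rintegral_dist_le (f g : T -> R) c :
  mu.-integrable setT (EFin \o f) -> mu.-integrable setT (EFin \o g) ->
  (forall x, `|f x - g x| <= c) -> `|\int[mu]_x f x - \int[mu]_x g x| <= c.
Proof.
move=> fi gi fg.
have fgi : mu.-integrable setT (EFin \o (fun x => f x - g x)).
  exact: (integrableB measurableT fi gi).
rewrite -RintegralB//; apply: le_trans (le_normr_Rintegral _ _) _ => //.
rewrite -[leRHS]Rintegral_prob_cst; apply: le_Rintegral => //.
  exact: (integrable_abse fgi).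
exact: finite_measure_integrable_cst.
Qed.

End bounded_functions.

Section finite_max.
Variables (R : realType) (J : finType).

Definition fmax (F : J -> R) : R := \big[Order.max/0]_i F i.

Lemma le_fmax (F : J -> R) i : F i <= fmax F.
Proof. exact: le_bigmax. Qed.

Lemma fmax_ge0 (F : J -> R) : 0 <= fmax F.
Proof. by rewrite /fmax; exact: bigmax_ge_id. Qed.

Lemma fmax_le (F : J -> R) c : 0 <= c -> (forall i, F i <= c) -> fmax F <= c.
Proof. by move=> c0 Fc; apply: bigmax_le => // i _; exact: Fc. Qed.

Lemma fmax_attained (j : J) (F : J -> R) : (forall i, 0 <= F i) ->
  exists i, fmax F = F i.
Proof.
move=> F0; exists [arg max_(i > j) F i]%O.
by apply: bigmax_eq_arg => // i _; exact: F0.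
Qed.

Lemma measurable_fmax d (T : measurableType d) (F : J -> T -> R) :
  (forall i, measurable_fun setT (F i)) ->
  measurable_fun setT (fun t => fmax (F ^~ t)).
Proof.
move=> mF; rewrite /fmax; elim: (index_enum J) => [|i s IH].
  by under eq_fun do rewrite big_nil; exact: measurable_cst.
by under eq_fun do rewrite big_cons; exact: measurable_maxr.
Qed.

End finite_max.

Section symmetrization.
Context d d' (T : measurableType d) (T' : measurableType d') (R : realType).
Variables (P : probability T R) (mu : probability T' R) (m : nat).
Variable X : 'I_m -> {RV P >-> T'}.
Hypothesis iidX : iid_sample mu X.

Let law j (A : set T') : measurable A -> P (X j @^-1` A) = mu A.
Proof. by have [_ h] := iidX; move=> mA; rewrite -(h j). Qed.

Let joint_law (A : 'I_m -> set T') : (forall j, measurable (A j)) ->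
  P (\bigcap_j (X j @^-1` A j)) = (\prod_(j < m) mu (A j))%E.
Proof.
move=> mA; have [+ _] := iidX; move=> /(_ [set: 'I_m]%SET A mA).
rewrite (_ : [set` [set: 'I_m]%SET] = [set: 'I_m]); last first.
  by apply/seteqP; split => // j _ /=; rewrite inE.
move=> ->; under eq_bigr => j _ do rewrite law//.
by apply: eq_bigl => j; rewrite inE.
Qed.

(** The space of [P] need not carry a second independent sample, so both copies live on the product
    of [P] with itself. The [j]-th points of the two copies are exchanged where [s j] is false. *)
Let swapped (s : 'I_m -> bool) (z : T * T) : (m + m).-tuple T' :=
  [tuple match fintype.split k with
    | inl j => if s j then X j z.1 else X j z.2
    | inr j => if s j then X j z.2 else X j z.1
    end | k < m + m].

Let swapped_l s z j : tnth (swapped s z) (lshift m j) = if s j then X j z.1 else X j z.2.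
Proof. by rewrite tnth_mktuple (unsplitK (inl _ j)). Qed.

Let swapped_r s z j : tnth (swapped s z) (rshift m j) = if s j then X j z.2 else X j z.1.
Proof. by rewrite tnth_mktuple (unsplitK (inr _ j)). Qed.

Let measurable_swapped s : measurable_fun setT (swapped s).
Proof.
apply/measurable_fun_tnthP => k.
rewrite (_ : _ \o _ = fun z => match fintype.split k with
    | inl j => if s j then X j z.1 else X j z.2
    | inr j => if s j then X j z.2 else X j z.1 end); last first.
  by apply/funext => z /=; rewrite tnth_mktuple.
by case: (fintype.split k) => j; case: (s j); apply: measurableT_comp.
Qed.

Let rect (A : 'I_(m + m) -> set T') : set ((m + m).-tuple T') :=
  \bigcap_k ((@tnth _ _ ^~ k) @^-1` A k).

Let law_rect s A : (forall k, measurable (A k)) ->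
  (P \x P)%E (swapped s @^-1` rect A) =
  ((\prod_(j < m) mu (A (lshift m j))) * (\prod_(j < m) mu (A (rshift m j))))%E.
Proof.
move=> mA.
pose B j := if s j then A (lshift m j) else A (rshift m j).
pose B' j := if s j then A (rshift m j) else A (lshift m j).
have mB j : measurable (B j) by rewrite /B; case: ifP.
have mB' j : measurable (B' j) by rewrite /B'; case: ifP.
have -> : swapped s @^-1` rect A =
    (\bigcap_j (X j @^-1` B j)) `*` (\bigcap_j (X j @^-1` B' j)).
  apply/seteqP; split => [z h|z [h1 h2] k _].
    split => j _ /=.
      rewrite /B; case: ifPn => sj.
        by have := h (lshift m j) I; rewrite /= swapped_l sj.
      by have := h (rshift m j) I; rewrite /= swapped_r (negbTE sj).
    rewrite /B'; case: ifPn => sj.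
      by have := h (rshift m j) I; rewrite /= swapped_r sj.
    by have := h (lshift m j) I; rewrite /= swapped_l (negbTE sj).
  rewrite -(splitK k); case: (fintype.split k) => j /=.
    rewrite swapped_l; have := h1 j I; have := h2 j I; rewrite /= /B /B'.
    by case: (s j).
  rewrite swapped_r; have := h1 j I; have := h2 j I; rewrite /= /B /B'.
  by case: (s j).
rewrite product_measure1E; first last.
- by apply: fin_bigcap_measurable => // j _; rewrite -[_ @^-1` _]setTI; apply: measurable_funP.
- by apply: fin_bigcap_measurable => // j _; rewrite -[_ @^-1` _]setTI; apply: measurable_funP.
rewrite [LHS](_ : _ = ((\prod_(j < m) mu (B j)) * (\prod_(j < m) mu (B' j)))%E); last first.
  by congr (_ * _)%E; exact: joint_law.
rewrite -!big_split/=; apply: eq_bigr => j _; rewrite /B /B'; case: (s j) => //.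
by rewrite muleC.
Qed.

(** Exchanging only permutes factors of the product formula for rectangles, and rectangles form a
    generating family that is stable under intersection. *)
Let swapped_law s (A : set ((m + m).-tuple T')) : measurable A ->
  pushforward (P \x P)%E (swapped s) A = pushforward (P \x P)%E (swapped (fun=> true)) A.
Proof.
pose G := [set rect A | A in [set A | forall k, measurable (A k)]].
have rectT : rect (fun=> setT) = setT by rewrite /rect bigcapT.
have mrect B : (forall k, measurable (B k)) -> measurable (rect B).
  move=> mB; apply: fin_bigcap_measurable => // k _.
  by rewrite -[_ @^-1` _]setTI; apply: measurable_tnth.
move=> mA; apply: (measure_unique G (fun=> setT)) => //.
- apply/seteqP; split.
    apply: smallest_sub; first exact: smallest_sigma_algebra.
    rewrite -bigcup_seq => C [k _ [D mD <-]]; rewrite setTI.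
    apply: sub_sigma_algebra; exists (fun l => if l == k then D else setT).
      by move=> l /=; case: ifP.
    apply/seteqP; split => u /=.
      by move=> /(_ k I) /=; rewrite eqxx.
    by move=> uD l _ /=; case: eqP => // ->.
  apply: smallest_sub; first exact: sigma_algebra_measurable.
  by move=> _ [B mB <-]; exact: mrect.
- move=> _ _ [B mB <-] [C mC <-]; exists (fun k => B k `&` C k).
    by move=> k; exact: measurableI.
  by apply/seteqP; split => [u h|u [h1 h2] k _];
    [split => k _; have [] := h k I|split; [exact: h1|exact: h2]].
- by move=> _; exists (fun=> setT).
- by rewrite bigcup_const//; exists 0%N.
- by move=> _ [B mB <-]; rewrite [LHS]law_rect// [RHS]law_rect.
- have e : pushforward (P \x P)%E (swapped s) setT = 1%E.
    by rewrite /pushforward preimage_setT; exact: probability_setT.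
  by move=> _; rewrite [X in (X < _)%E]e ltry.
Qed.

Variables (J : finType) (h : J -> T' -> R) (B : R).
Hypotheses (mh : forall i, measurable_fun setT (h i)) (h0 : forall i y, 0 <= h i y).
Hypothesis hB : forall i y, h i y <= B.

Let bracket (u : (m + m).-tuple T') : R :=
  fmax (fun i => `|m%:R^-1 * \sum_j (h i (tnth u (lshift m j)) - h i (tnth u (rshift m j)))|).

Let measurable_bracket : measurable_fun setT bracket.
Proof.
apply: measurable_fmax => i; apply: measurableT_comp => //.
apply: measurable_funM => //; apply: measurable_sum => j.
by apply: measurable_funB; apply: measurableT_comp => //; exact: measurable_tnth.
Qed.

Let int_bracket s : (\int[P \x P]_z (bracket (swapped s z))%:E =
  \int[P \x P]_z (bracket (swapped (fun=> true) z))%:E)%E.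
Proof.
have push r : (\int[P \x P]_z (bracket (swapped r z))%:E =
    \int[pushforward (P \x P)%E (swapped r)]_u (bracket u)%:E)%E.
  rewrite ge0_integral_pushforward ?preimage_setT//.
  - exact/measurable_EFinP.
  - by move=> u _; rewrite lee_fin fmax_ge0.
rewrite !push; apply: eq_measure_integral => A mA _; exact: swapped_law.
Qed.

Let signed (s : {ffun 'I_m -> bool}) t : R :=
  fmax (fun i => `|\sum_j h i (X j t) * sgb R (s j)|).

Let measurable_signed s : measurable_fun setT (signed s).
Proof.
apply: measurable_fmax => i; apply: measurableT_comp => //.
apply: measurable_sum => j; apply: measurable_funM => //.
exact: measurableT_comp.
Qed.

Let bracket_signed (s : {ffun 'I_m -> bool}) z :
  bracket (swapped s z) <= m%:R^-1 * (signed s z.1 + signed s z.2).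
Proof.
apply: fmax_le => [|i].
  by rewrite mulr_ge0 ?invr_ge0// addr_ge0// fmax_ge0.
rewrite normrM ger0_norm ?invr_ge0// ler_wpM2l ?invr_ge0//.
rewrite (_ : \sum_j _ = \sum_j h i (X j z.1) * sgb R (s j) -
    \sum_j h i (X j z.2) * sgb R (s j)); last first.
  rewrite -sumrB; apply: eq_bigr => j _; rewrite swapped_l swapped_r.
  by case: (s j) => /=; ring.
by apply: le_trans (ler_normB _ _) _; rewrite lerD// (le_fmax (fun i => `|_|)).
Qed.

Let int_bracket_le s : (\int[P \x P]_z (bracket (swapped (fun=> true) z))%:E <=
  (2 * m%:R^-1)%:E * \int[P]_t (signed s t)%:E)%E.
Proof.
rewrite -(int_bracket s).
have msE : measurable_fun setT (fun t => (signed s t)%:E) by exact/measurable_EFinP.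
have m1 : measurable_fun setT (fun z : T * T => (signed s z.1)%:E).
  by apply/measurable_EFinP; exact: measurableT_comp.
have m2 : measurable_fun setT (fun z : T * T => (signed s z.2)%:E).
  by apply/measurable_EFinP; exact: measurableT_comp.
have s0 t : (0 <= (signed s t)%:E)%E by rewrite lee_fin fmax_ge0.
apply: (@le_trans _ _ (\int[P \x P]_z
    (m%:R^-1%:E * ((signed s z.1)%:E + (signed s z.2)%:E)))%E).
  apply: ge0_le_integral => //.
  - by move=> z _; rewrite lee_fin fmax_ge0.
  - by apply/measurable_EFinP; exact: measurableT_comp.
  - by apply: measurable_funeM; exact: emeasurable_funD.
  - by move=> z _; rewrite -EFinD -EFinM lee_fin bracket_signed.
rewrite ge0_integralZl_EFin ?invr_ge0//; last 2 first.
  by move=> z _; rewrite adde_ge0.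
  exact: emeasurable_funD.
rewrite ge0_integralD// (fubini_tonelli1 _ m1)// (fubini_tonelli2 _ m2)//.
rewrite /fubini_F /fubini_G /=.
have cstE x : (\int[P]__ (signed s x)%:E = (signed s x)%:E)%E.
  by rewrite integral_cst// [X in (_ * X)%E]probability_setT mule1.
rewrite (eq_integral _ _ (fun x _ => cstE x)).
rewrite -mule2n -[(_ *+ 2)%E]mule_natl muleA -EFinM.
by rewrite mulrC.
Qed.

Let mean i : R := fine (\int[mu]_y (h i y)%:E)%E.

Let hX_integrable i j : P.-integrable setT (EFin \o (fun t => h i (X j t))).
Proof.
apply: (@bounded_integrable _ _ _ _ _ B); first exact: measurableT_comp.
by move=> t; rewrite ger0_norm.
Qed.

Let mean_law i j : \int[P]_t h i (X j t) = mean i.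
Proof.
rewrite /mean /Rintegral; congr fine.
have meq : (\int[mu]_y (h i y)%:E = \int[distribution P (X j)]_y (h i y)%:E)%E.
  by apply: eq_measure_integral => A mA _; have [_ e] := iidX; exact/esym/e.
rewrite meq ge0_integral_distribution//.
- exact/measurable_EFinP.
- by move=> y; rewrite lee_fin.
Qed.

Let dev t : R := fmax (fun i => `|m%:R^-1 * \sum_j h i (X j t) - mean i|).

(** Jensen's inequality: the mean is the expectation of the empirical average of the second copy. *)
Let dev_le t : (0 < m)%N ->
  ((dev t)%:E <= \int[P]_t' (bracket (swapped (fun=> true) (t, t')))%:E)%E.
Proof.
move=> m0; have mb : measurable_fun setT (fun t' => bracket (swapped (fun=> true) (t, t'))).
  apply: measurableT_comp => //.
  by apply: (measurableT_comp (measurable_swapped _)) => //; exact: measurable_pair1.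
pose g i t' := m%:R^-1 * \sum_j (h i (X j t) - h i (X j t')).
have gE i : (\int[P]_t' (g i t')%:E = (m%:R^-1 * \sum_j h i (X j t) - mean i)%:E)%E.
  have -> : (fun t' => (g i t')%:E) = (fun t' => \sum_(j < m)
      ((m%:R^-1 * h i (X j t))%:E - (m%:R^-1)%:E * (h i (X j t'))%:E))%E.
    apply/funext => t'; rewrite /g mulr_sumr -sumEFin; apply: eq_bigr => j _.
    by rewrite mulrBr EFinB EFinM.
  have iX j : P.-integrable setT (fun t' => (m%:R^-1)%:E * (h i (X j t'))%:E)%E.
    by apply: integrableZl => //; exact: hX_integrable.
  have ic j : P.-integrable setT (fun=> (m%:R^-1 * h i (X j t))%:E).
    by apply: finite_measure_integrable_cst.
  rewrite integral_sum//; last by move=> j; exact: integrableB.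
  rewrite (eq_bigr (fun j => (m%:R^-1 * h i (X j t) - m%:R^-1 * mean i)%:E)) => [|j _].
    rewrite sumEFin sumrB -!mulr_sumr sumr_const card_ord -[mean i *+ m]mulr_natl.
    rewrite mulrA mulVf ?mul1r//.
    by rewrite pnatr_eq0 -lt0n.
  rewrite integralB// integral_cst// [X in (_ * X)%E]probability_setT mule1.
  rewrite integralZl//; last exact: hX_integrable.
  rewrite -(mean_law i j) EFinB (EFinM _ (Rintegral _ _ _)) fineK//.
  by apply: integrable_fin_num => //; exact: hX_integrable.
have leg i : ((`|m%:R^-1 * \sum_j h i (X j t) - mean i|)%:E <=
    \int[P]_t' (bracket (swapped (fun=> true) (t, t')))%:E)%E.
  rewrite (_ : (`|_|)%:E = `|\int[P]_t' (g i t')%:E|)%E; last by rewrite gE.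
  have mg : measurable_fun setT (fun t' => (g i t')%:E).
    apply/measurable_EFinP; apply: measurable_funM => //; apply: measurable_sum => j.
    by apply: measurable_funB => //; exact: measurableT_comp.
  apply: le_trans (le_abse_integral _ _ mg) _ => //.
  apply: ge0_le_integral => //.
  - exact: measurableT_comp.
  - exact/measurable_EFinP.
  move=> t' _; rewrite lee_fin /bracket /=.
  apply: le_trans (le_fmax _ i); rewrite /g.
  by under [X in _ <= `|_ * X|]eq_bigr => j _ do rewrite swapped_l swapped_r.
have [j _|j0] := pickP (fun _ : J => true).
  have [i] := fmax_attained j (fun i => normr_ge0 (m%:R^-1 * \sum_j h i (X j t) - mean i)).
  by rewrite /dev => ->.
have -> : dev t = 0.
  by apply/eqP; rewrite eq_le fmax_ge0 andbT; apply: fmax_le => // j; have := j0 j.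
by apply: integral_ge0 => t' _; rewrite lee_fin fmax_ge0.
Qed.

Lemma symmetrization : (0 < m)%N ->
  (\int[P]_t (fmax (fun i =>
       `|m%:R^-1 * \sum_j h i (X j t) - fine (\int[mu]_y (h i y)%:E)|))%:E <=
   (2 * m%:R^-1)%:E *
   \int[P]_t (rad (fun s => fmax (fun i => `|\sum_j h i (X j t) * sgb R (s j)|)))%:E)%E.
Proof.
move=> m0; rewrite -/(mean _).
have mb : measurable_fun setT (fun z => (bracket (swapped (fun=> true) z))%:E).
  by apply/measurable_EFinP; exact: measurableT_comp.
have mdev : measurable_fun setT (fun t => (dev t)%:E).
  apply/measurable_EFinP; apply: measurable_fmax => i; apply: measurableT_comp => //.
  apply: measurable_funB => //; apply: measurable_funM => //; apply: measurable_sum => j.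
  exact: measurableT_comp.
apply: (@le_trans _ _ (\int[P \x P]_z (bracket (swapped (fun=> true) z))%:E)%E).
  rewrite (fubini_tonelli1 _ mb); last by move=> z; rewrite lee_fin fmax_ge0.
  apply: ge0_le_integral => //.
  - by move=> t _; rewrite lee_fin fmax_ge0.
  - by apply: measurable_fun_fubini_tonelli_F => // z; rewrite lee_fin fmax_ge0.
  - by move=> t _; exact: dev_le.
have msE s : measurable_fun setT (fun t => (signed s t)%:E) by exact/measurable_EFinP.
pose c : R := 2^-1 ^+ #|'I_m|.
have c0 : 0 <= c by rewrite exprn_ge0// invr_ge0.
have -> : (\int[P]_t (rad (signed ^~ t))%:E =
    \sum_(s : {ffun 'I_m -> bool}) c%:E * \int[P]_t (signed s t)%:E)%E.
  under eq_integral => t _ do rewrite radE -sumEFin.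
  rewrite ge0_integral_sum//; first last.
  - by move=> s t _; rewrite lee_fin mulr_ge0// fmax_ge0.
  - by move=> s; apply/measurable_EFinP; apply: measurable_funM.
  apply: eq_bigr => s _; under eq_integral => t _ do rewrite EFinM.
  by rewrite ge0_integralZl_EFin// => t _; rewrite lee_fin fmax_ge0.
rewrite ge0_sume_distrr; last first.
  by move=> s _; rewrite mule_ge0// integral_ge0// => t _; rewrite lee_fin fmax_ge0.
(* The integral on the left does not depend on signs; it is cut into [2 ^ m] equal shares, to be
   compared pattern by pattern. *)
have bE : (\int[P \x P]_z (bracket (swapped (fun=> true) z))%:E =
    \sum_(s : {ffun 'I_m -> bool}) c%:E * \int[P \x P]_z (bracket (swapped (fun=> true) z))%:E)%E.
  rewrite -ge0_sume_distrl; last by move=> *; rewrite lee_fin.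
  rewrite sumEFin sumr_const card_ffun card_bool /c -[X in (X%:E * _)%E]mulr_natl natrX -exprMn.
  by rewrite divff// expr1n mul1e.
rewrite [leLHS]bE; apply: lee_sum => s _.
by rewrite muleCA; apply: lee_wpmul2l; rewrite ?lee_fin//; exact: int_bracket_le.
Qed.

End symmetrization.

(** * The empirical process in an orthonormal basis *)

(* Cholesky: [P] clears the first row and column of [G], leaving the Schur complement. *)
Lemma pos_def_orthonormalize (R : realType) n (G : 'M[R]_n) : G^T = G ->
  (forall v : 'rV_n, v != 0 -> 0 < (v *m G *m v^T) 0 0) ->
  exists Q : 'M[R]_n, Q *m G *m Q^T = 1%:M.
Proof.
elim: n G => [|n IH] G Gs Gp; first by exists 0; apply/matrixP => -[].
move: G Gs Gp; rewrite -[n.+1]/(1 + n)%N => G Gs Gp.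
pose g := ulsubmx G 0 0; pose r := ursubmx G; pose D := drsubmx G.
have ulE : ulsubmx G = g%:M by exact: mx11_scalar.
have dlE : dlsubmx G = r^T by rewrite /r trmx_ursub Gs.
have DE : D^T = D by rewrite /D trmx_drsub Gs.
have GE : G = block_mx g%:M r r^T D by rewrite -ulE -dlE submxK.
have g0 : 0 < g.
  have v0 : (row_mx 1%:M 0 : 'rV[R]_(1 + n)) != 0.
    apply/eqP => /matrixP /(_ 0 (lshift n 0)); rewrite row_mxEl !mxE/= => /eqP.
    by rewrite oner_eq0.
  have := Gp _ v0; rewrite {1}GE tr_row_mx mul_row_block mul_row_col.
  by rewrite !mul0mx !addr0 trmx0 mulmx0 addr0 trmx1 mulmx1 mul1mx mxE.
pose P : 'M[R]_(1 + n) := block_mx 1%:M 0 (- g^-1 *: r^T) 1%:M.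
pose S := D - g^-1 *: (r^T *m r).
have PT : P^T = block_mx 1%:M (- g^-1 *: r) 0 1%:M.
  by rewrite tr_block_mx !trmx1 trmx0 linearZ/= trmxK.
have PGP : P *m G *m P^T = block_mx g%:M 0 0 S.
  rewrite PT GE /P !mulmx_block !mul1mx !mul0mx !mulmx0 !mulmx1 !addr0.
  have e1 : g%:M *m (- g^-1 *: r) + r = 0.
    by rewrite mul_scalar_mx scalerA mulrN divff ?gt_eqF// scaleN1r addNr.
  have e2 : (- g^-1 *: r^T) *m g%:M + r^T = 0.
    by rewrite mul_mx_scalar scalerA mulrN divff ?gt_eqF// scaleN1r addNr.
  rewrite e1 e2 mul0mx add0r; congr block_mx.
  by rewrite -scalemxAl scaleNr addrC.
have [Q QS] : exists Q : 'M[R]_n, Q *m S *m Q^T = 1%:M.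
  apply: IH => [|w w0].
    by rewrite /S linearB/= linearZ/= trmx_mul trmxK DE.
  have v0 : row_mx 0 w *m P != 0.
    apply: contraNN w0 => /eqP; rewrite mul_row_block !mulmx1 mul0mx add0r.
    by rewrite add0r => /(congr1 rsubmx); rewrite row_mxKr linear0 => /eqP.
  have := Gp _ v0; rewrite trmx_mul -!mulmxA (mulmxA G) (mulmxA P) (mulmxA P) PGP.
  rewrite tr_row_mx mul_block_col mul_row_col !mul0mx !add0r.
  by rewrite mulmxA.
exists (block_mx ((Num.sqrt g)^-1)%:M 0 0 Q *m P).
rewrite trmx_mul -!mulmxA (mulmxA G) (mulmxA P) (mulmxA P) PGP tr_block_mx !trmx0.
rewrite !mulmx_block !mulmx0 !mul0mx !addr0 !add0r (mulmxA Q S) QS tr_scalar_mx.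
have g1 : Num.sqrt g != 0 by rewrite gt_eqF// sqrtr_gt0.
rewrite -!scalar_mxM !mulmx0 -{2}(sqr_sqrtr (ltW g0)) expr2 mulfK// mulVf//.
by rewrite -scalar_mx_block.
Qed.

Lemma Rintegral_lin_combM d (T : measurableType d) (R : realType) (mu : probability T R)
    N (e : 'I_N -> T -> R) (a b : 'I_N -> R) :
  (forall i j, mu.-integrable setT (EFin \o (fun x => e i x * e j x))) ->
  \int[mu]_x (lin_comb e a x * lin_comb e b x) =
  \sum_i \sum_j a i * b j * \int[mu]_x (e i x * e j x).
Proof.
move=> ie; have iM i j := integrable_EFinZ (a i * b j) (ie i j).
transitivity (\int[mu]_x (\sum_i \sum_j a i * b j * (e i x * e j x))).
  apply: eq_Rintegral => x _; rewrite /lin_comb mulr_suml; apply: eq_bigr => i _.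
  by rewrite mulr_sumr; apply: eq_bigr => j _; ring.
rewrite Rintegral_sum => [|i]; last exact: integrable_fsum.
apply: eq_bigr => i _; rewrite Rintegral_sum//.
by apply: eq_bigr => j _; rewrite (RintegralZl _ measurableT (ie i j)).
Qed.

Section orthonormal_system.
Context d (T : measurableType d) (R : realType) (mu : probability T R).
Variables (p : R) (N : nat) (e : 'I_N -> T -> R) (K : R).
Hypotheses (p2 : 2 <= p) (K0 : 0 <= K).
Hypothesis me : forall i, measurable_fun setT (e i).
Hypothesis eK : forall x, \sum_i e i x ^+ 2 <= K ^+ 2.
Hypothesis eorth : forall i j, \int[mu]_x (e i x * e j x) = (i == j)%:R.
Implicit Types a b : 'I_N -> R.

Definition Lp_moment a : R := \int[mu]_x `|lin_comb e a x| `^ p.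
Local Notation nn := Lp_moment.

Let p0 : p != 0. Proof. by have h := p2; rewrite gt_eqF//; lra. Qed.

Lemma measurable_lin_comb a : measurable_fun setT (lin_comb e a).
Proof. by apply: measurable_sum => i; apply: measurable_funM. Qed.

Lemma measurable_powR_lin_comb a : measurable_fun setT (fun x => `|lin_comb e a x| `^ p).
Proof.
by apply: (measurableT_comp (measurable_powR p)); apply: measurableT_comp => //;
  exact: measurable_lin_comb.
Qed.

Lemma sqr_lin_comb_le a x : lin_comb e a x ^+ 2 <= (\sum_i a i ^+ 2) * K ^+ 2.
Proof.
apply: le_trans (sqr_sum_le _ _) _; apply: ler_wpM2l => //.
by apply: sumr_ge0 => i _; exact: sqr_ge0.
Qed.

Lemma norm_lin_comb_le a x : `|lin_comb e a x| <= Num.sqrt (\sum_i a i ^+ 2) * K.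
Proof.
rewrite -(ger0_norm K0) -[`|K|]sqrtr_sqr -sqrtr_sqr -sqrtrM; last first.
  by apply: sumr_ge0 => i _; exact: sqr_ge0.
by apply: ler_wsqrtr; exact: sqr_lin_comb_le.
Qed.

Lemma powR_lin_comb_le a x :
  `|lin_comb e a x| `^ p <= (Num.sqrt (\sum_i a i ^+ 2) * K) `^ p.
Proof.
apply: ge0_ler_powR; rewrite ?nnegrE ?mulr_ge0 ?sqrtr_ge0//; last exact: norm_lin_comb_le.
by have := p2; lra.
Qed.

Lemma integrable_powR_lin_comb a :
  mu.-integrable setT (EFin \o (fun x => `|lin_comb e a x| `^ p)).
Proof.
apply: (@bounded_integrable _ _ _ _ _ ((Num.sqrt (\sum_i a i ^+ 2) * K) `^ p)).
  exact: measurable_powR_lin_comb.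
by move=> x; rewrite ger0_norm ?powR_ge0// powR_lin_comb_le.
Qed.

Lemma Lp_moment_ge0 a : 0 <= nn a.
Proof. by apply: Rintegral_ge0 => x _; exact: powR_ge0. Qed.

Lemma lin_combZ l a x : lin_comb e (fun i => a i * l) x = lin_comb e a x * l.
Proof. exact: dotZl. Qed.

Lemma Lp_momentZ l a : nn (fun i => a i * l) = nn a * `|l| `^ p.
Proof.
rewrite /nn; under eq_Rintegral do rewrite lin_combZ normrM powRM//.
by rewrite RintegralZr//; exact: integrable_powR_lin_comb.
Qed.

Lemma Lp_moment_clarkson a b :
  nn (fun i => (a i + b i) / 2) + nn (fun i => (a i - b i) / 2) <= (nn a + nn b) / 2.
Proof.
have ia := integrable_powR_lin_comb; have iD u v := integrable_EFinD (ia u) (ia v).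
have E u v : \int[mu]_x (`|lin_comb e u x| `^ p + `|lin_comb e v x| `^ p) = nn u + nn v.
  exact: (RintegralD measurableT (ia u) (ia v)).
rewrite -[X in _ <= X / 2]E -[X in X <= _]E.
rewrite mulrC -(RintegralZl _ measurableT (iD a b)).
apply: (le_Rintegral measurableT (iD _ _) (integrable_EFinZ _ (iD a b))) => x _.
rewrite mulrC; have := clarkson (lin_comb e a x) (lin_comb e b x) p2.
rewrite -[lin_comb e a x]/(dot _ (e^~ x)) -[lin_comb e b x]/(dot _ (e^~ x)).
by rewrite -dot_mid -dot_half_sub.
Qed.

Lemma integrable_sqr_lin_comb a : mu.-integrable setT (EFin \o (fun x => lin_comb e a x ^+ 2)).
Proof.
apply: (@bounded_integrable _ _ _ _ _ ((\sum_i a i ^+ 2) * K ^+ 2)).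
  by apply: measurable_funX; exact: measurable_lin_comb.
by move=> x; rewrite ger0_norm ?sqr_ge0// sqr_lin_comb_le.
Qed.

Lemma sqr_basis_le i x : `|e i x| <= K.
Proof.
rewrite -ler_sqr ?nnegrE// real_normK ?num_real//; apply: le_trans (eK x).
by rewrite (bigD1 i)//= lerDl; apply: sumr_ge0 => j _; exact: sqr_ge0.
Qed.

Lemma integrable_basisM i j : mu.-integrable setT (EFin \o (fun x => e i x * e j x)).
Proof.
apply: (@bounded_integrable _ _ _ _ _ (K * K)); first exact: measurable_funM.
by move=> x; rewrite normrM ler_pM// sqr_basis_le.
Qed.

Lemma L2_lin_comb a : \int[mu]_x (lin_comb e a x ^+ 2) = \sum_i a i ^+ 2.
Proof.
under eq_Rintegral do rewrite expr2.
rewrite Rintegral_lin_combM; last exact: integrable_basisM.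
apply: eq_bigr => i _; under eq_bigr do rewrite eorth.
rewrite (bigD1 i)//= eqxx mulr1 big1 ?addr0// => j ji.
by rewrite eq_sym (negbTE ji) mulr0.
Qed.

(** Bernoulli's inequality with exponent [p / 2], applied to the square of the function and
    integrated against the probability [mu]. *)
Lemma sum_sqr_le1 a : nn a <= 1 -> \sum_i a i ^+ 2 <= 1.
Proof.
move=> na; have q1 : 1 <= p / 2 by have := p2; lra.
have q0 : 0 < p / 2 by lra.
have h x : 1 + p / 2 * (lin_comb e a x ^+ 2 - 1) <= `|lin_comb e a x| `^ p.
  by rewrite powR_normM2; apply: powR_bernoulli => //; exact: sqr_ge0.
have is2 := integrable_sqr_lin_comb a.
have ic c : mu.-integrable setT (EFin \o (fun=> c : R)) by exact: finite_measure_integrable_cst.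
have : \int[mu]_x (1 + p / 2 * (lin_comb e a x ^+ 2 - 1)) <= nn a.
  apply: le_Rintegral => //; last exact: integrable_powR_lin_comb.
  apply: (@bounded_integrable _ _ _ _ _ (1 + p / 2 * ((\sum_i a i ^+ 2) * K ^+ 2 + 1))).
    apply: measurable_funD => //; apply: measurable_funM => //; apply: measurable_funB => //.
    by apply: measurable_funX; exact: measurable_lin_comb.
  move=> x; apply: le_trans (ler_normD _ _) _; rewrite normr1 lerD2l normrM (ger0_norm (ltW q0)).
  apply: ler_wpM2l; first exact: ltW.
  apply: le_trans (ler_normB _ _) _; rewrite normr1 lerD2r ger0_norm ?sqr_ge0//.
  exact: sqr_lin_comb_le.
rewrite (_ : (fun x => _) = fun x => (1 - p / 2) + p / 2 * lin_comb e a x ^+ 2); last first.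
  by apply/funext => x; ring.
rewrite RintegralD//; last exact: integrable_EFinZ.
rewrite RintegralZl// L2_lin_comb Rintegral_prob_cst => hh.
have : p / 2 * (\sum_i a i ^+ 2) <= p / 2 * 1 by lra.
by rewrite ler_pM2l.
Qed.

(** All multiples of [a] have moment 0, so [sum_sqr_le1] bounds all of them; the multiple whose
    [i]-th coordinate is 2 is too long. *)
Lemma Lp_moment_eq0 a : nn a = 0 -> forall i, a i = 0.
Proof.
move=> na i; apply/eqP; rewrite -sqrf_eq0; apply: contraTT isT => ai0.
have ai1 : 0 < a i ^+ 2 by rewrite lt_def ai0 sqr_ge0.
pose l := 2 / a i.
have /sum_sqr_le1 : nn (fun i => a i * l) <= 1 by rewrite Lp_momentZ na mul0r.
rewrite (bigD1 i)//= => h.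
have : (a i * l) ^+ 2 <= 1.
  apply: le_trans h; rewrite lerDl; apply: sumr_ge0 => j _; exact: sqr_ge0.
have ai : a i != 0 by rewrite -sqrf_eq0.
by rewrite /l mulrCA divff// mulr1 => ?; exfalso; lra.
Qed.

End orthonormal_system.

Definition chaining_const (R : realType) (p : R) : R :=
  2 * (2 * (2 * expR 2 + 61) + 160 +
    160 * Num.sqrt (2048 * (p ^+ 2 * 2 `^ p * (128 * expR 2 + 72 * 2 `^ p)))).

Lemma chaining_const_ge0 (R : realType) (p : R) : 0 <= chaining_const p.
Proof.
rewrite /chaining_const; set s := Num.sqrt _; have : 0 <= s by exact: sqrtr_ge0.
by move: s => s; have := expR_gt0 (2 : R); move: (expR _) => e; lra.
Qed.

(** The coefficient 1/2 of [v] is what later allows the expectation of [v] to be moved to the other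
    side. *)
Lemma sqrtr_amgm (R : realType) (C A v : R) : 0 <= C -> 0 <= A -> 0 <= v ->
  2 * C * Num.sqrt (A * (1 + v)) <= 2 * C * Num.sqrt A + 2 * C ^+ 2 * A + 2^-1 * v.
Proof.
move=> C0 A0 v0; rewrite mulrDr mulr1.
have : Num.sqrt (A + A * v) <= Num.sqrt A + Num.sqrt A * Num.sqrt v.
  by rewrite -sqrtrM//; apply: sqrtrD_le => //; exact: mulr_ge0.
move: (sqr_sqrtr v0) (sqr_sqrtr A0).
move: (Num.sqrt (A + A * v)) (Num.sqrt A) (Num.sqrt v) => b a w <- <- h.
have : 2 * C * b <= 2 * C * (a + a * w) by apply: ler_wpM2l => //; lra.
have := sqr_ge0 (2 * C * a - w).
by rewrite sqrrB !exprMn; lra.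
Qed.

Section empirical_process.
Context d d' (T : measurableType d) (T' : measurableType d') (R : realType).
Variables (P : probability T R) (mu : probability T' R) (m : nat).
Variable X : 'I_m -> {RV P >-> T'}.
Hypothesis iidX : iid_sample mu X.
Variables (p : R) (N : nat) (e : 'I_N -> T' -> R) (K : R).
Hypotheses (p2 : 2 <= p) (K0 : 0 < K) (m2 : (1 < m)%N).
Hypothesis me : forall i, measurable_fun setT (e i).
Hypothesis eK : forall x, \sum_i e i x ^+ 2 <= K ^+ 2.
Hypothesis eorth : forall i j, \int[mu]_x (e i x * e j x) = (i == j)%:R.
Implicit Types a b : 'I_N -> R.

Local Notation nn := (Lp_moment mu p e).
Local Notation emp a t := (empirical_moment p X (lin_comb e a) t).

Let p0 : p != 0. Proof. by have h := p2; rewrite gt_eqF//; lra. Qed.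
Let m0 : 0 < m%:R :> R. Proof. by rewrite ltr0n ltnW. Qed.

Let emp_ge0 a t : 0 <= emp a t.
Proof. by rewrite mulr_ge0 ?invr_ge0// sumr_ge0// => j _; exact: powR_ge0. Qed.

Let empZ l a t : emp (fun i => a i * l) t = emp a t * `|l| `^ p.
Proof.
rewrite /empirical_moment -mulrA mulr_suml; congr (_ * _); apply: eq_bigr => j _.
by rewrite lin_combZ normrM powRM.
Qed.

Let emp_dist_le f g c t : (forall x, `| `|f x| `^ p - `|g x| `^ p| <= c) ->
  `|empirical_moment p X f t - empirical_moment p X g t| <= c.
Proof.
move=> fg; rewrite /empirical_moment -mulrBr -sumrB normrM ger0_norm ?invr_ge0//.
rewrite mulrC ler_pdivrMr//; apply: le_trans (ler_norm_sum _ _ _) _.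
apply: (@le_trans _ _ (\sum_(j < m) c)); first by apply: ler_sum => j _; exact: fg.
by rewrite sumr_const card_ord mulr_natr.
Qed.

Let powR_lin_comb_dist a : exists2 D, 0 <= D & forall eta b x, 0 <= eta <= 1 ->
  (forall i, `|a i - b i| <= eta) ->
  `| `|lin_comb e a x| `^ p - `|lin_comb e b x| `^ p| <= D * eta.
Proof.
have p1 : 1 <= p by have := p2; lra.
have K0' := ltW K0.
pose B := (\sum_i `|a i|) * K.
pose NK := N%:R * K.
have NK0 : 0 <= NK by rewrite mulr_ge0.
exists (p * NK * (B + NK) `^ (p - 1)).
  by rewrite mulr_ge0 ?powR_ge0// mulr_ge0//; lra.
move=> eta b x /andP[eta0 eta1] ab.
have eKi i : `|e i x| <= K by exact: (sqr_basis_le K0').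
have hB : `|lin_comb e a x| <= B.
  apply: le_trans (ler_norm_sum _ _ _) _; rewrite /B mulr_suml; apply: ler_sum => i _.
  by rewrite normrM ler_wpM2l.
have hD : `|lin_comb e a x - lin_comb e b x| <= NK * eta.
  rewrite /lin_comb -sumrB; apply: le_trans (ler_norm_sum _ _ _) _.
  apply: (@le_trans _ _ (\sum_(i < N) eta * K)).
    by apply: ler_sum => i _; rewrite -mulrBl normrM ler_pM.
  by rewrite sumr_const card_ord -mulr_natl /NK mulrA mulrAC.
have hb : `|lin_comb e b x| <= B + NK.
  have := ler_normB (lin_comb e a x) (lin_comb e a x - lin_comb e b x).
  rewrite opprB addrC subrK => h; apply: le_trans h _; apply: lerD => //.
  by apply: le_trans hD _; rewrite ler_piMr.
apply: le_trans (dist_powR_norm_spow _ _ p0) _; apply: le_trans (spow_lip _ _ p1) _.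
have -> : p * NK * (B + NK) `^ (p - 1) * eta = p * (NK * eta) * (B + NK) `^ (p - 1) by ring.
apply: ler_pM; rewrite ?powR_ge0//; first by rewrite mulr_ge0//; lra.
  by apply: ler_wpM2l => //; lra.
apply: ge0_ler_powR; rewrite ?nnegrE ?le_max ?normr_ge0//; first by lra.
  by rewrite addr_ge0// mulr_ge0// sumr_ge0.
by rewrite ge_max hb andbT (le_trans hB)// lerDl.
Qed.

(* A countable dense family of coefficient vectors makes the supremum over the
   unit ball measurable. *)
Let ratvec (k : nat) : 'I_N -> R :=
  if unpickle k is Some c then fun i => ratr ((c : {ffun 'I_N -> rat}) i) else fun=> 0.

Let ratvec_dense a eta : 0 < eta -> exists k, forall i, `|a i - ratvec k i| <= eta.
Proof.
move=> eta0.
have /choice[c hc] i : exists q : rat, `|a i - ratr q| <= eta.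
  have /rat_in_itvoo[q] : a i < a i + eta by rewrite ltrDl.
  rewrite in_itv/= => /andP[h1 h2]; exists q.
  by rewrite distrC ger0_norm; lra.
exists (pickle [ffun i => c i]) => i.
by rewrite /ratvec pickleK ffunE.
Qed.

(** The rational vectors scaled to moment 1; a vector of moment 0 becomes the zero vector, as a
    nonzero power of 0 is 0. *)
Let dir k : 'I_N -> R := fun i => ratvec k i * nn (ratvec k) `^ (- p^-1).

Let dirE k (F : ('I_N -> R) -> R) : (forall l a, F (fun i => a i * l) = F a * `|l| `^ p) ->
  nn (ratvec k) != 0 -> F (dir k) = F (ratvec k) / nn (ratvec k).
Proof.
move=> FZ n0; rewrite FZ; congr (_ * _); rewrite ger0_norm ?powR_ge0//.
by rewrite -powRrM mulNr mulVf// powR_inv1// Lp_moment_ge0.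
Qed.

Let nnZ := Lp_momentZ mu p2 (ltW K0) me eK.

Let dir_le1 k : nn (dir k) <= 1.
Proof.
have [n0|n0] := eqVneq (nn (ratvec k)) 0.
  by rewrite nnZ n0 mul0r.
by rewrite dirE ?divff.
Qed.

Let dev k t := `|emp (dir k) t - nn (dir k)|.

Let perturbation (u u' n n' c q eps : R) : 0 <= c -> `|u - u'| <= q -> `|n - n'| <= q ->
  `|u' - n'| <= c * n' -> (2 + c) * q <= eps -> `|u - n| <= c * n + eps.
Proof.
move=> c0; rewrite !ler_norml => /andP[a1 a2] /andP[b1 b2] /andP[c1 c2] h.
have h1 : c * (n' - n) <= c * q by apply: ler_wpM2l => //; lra.
by apply/andP; split; lra.
Qed.

(** By homogeneity a bound at the normalised vectors holds for all rational vectors, with the factor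
    [nn]. Both sides are continuous in the coefficients, with a modulus that is uniform over the
    sample, so it extends to all vectors. *)
Let dev_homogeneous c t : (forall k, dev k t <= c) ->
  forall a, `|emp a t - nn a| <= c * nn a.
Proof.
move=> wc a; have c0 : 0 <= c by apply: le_trans (wc 0%N); exact: normr_ge0.
have rat_case k : `|emp (ratvec k) t - nn (ratvec k)| <= c * nn (ratvec k).
  have [n0|n0] := eqVneq (nn (ratvec k)) 0.
    rewrite n0 mulr0 subr0 /empirical_moment big1 ?mulr0 ?normr0// => j _.
    rewrite /lin_comb big1 ?normr0 ?powR0// => i _.
    by rewrite (Lp_moment_eq0 p2 (ltW K0) me eK eorth n0) mul0r.
  have n1 : 0 < nn (ratvec k) by rewrite lt_def n0 Lp_moment_ge0.
  have := wc k; rewrite /dev (dirE (F := fun a => emp a t))// ?(dirE (F := nn))//.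
  by rewrite -mulrBl normrM normfV (ger0_norm (ltW n1)) ler_pdivrMr.
have [D D0 hD] := powR_lin_comb_dist a.
apply/ler_addgt0Pr => eps eps0.
pose q := (2 + c) * D + 1; have q0 : 0 < q by rewrite ltr_wpDl// mulr_ge0// addr_ge0.
pose eta := Num.min 1 (eps / q).
have eta0 : 0 < eta by rewrite lt_min ltr01 divr_gt0.
have eta1 : eta <= 1 by rewrite ge_min lexx.
have [k hk] := ratvec_dense a eta0.
have hx x := hD eta (ratvec k) x (introT andP (conj (ltW eta0) eta1)) hk.
have h1 := emp_dist_le t hx.
have h2 : `|nn a - nn (ratvec k)| <= D * eta.
  by apply: Rintegral_dist_le => //; exact: (integrable_powR_lin_comb mu p2 (ltW K0)).
have h3 := rat_case k.
have h4 : q * eta <= eps by rewrite mulrC -ler_pdivlMr// ge_min lexx orbT.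
apply: (perturbation c0 h1 h2 h3); apply: le_trans h4.
by rewrite mulrA ler_pM2r// /q lerDl.
Qed.

Let sum_sqr_dir k : \sum_i dir k i ^+ 2 <= 1.
Proof. exact: (sum_sqr_le1 p2 (ltW K0) me eK eorth (dir_le1 k)). Qed.

Let powR_dir_le k x : `|lin_comb e (dir k) x| `^ p <= K `^ p.
Proof.
apply: le_trans (powR_lin_comb_le p2 (ltW K0) eK _ _) _.
have K0' := ltW K0; apply: ge0_ler_powR; rewrite ?nnegrE ?mulr_ge0 ?sqrtr_ge0//.
  by have := p2; lra.
by rewrite ler_piMl// -sqrtr1 ler_wsqrtr.
Qed.

Let dev_bounded k t : dev k t <= K `^ p + 1.
Proof.
have h1 : emp (dir k) t <= K `^ p.
  rewrite /empirical_moment mulrC ler_pdivrMr//.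
  apply: (@le_trans _ _ (\sum_(j < m) K `^ p)); first by apply: ler_sum => j _.
  by rewrite sumr_const card_ord mulr_natr.
have := emp_ge0 (dir k) t; have := Lp_moment_ge0 mu p e (dir k); have := dir_le1 k.
by rewrite /dev ler_norml => a1 a2 a3; apply/andP; split; lra.
Qed.

Let devmax n t := fmax (fun k : 'I_n => dev k t).

Let measurable_emp a : measurable_fun setT (fun t => emp a t).
Proof.
apply: measurable_funM => //; apply: measurable_sum => j.
apply: (measurableT_comp (f := fun x => `|lin_comb e a x| `^ p)) => //.
exact: measurable_powR_lin_comb.
Qed.

Let measurable_devmax n : measurable_fun setT (devmax n).
Proof.
apply: measurable_fmax => k; rewrite /dev.
by apply: measurableT_comp => //; apply: measurable_funB => //; exact: measurable_emp.
Qed.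

Let devmax_nd t : {homo devmax^~ t : n k / (n <= k)%N >-> n <= k}.
Proof.
move=> n k nk; apply: fmax_le => [|i]; first exact: fmax_ge0.
exact: (le_fmax (fun i : 'I_k => dev i t) (widen_ord nk i)).
Qed.

Let devmax_le n t c : 0 <= c -> (forall k, dev k t <= c) -> devmax n t <= c.
Proof. by move=> c0 h; apply: fmax_le. Qed.

Let devsup t : \bar R := ereal_sup (range (fun n => (devmax n t)%:E)).

Let devsup_bounds t : (0 <= devsup t <= (K `^ p + 1)%:E)%E.
Proof.
apply/andP; split.
  by apply: le_trans (ereal_sup_ubound _); last (by exists 0%N); rewrite lee_fin fmax_ge0.
apply: ge_ereal_sup => _ [n _ <-]; rewrite lee_fin; apply: devmax_le => //.
by rewrite addr_ge0// powR_ge0.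
Qed.

(** The supremum over the countable family is finite because every [dev k] is at most [K] to the [p]
    plus 1, and measurable as the limit of the finite maxima [devmax]. *)
Let V t := fine (devsup t).

Let VE t : (V t)%:E = devsup t.
Proof.
have /andP[h1 h2] := devsup_bounds t; rewrite fineK// ge0_fin_numE//.
by apply: le_lt_trans h2 _; rewrite ltry.
Qed.

Let cvg_devmax t : (devmax n t)%:E @[n --> \oo] --> (V t)%:E.
Proof.
rewrite VE; apply: ereal_nondecreasing_cvgn => n k nk.
by rewrite lee_fin devmax_nd.
Qed.

Let measurable_V : measurable_fun setT V.
Proof.
apply/measurable_EFinP.
apply: (emeasurable_fun_cvg (fun n t => (devmax n t)%:E)) => [n|t _].
  exact/measurable_EFinP.
exact: cvg_devmax.
Qed.

Let V_ge0 t : 0 <= V t. Proof. by rewrite -lee_fin VE; case/andP: (devsup_bounds t). Qed.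

Let V_le t : V t <= K `^ p + 1.
Proof. by rewrite -lee_fin VE; case/andP: (devsup_bounds t). Qed.

Let dev_le_V k t : dev k t <= V t.
Proof.
apply: le_trans (le_fmax (fun i : 'I_k.+1 => dev i t) ord_max) _.
by rewrite -lee_fin VE; apply: ereal_sup_ubound; exists k.+1.
Qed.

Let V_homogeneous t a : `|emp a t - nn a| <= V t * nn a.
Proof. exact: dev_homogeneous (dev_le_V^~ t) a. Qed.

Let V_minimal t c : 0 <= c ->
  (forall a, nn a <= 1 -> `|emp a t - nn a| <= c) -> V t <= c.
Proof.
move=> c0 h; rewrite -lee_fin VE; apply: ge_ereal_sup => _ [n _ <-]; rewrite lee_fin.
by apply: devmax_le => // k; apply: h; exact: dir_le1.
Qed.

Local Notation A := (K `^ p * ln m%:R / m%:R).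

(** The self-bounding step: for a fixed sample [signed_process_bound] applies with
    [S = m * (1 + V t)], by [V_homogeneous], and [sqrtr_amgm] isolates half of [V t]. *)
Let rad_dir_le n t :
  2 * m%:R^-1 * rad (fun s => fmax (fun k : 'I_n.+1 =>
     `|\sum_j `|lin_comb e (dir k) (X j t)| `^ p * sgb R (s j)|)) <=
  2 * chaining_const p * Num.sqrt A + 2 * chaining_const p ^+ 2 * A + 2^-1 * V t.
Proof.
have [V0 C0] := (V_ge0 t, chaining_const_ge0 p).
have lm0 : 0 <= ln m%:R :> R by rewrite ln_ge0// ler1n ltnW.
have KP0 : 0 <= K `^ p by exact: powR_ge0.
pose S0 := m%:R * (1 + V t).
have S0_gt0 : 0 < S0 by rewrite mulr_gt0// ltr_pwDl.
have /choice[tau htau] (s : {ffun 'I_m -> bool}) : exists i : 'I_n.+1,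
    fmax (fun k : 'I_n.+1 => `|\sum_j `|lin_comb e (dir k) (X j t)| `^ p * sgb R (s j)|) =
    `|\sum_j `|lin_comb e (dir i) (X j t)| `^ p * sgb R (s j)|.
  by apply: (fmax_attained ord0) => i; exact: normr_ge0.
have hS a : \sum_j `|dot a (fun i => e i (X j t))| `^ p <= S0 * nn a.
  have := V_homogeneous t a; rewrite ler_norml => /andP[_].
  rewrite lerBlDl -[X in X + _]mul1r -mulrDl /empirical_moment mulrC ler_pdivrMr//.
  by rewrite [leRHS]mulrAC [X in _ <= X * _]mulrC.
have bound := signed_process_bound p2 m2 K0 S0_gt0 (fun j => eK (X j t))
  (Lp_moment_ge0 mu p e) (Lp_moment_clarkson mu p2 (ltW K0) me eK)
  (sum_sqr_le1 p2 (ltW K0) me eK eorth) hS erefl erefl tau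
  (fun k : 'I_n.+1 => dir_le1 k).
have -> : (fun s : {ffun 'I_m -> bool} => fmax (fun k : 'I_n.+1 =>
    `|\sum_j `|lin_comb e (dir k) (X j t)| `^ p * sgb R (s j)|)) =
    fun s => `|\sum_j `|dot (dir (tau s)) (fun i => e i (X j t))| `^ p * sgb R (s j)|.
  by apply/funext => s; rewrite htau.
apply: (@le_trans _ _ (2 * m%:R^-1 *
    (chaining_const p * Num.sqrt (K `^ p * S0) * Num.sqrt (ln m%:R)))).
  by apply: ler_wpM2l; rewrite ?mulr_ge0 ?invr_ge0.
have -> : 2 * m%:R^-1 * (chaining_const p * Num.sqrt (K `^ p * S0) * Num.sqrt (ln m%:R)) =
    2 * chaining_const p * Num.sqrt (A * (1 + V t)).
  have -> : A * (1 + V t) = m%:R^-1 ^+ 2 * ((K `^ p * S0) * ln m%:R).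
    by rewrite /S0; field; rewrite gt_eqF.
  rewrite (sqrtrM _ (sqr_ge0 _)) sqrtr_sqr ger0_norm ?invr_ge0//.
  by rewrite (sqrtrM _ (mulr_ge0 KP0 (ltW S0_gt0))); ring.
by apply: sqrtr_amgm => //; rewrite mulr_ge0 ?invr_ge0// mulr_ge0.
Qed.

(** The bound is proved for finite maxima, then for [V] by monotone convergence. Half of the
    integral of [V] reappears on the right; it can be subtracted because [V] is bounded, so that its
    integral is finite. *)
Let int_V : (\int[P]_t (V t)%:E <=
  (4 * chaining_const p * Num.sqrt A + 4 * chaining_const p ^+ 2 * A)%:E)%E.
Proof.
have iV : P.-integrable setT (EFin \o V).
  by apply: (@bounded_integrable _ _ _ _ _ (K `^ p + 1)) => // t; rewrite ger0_norm.
pose c := 2 * chaining_const p * Num.sqrt A + 2 * chaining_const p ^+ 2 * A.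
have devmaxn n : (\int[P]_t (devmax n.+1 t)%:E <= (c + 2^-1 * \int[P]_t V t)%:E)%E.
  have mh (k : 'I_n.+1) : measurable_fun setT (fun x => `|lin_comb e (dir k) x| `^ p).
    exact: measurable_powR_lin_comb.
  have := symmetrization iidX mh (fun _ _ => powR_ge0 _ _)
    (fun k : 'I_n.+1 => powR_dir_le k) (ltnW m2).
  move/le_trans; apply.
  rewrite -ge0_integralZl_EFin//; first last.
  - apply/measurable_EFinP; under eq_fun do rewrite radE.
    apply: measurable_sum => s; apply: measurable_funM => //; apply: measurable_fmax => k.
    apply: measurableT_comp => //; apply: measurable_sum => j; apply: measurable_funM => //.
    exact: (measurableT_comp (mh k)).
  - by move=> t _; rewrite lee_fin rad_ge0// => s; exact: fmax_ge0.
  have iU : P.-integrable setT (EFin \o (fun t => c + 2^-1 * V t)).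
    by apply: integrable_EFinD; [exact: finite_measure_integrable_cst|exact: integrable_EFinZ].
  rewrite -(Rintegral_prob_cst P c) -RintegralZl// -RintegralD//; last 2 first.
  - exact: finite_measure_integrable_cst.
  - exact: integrable_EFinZ.
  rewrite /Rintegral fineK; last exact: integrable_fin_num.
  apply: ge0_le_integral => //.
  - move=> t _; rewrite mule_ge0// lee_fin ?mulr_ge0 ?invr_ge0//.
    by apply: rad_ge0 => s; exact: fmax_ge0.
  - apply: measurable_funeM; apply/measurable_EFinP; under eq_fun do rewrite radE.
    apply: measurable_sum => s; apply: measurable_funM => //; apply: measurable_fmax => k.
    apply: measurableT_comp => //; apply: measurable_sum => j; apply: measurable_funM => //.
    exact: (measurableT_comp (mh k)).
  - exact: measurable_int iU.
  - by move=> t _; rewrite -EFinM lee_fin; exact: rad_dir_le.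
have VI : (\int[P]_t (V t)%:E <= (c + 2^-1 * \int[P]_t V t)%:E)%E.
  have -> : (\int[P]_t (V t)%:E = limn (fun n => \int[P]_t (devmax n t)%:E))%E.
    rewrite -monotone_convergence//.
    - by apply: eq_integral => t _; apply/esym/cvg_lim => //; exact: cvg_devmax.
    - by move=> n; exact/measurable_EFinP.
    - by move=> n t _; rewrite lee_fin fmax_ge0.
    - by move=> t _ n k nk; rewrite lee_fin devmax_nd.
  apply: lime_le.
    apply: ereal_nondecreasing_is_cvgn => n k nk; apply: ge0_le_integral => //.
    - by move=> t _; rewrite lee_fin fmax_ge0.
    - exact/measurable_EFinP.
    - exact/measurable_EFinP.
    - by move=> t _; rewrite lee_fin devmax_nd.
  by exists 1%N => // -[//|n] _; exact: devmaxn.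
move: VI; have VE' : (\int[P]_t (V t)%:E = (\int[P]_t V t)%:E)%E.
  by rewrite /Rintegral fineK//; exact: integrable_fin_num.
by rewrite VE' !lee_fin /c; lra.
Qed.

(** The third and fourth clauses say that [V] is the supremum over the whole uncountable unit ball,
    in homogeneous form, so a measurable function stands for it. *)
Lemma empirical_process_bound : exists V : T -> R,
  [/\ measurable_fun setT V, forall t, 0 <= V t,
      forall t a, `|emp a t - nn a| <= V t * nn a,
      forall t c, 0 <= c -> (forall a, nn a <= 1 -> `|emp a t - nn a| <= c) -> V t <= c &
      (\int[P]_t (V t)%:E <=
        (4 * chaining_const p * Num.sqrt A + 4 * chaining_const p ^+ 2 * A)%:E)%E].
Proof. by exists V; split. Qed.

End empirical_process.

(** * Nikolskii subspaces *)

Lemma mx_quadratic_form (R : comNzRingType) m n (Q : 'M[R]_(m, n)) (G : 'M[R]_n)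
    (Q' : 'M[R]_(m, n)) k l :
  (Q *m G *m Q'^T) k l = \sum_i \sum_j Q k i * Q' l j * G i j.
Proof.
rewrite -mulmxA mxE; apply: eq_bigr => i _; rewrite mxE mulr_sumr.
by apply: eq_bigr => j _; rewrite mxE; ring.
Qed.

Section Lnorm_real.
Context d (T : measurableType d) (R : realType) (mu : probability T R).

Lemma Lnorm_Rintegral (p : R) (f : T -> R) :
  mu.-integrable setT (EFin \o (fun x => `|f x| `^ p)) ->
  'N[mu]_(p%:E)[EFin \o f]%E = ((\int[mu]_x `|f x| `^ p) `^ p^-1)%:E.
Proof.
move=> fi; rewrite unlock -poweR_EFin /Rintegral fineK//.
exact: (integrable_fin_num measurableT fi).
Qed.

Lemma Lnorm2_sqrt (f : T -> R) : mu.-integrable setT (EFin \o (fun x => f x ^+ 2)) ->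
  'N[mu]_(2%:E)[EFin \o f]%E = (Num.sqrt (\int[mu]_x (f x ^+ 2)))%:E.
Proof.
have e : (fun x => `|f x| `^ 2) = (fun x => f x ^+ 2).
  by apply/funext => x; rewrite powR_mulrn// real_normK ?num_real.
move=> fi; rewrite Lnorm_Rintegral e// powR12_sqrt//.
by apply: Rintegral_ge0 => x _; exact: sqr_ge0.
Qed.

End Lnorm_real.

Section nikolskii_subspaces.
Variables (R : realType) (Omega : ptopologicalType).
Variable mu : probability (borelType Omega) R.
Hypothesis cptO : compact [set: Omega].

Lemma continuous_borel_measurable (f : Omega -> R) : continuous f ->
  measurable_fun [set: borelType Omega] (f : borelType Omega -> R).
Proof.
move=> /continuousP cf; apply: (measurability _ (RGenOpens.measurableE R)).
move=> _ [_ [a [b ->] <-]]; rewrite setTI; apply: sub_sigma_algebra.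
exact/cf/interval_open.
Qed.

Lemma continuous_bounded (f : Omega -> R) : continuous f -> exists B, forall x, `|f x| <= B.
Proof.
move=> cf; have : compact (f @` setT).
  by apply: continuous_compact => //; exact: continuous_subspaceT.
move=> /compact_bounded[B [_ hB]]; exists (B + 1) => x.
by apply: (hB (B + 1)) => //; rewrite ltrDl.
Qed.

Lemma continuous_integrableM (f g : Omega -> R) : continuous f -> continuous g ->
  mu.-integrable setT (EFin \o (fun x : borelType Omega => f x * g x)).
Proof.
move=> cf cg; have [[A hA] [B hB]] := (continuous_bounded cf, continuous_bounded cg).
apply: (@bounded_integrable _ _ _ _ _ (A * B)).
  by apply: measurable_funM; exact: continuous_borel_measurable.
by move=> x; rewrite normrM ler_pM.
Qed.

Variables (p : R) (N : nat) (M : R) (L : set (Omega -> R)).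
Hypothesis p2 : 2 <= p.
Hypothesis nikL : nikolskii_subspace mu p N M L.

(** The Gram matrix is positive definite since, by the Nikolskii inequality, a function of [L] with
    zero 2-norm vanishes at every point. The bound on the sum of [e i x ^+ 2] comes from the
    inequality for the function with coefficients [e i x]: its value at [x] equals its squared
    2-norm. *)
Lemma nikolskii_basis : (0 < N)%N -> exists (e : 'I_N -> borelType Omega -> R) (K : R),
  [/\ 1 <= K, K = M * Num.sqrt N%:R, L = range (lin_comb e),
      (forall i, measurable_fun setT (e i)) /\ (forall x, \sum_i e i x ^+ 2 <= K ^+ 2) &
      forall i j, \int[mu]_x (e i x * e j x) = (i == j)%:R].
Proof.
move=> N0; have [[e0 [free LE]] cL nik] := nikL.
set K := M * Num.sqrt N%:R.
have Lc f : L f -> continuous f by move=> /cL[].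
have L0 a : L (lin_comb e0 a) by rewrite LE; exists a.
have pointwise f x : L f -> `|f x| <= K * Num.sqrt (\int[mu]_y (f y ^+ 2)).
  move=> Lf; have := nik _ Lf; rewrite Lnorm2_sqrt; last first.
    exact: continuous_integrableM (Lc _ Lf) (Lc _ Lf).
  rewrite -EFinM -lee_fin; apply: le_trans; apply: ereal_sup_ubound.
  by exists x.
have e0E i : e0 i = lin_comb e0 (fun j => (j == i)%:R).
  apply/funext => x; rewrite /lin_comb (bigD1 i)//= eqxx mul1r big1 ?addr0// => j /negbTE ->.
  by rewrite mul0r.
have ce0 i : continuous (e0 i) by apply: Lc; rewrite e0E.
have ie0 i j := continuous_integrableM (ce0 i) (ce0 j).
have K0 : 0 < K.
  rewrite ltNge; apply/negP => Kle; pose i := Ordinal N0.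
  have /(free _)/(_ i) : forall x, lin_comb e0 (fun j => (j == i)%:R) x = 0.
    move=> x; apply/eqP; rewrite -normr_le0; apply: le_trans (pointwise _ _ (L0 _)) _.
    by rewrite mulr_le0_ge0.
  by rewrite eqxx => /eqP; rewrite oner_eq0.
pose G : 'M[R]_N := \matrix_(i, j) \int[mu]_x (e0 i x * e0 j x).
have intE (a b : 'rV_N) :
    \int[mu]_x (lin_comb e0 (a 0) x * lin_comb e0 (b 0) x) = (a *m G *m b^T) 0 0.
  rewrite Rintegral_lin_combM// mx_quadratic_form.
  by apply: eq_bigr => i _; apply: eq_bigr => j _; rewrite mxE.
have [Q QG] : exists Q : 'M[R]_N, Q *m G *m Q^T = 1%:M.
  apply: pos_def_orthonormalize => [|v v0].
    by apply/matrixP => i j; rewrite !mxE; apply: eq_Rintegral => x _; rewrite mulrC.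
  rewrite -intE lt_def; apply/andP; split; last first.
    by apply: Rintegral_ge0 => x _; rewrite -expr2 sqr_ge0.
  apply: contraNN v0 => /eqP h; apply/eqP/matrixP => k i; rewrite (ord1 k) mxE.
  apply: (free (v 0)) => x; apply/eqP; rewrite -normr_le0.
  apply: le_trans (pointwise _ x (L0 _)) _; rewrite [X in Num.sqrt X](_ : _ = 0) ?sqrtr0 ?mulr0//.
have Qu : Q \in unitmx by have [] := mulmx1_unit (etrans (mulmxA _ _ _) QG).
pose e k : borelType Omega -> R := lin_comb e0 (Q k).
have eorth k l : \int[mu]_x (e k x * e l x) = (k == l)%:R.
  rewrite /e Rintegral_lin_combM//; have := congr1 (fun A : 'M[R]_N => A k l) QG.
  rewrite mx_quadratic_form [RHS]mxE => <-.
  by apply: eq_bigr => i _; apply: eq_bigr => j _; rewrite mxE.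
have eE a : lin_comb e a = lin_comb e0 ((\row_i a i *m Q) 0).
  apply/funext => x; rewrite /lin_comb /e; under [RHS]eq_bigr => i _ do rewrite mxE mulr_suml.
  rewrite exchange_big/=; apply: eq_bigr => k _; rewrite /lin_comb mulr_sumr.
  by apply: eq_bigr => i _; rewrite mxE mulrA.
have LE' : L = range (lin_comb e).
  rewrite LE; apply/seteqP; split => _ [a _ <-]; last by exists ((\row_i a i *m Q) 0).
  exists ((\row_i a i *m invmx Q) 0) => //; rewrite eE; congr (lin_comb e0 _).
  rewrite (_ : \row_i _ = \row_i a i *m invmx Q); last by apply/rowP => i; rewrite !mxE.
  by rewrite mulmxKV//; apply/funext => i; rewrite mxE.
have ce i : continuous (e i) by exact/Lc/L0.
have ie i j := continuous_integrableM (ce i) (ce j).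
have eK x : \sum_i e i x ^+ 2 <= K ^+ 2.
  set s := \sum_i _; have s0 : 0 <= s by apply: sumr_ge0 => i _; exact: sqr_ge0.
  have : `|lin_comb e (e^~ x) x| <= K * Num.sqrt (\int[mu]_y (lin_comb e (e^~ x) y ^+ 2)).
    by apply: pointwise; rewrite LE'; exists (e^~ x).
  have -> : lin_comb e (e^~ x) x = s by apply: eq_bigr => i _; rewrite expr2.
  have -> : \int[mu]_y (lin_comb e (e^~ x) y ^+ 2) = s.
    rewrite [LHS]Rintegral_lin_combM//; apply: eq_bigr => i _.
    rewrite (bigD1 i)//= eorth eqxx mulr1 big1 ?addr0// => j ji.
    by rewrite eorth eq_sym (negbTE ji) mulr0.
  rewrite ger0_norm// => h; rewrite -(sqr_sqrtr s0).
  have [->|s1] := eqVneq (Num.sqrt s) 0; first by rewrite expr0n sqr_ge0.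
  have s2 : 0 < Num.sqrt s by rewrite lt_def s1 sqrtr_ge0.
  by apply: sqr_le; [exact: ltW|rewrite -(ler_pM2r s2) -expr2 sqr_sqrtr].
have me i : measurable_fun setT (e i) by exact: continuous_borel_measurable.
exists e, K; split => //.
(* Integrating the sum of the squares of the basis gives [N]; this yields [1 <= K]. *)
have NK : N%:R <= K ^+ 2.
  have -> : N%:R = \int[mu]_x (\sum_i e i x * e i x).
    rewrite Rintegral_sum//; under eq_bigr do rewrite eorth eqxx.
    by rewrite sumr_const card_ord.
  rewrite -[leRHS](Rintegral_prob_cst mu); apply: le_Rintegral => //.
    exact: integrable_fsum.
    exact: finite_measure_integrable_cst.
  by move=> x _; apply: le_trans (eK x); under eq_bigr do rewrite -expr2.
have : 1 <= K ^+ 2 by apply: le_trans NK; rewrite ler1n.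
by rewrite expr_ge1// ltW.
Qed.

Lemma nikolskii_powR K : 0 <= K -> K = M * Num.sqrt N%:R -> (0 < N)%N ->
  K `^ p = M `^ p * N%:R `^ (p / 2).
Proof.
move=> K0 KE N0; have sN : 0 < Num.sqrt N%:R :> R by rewrite sqrtr_gt0 ltr0n.
have M0 : 0 <= M by rewrite -(pmulr_lge0 _ sN) -KE.
rewrite KE powRM ?sqrtr_ge0//; congr (_ * _).
by rewrite -powR12_sqrt// -powRrM mulrC.
Qed.

Lemma nikolskii_dim0 f : N = 0%N -> L f -> f = fun=> 0.
Proof.
move=> N0; have [[e [_ ->]] _ _] := nikL; move=> [a _ <-]; apply/funext => x.
by rewrite /lin_comb big1// => i; have := ltn_ord i; rewrite [X in (_ < X)%N]N0.
Qed.

Section sampling.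
Context d (T : measurableType d) (P : probability T R) (m : nat).
Variable X : 'I_m -> {RV P >-> borelType Omega}.
Hypotheses (iidX : iid_sample mu X) (m2 : (1 < m)%N) (N0 : (0 < N)%N).
Local Notation A := (ln m%:R / m%:R * M `^ p * N%:R `^ (p / 2)).

Lemma nikolskii_deviation : exists V : T -> R,
  [/\ measurable_fun setT V, forall t, 0 <= V t,
      forall t f, L f -> exists n, [/\ 0 <= n,
         ('N[mu]_(p%:E)[EFin \o f] `^ p = n%:E)%E,
         ('N[mu]_(p%:E)[EFin \o f] <= 1)%E = (n <= 1) &
         `|empirical_moment p X f t - n| <= V t * n],
      forall t c, 0 <= c -> (forall f, L f -> forall n,
         ('N[mu]_(p%:E)[EFin \o f] `^ p = n%:E)%E -> n <= 1 ->
         `|empirical_moment p X f t - n| <= c) -> V t <= c &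
      (\int[P]_t (V t)%:E <=
        (4 * chaining_const p * Num.sqrt A + 4 * chaining_const p ^+ 2 * A)%:E)%E].
Proof.
have [e [K [K1 KE LE [me eK] eorth]]] := nikolskii_basis N0.
have K0 : 0 < K by lra.
have p0 : 0 < p by have := p2; lra.
have [V [mV V0 Vh Vmin Vint]] := empirical_process_bound iidX p2 K0 m2 me eK eorth.
have ip a := integrable_powR_lin_comb mu p2 (ltW K0) me eK a.
have normE a : 'N[mu]_(p%:E)[EFin \o lin_comb e a]%E = (Lp_moment mu p e a `^ p^-1)%:E.
  by rewrite Lnorm_Rintegral.
have powE a : ('N[mu]_(p%:E)[EFin \o lin_comb e a] `^ p = (Lp_moment mu p e a)%:E)%E.
  by rewrite normE poweR_EFin -powRrM mulVf ?gt_eqF// powRr1// Lp_moment_ge0.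
have one_powR q : (1 : R) `^ q = 1 by rewrite powR1.
exists V; split => //.
- move=> t f; rewrite LE => -[a _ <-]; exists (Lp_moment mu p e a); split => //.
    exact: Lp_moment_ge0.
  rewrite normE lee_fin; apply/idP/idP => h.
    have -> : Lp_moment mu p e a = (Lp_moment mu p e a `^ p^-1) `^ p.
      by rewrite -powRrM mulVf ?gt_eqF// powRr1// Lp_moment_ge0.
    by rewrite -(one_powR p); apply: ge0_ler_powR; rewrite ?nnegrE ?powR_ge0// ltW.
  rewrite -(one_powR p^-1); apply: ge0_ler_powR; rewrite ?nnegrE ?Lp_moment_ge0//.
  by rewrite invr_ge0 ltW.
- move=> t c c0 h; apply: Vmin => // a na; apply: (h (lin_comb e a)) => //.
  by rewrite LE; exists a.
- have -> : A = K `^ p * ln m%:R / m%:R by rewrite (nikolskii_powR (ltW K0) KE N0); ring.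
  exact: Vint.
Qed.

End sampling.

End nikolskii_subspaces.

(** * Elementary estimates for the sample size *)

Section constants.
Variable R : realType.

Lemma ln4_ge : 2^-1 <= ln 4 :> R.
Proof.
have : ln (1 + - (3 / 4)) <= - (3 / 4) :> R by apply: le_ln1Dx; lra.
have -> : 1 + - (3 / 4) = 4^-1 :> R by lra.
by rewrite lnV ?posrE//; lra.
Qed.

Lemma ln_le_sqrt (y : R) : 0 < y -> ln y <= 2 * Num.sqrt y.
Proof.
move=> y0; have s0 : 0 < Num.sqrt y by rewrite sqrtr_gt0.
rewrite -{1}(sqr_sqrtr (ltW y0)) expr2 lnM ?posrE//.
by have := ln_sublinear s0; lra.
Qed.

(* With [x = y Q], [ln x / y = ln y / y + ln Q / y <= 2 / sqrt y + ln Q / y]. *)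
Lemma log_ratio_le (s Q x : R) : 1 <= s -> 1 <= Q ->
  2 * s ^+ 2 * Q * ln (4 * Q) <= x ->
  [/\ s ^+ 2 <= x & Q * ln x / x <= 3 / s].
Proof.
move=> s1 Q1 h.
have s0 : 0 < s by lra.
have Q0 : 0 < Q by lra.
have l4 := ln4_ge.
have lQ : 0 <= ln Q by rewrite ln_ge0.
have l4Q : ln (4 * Q) = ln 4 + ln Q by rewrite lnM ?posrE//.
pose y := x / Q.
have xE : x = y * Q by rewrite /y divfK// gt_eqF.
have hy : 2 * s ^+ 2 * ln (4 * Q) <= y by rewrite ler_pdivlMr// mulrAC.
have ss : s <= s ^+ 2 by rewrite expr2 ler_peMl//; lra.
have sy : s ^+ 2 <= y.
  apply: le_trans hy; rewrite l4Q -mulrA mulrCA ler_peMr ?sqr_ge0//; lra.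
have y0 : 0 < y by lra.
split; first by rewrite xE; apply: le_trans sy _; rewrite ler_peMr// ltW.
have -> : Q * ln x / x = ln x / y by rewrite xE; field; rewrite !gt_eqF.
rewrite {1}xE lnM ?posrE// mulrDl.
have sqy : s <= Num.sqrt y by rewrite -(ger0_norm (ltW s0)) -sqrtr_sqr ler_wsqrtr.
have t1 : ln y / y <= 2 / s.
  have ys : 0 < Num.sqrt y by lra.
  apply: (@le_trans _ _ (2 * Num.sqrt y / y)).
    by rewrite ler_pM2r ?invr_gt0//; exact: ln_le_sqrt.
  have -> : 2 * Num.sqrt y / y = 2 / Num.sqrt y.
    by rewrite -{2}(sqr_sqrtr (ltW y0)); field; rewrite gt_eqF.
  by rewrite ler_pM2l// lef_pV2 ?posrE.
have t2 : ln Q / y <= 1 / s.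
  rewrite ler_pdivrMr// mul1r ler_pdivlMl//; apply: le_trans hy.
  rewrite l4Q; have : s * ln Q <= s ^+ 2 * ln Q by rewrite ler_wpM2r.
  have : 0 <= s ^+ 2 * ln 4 by rewrite mulr_ge0 ?sqr_ge0//; lra.
  have : 0 <= s ^+ 2 * ln Q by rewrite mulr_ge0 ?sqr_ge0.
  have -> : 2 * s ^+ 2 * (ln 4 + ln Q) = 2 * (s ^+ 2 * ln 4) + 2 * (s ^+ 2 * ln Q) by ring.
  by move: (s ^+ 2 * ln Q) (s ^+ 2 * ln 4) (s * ln Q) => a b c *; lra.
lra.
Qed.

End constants.

(** With [r = eta / (8 * (C + 1) ^+ 2)] both [Num.sqrt A] and [A] are at most [r], and
    [4 * C + 4 * C ^+ 2] is less than [8 * (C + 1) ^+ 2]. *)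
Lemma deviation_small (R : realType) (C eta A : R) : 0 <= C -> 0 < eta < 1 ->
  0 <= A <= (eta / (8 * (C + 1) ^+ 2)) ^+ 2 ->
  4 * C * Num.sqrt A + 4 * C ^+ 2 * A < eta.
Proof.
move=> C0 /andP[e0 e1] /andP[A0]; set D := 8 * (C + 1) ^+ 2; set r := eta / D => Ar.
have D8 : 8 <= D by rewrite ler_peMr// expr_ge1//; lra.
have r0 : 0 <= r by rewrite divr_ge0//; lra.
have r1 : r <= 1 by rewrite ler_pdivrMr; lra.
have sA : Num.sqrt A <= r by rewrite -(ger0_norm r0) -sqrtr_sqr ler_wsqrtr.
have rr : r ^+ 2 <= r by rewrite expr2 ler_piMl.
have rD : r * D = eta by rewrite divfK// gt_eqF//; lra.
have t1 : 4 * C * Num.sqrt A <= 4 * C * r by apply: ler_wpM2l => //; lra.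
have t2 : 4 * C ^+ 2 * A <= 4 * C ^+ 2 * r.
  by apply: ler_wpM2l; [rewrite mulr_ge0// sqr_ge0|lra].
have := mulr_ge0 C0 r0; have : r * D = 8 * (C ^+ 2 * r) + 16 * (C * r) + 8 * r by rewrite /D; ring.
have := mulr_ge0 (sqr_ge0 C) r0; move: rD t1 t2 e0; rewrite -!mulrA.
move: (r * D) (C ^+ 2 * r) (C * r) (C * Num.sqrt A) (C ^+ 2 * A) => *; lra.
Qed.

Local Opaque chaining_const.

(** * Expected deviation and sampling discretization *)

Section nikolskii_sampling.
Variables (R : realType) (Omega : ptopologicalType).
Variables (mu : probability (borelType Omega) R) (p : R) (N : nat) (M : R).
Variable L : set (Omega -> R).
Hypotheses (cptO : compact [set: Omega]) (p2 : 2 <= p).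
Hypothesis nikL : nikolskii_subspace mu p N M L.
Context d (T : measurableType d) (P : probability T R) (m : nat).
Variable X : 'I_m -> {RV P >-> borelType Omega}.
Hypothesis iidX : iid_sample mu X.
Local Notation C := (chaining_const p).
Local Notation deviation f t :=
  (`| (empirical_moment p X f t)%:E - 'N[mu]_(p%:E)[EFin \o f] `^ p |)%E.
Local Notation sup_deviation t :=
  (ereal_sup [set deviation f t | f in Lp_unit_ball mu p L]).

Let p0 : 0 < p. Proof. by have := p2; lra. Qed.

Let Lp_zero : ('N[mu]_(p%:E)[EFin \o (fun=> 0%R)] = 0)%E.
Proof. by rewrite [LHS]Lnorm0// eqe gt_eqF. Qed.

Let zero_ball : Lp_unit_ball mu p L (fun=> 0).
Proof.
split; last by rewrite Lp_zero.
have [[e [_ ->]] _ _] := nikL; exists (fun=> 0) => //.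
by apply/funext => x; rewrite /lin_comb big1// => i _; rewrite mul0r.
Qed.

Let moment_zero t : empirical_moment p X (fun=> 0) t = 0.
Proof.
by rewrite /empirical_moment big1 ?mulr0// => j _; rewrite normr0 powR0// gt_eqF.
Qed.

Let A := ln m%:R / m%:R * M `^ p * N%:R `^ (p / 2).

Let A_ge0 : 0 <= A.
Proof.
rewrite mulr_ge0 ?powR_ge0// mulr_ge0 ?powR_ge0// mulr_ge0 ?invr_ge0//.
by case: (m) => [|n]; [rewrite ln0|rewrite ln_ge0// ler1n].
Qed.

Lemma expectation_sup_deviation : (1 < m)%N ->
  (\int[P]_t sup_deviation t <= ((4 * C + 4 * C ^+ 2) * (A + Num.sqrt A))%:E)%E.
Proof.
move=> m2; have C0 : 0 <= C by exact: chaining_const_ge0.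
have sA := sqrtr_ge0 A.
have [N0|N0] := posnP N.
  have e t : sup_deviation t = 0%E.
    rewrite (_ : [set _ | _ in _] = [set 0%E]) ?ereal_sup1//.
    have z : deviation (fun=> 0) t = 0%E.
      by rewrite Lp_zero poweR0r ?gt_eqF// moment_zero sube0 abse0.
    apply/seteqP; split => [_ [f [Lf _] <-]|_ ->]; last by exists (fun=> 0).
    by rewrite /= (nikolskii_dim0 nikL N0 Lf) z.
  under eq_integral do rewrite e.
  rewrite integral0 lee_fin; apply: mulr_ge0; last exact: addr_ge0.
  by move: C C0 => c c0; have := sqr_ge0 c; lra.
have [V [mV V0 Vh Vmin Vint]] := nikolskii_deviation cptO p2 nikL iidX m2 N0.
have devE f n t : ('N[mu]_(p%:E)[EFin \o f] `^ p = n%:E)%E ->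
    deviation f t = (`|empirical_moment p X f t - n|)%:E by move=> ->.
have sup_le t : (sup_deviation t <= (V t)%:E)%E.
  apply: ge_ereal_sup => _ [f [Lf fB] <-]; have [n [n0 nE nB h]] := Vh t f Lf.
  rewrite (devE _ _ _ nE) lee_fin; apply: le_trans h _.
  by rewrite ler_piMr// -nB.
have sup_ge0 t : (0 <= sup_deviation t)%E.
  apply: (@le_trans _ _ (deviation (fun=> 0) t)) => //.
  by apply: ereal_sup_ubound; exists (fun=> 0).
(* Minimality of [V] gives the reverse inequality, so the supremum over the uncountable ball is
   exactly the measurable function [V]. *)
have supE t : sup_deviation t = (V t)%:E.
  apply/eqP; rewrite eq_le sup_le/=.
  have fn : sup_deviation t \is a fin_num.
    by rewrite ge0_fin_numE// (le_lt_trans (sup_le t))// ltry.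
  rewrite -(fineK fn) lee_fin; apply: Vmin => [|f Lf n nE n1]; first exact: fine_ge0.
  rewrite -lee_fin fineK// -(devE _ _ _ nE); apply: ereal_sup_ubound; exists f => //.
  have [n' [_ n'E nB _]] := Vh t f Lf; split => //; rewrite nB.
  by move: n'E; rewrite nE => -[<-].
under eq_integral do rewrite supE.
apply: le_trans Vint _; rewrite lee_fin -/A.
have := mulr_ge0 C0 A_ge0; have := mulr_ge0 (sqr_ge0 C) sA; move: (sqr_ge0 C).
have -> : (4 * C + 4 * C ^+ 2) * (A + Num.sqrt A) = 4 * (C * A) + 4 * (C * Num.sqrt A) +
  4 * (C ^+ 2 * A) + 4 * (C ^+ 2 * Num.sqrt A) by ring.
by rewrite -!mulrA; move: (C * A) (C * Num.sqrt A) (C ^+ 2 * A) (C ^+ 2 * Num.sqrt A) => *; lra.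
Qed.

(** Markov's inequality for [V] at level [eps], which needs its mean to be below [eps * delta]. By
    [log_ratio_le] the quantity [A] is at most [3 / s], and [s] is chosen to bring this below the
    threshold of [deviation_small]; the summand 2 in [s] ensures that [m] is at least 2. *)
Lemma discretization_probability (eps delta : R) : 0 < eps < 1 -> 0 < delta < 1 ->
  let s := 3 / (eps * delta / (8 * (C + 1) ^+ 2)) ^+ 2 + 2 in
  p * s ^+ 2 * M `^ p * N%:R `^ (p / 2) * ln (4 * M ^+ 2 * N%:R) <= m%:R ->
  ((1 - delta)%:E < P [set t | forall f, L f ->
       (1 - eps)%:E * 'N[mu]_(p%:E)[EFin \o f] `^ p <= (empirical_moment p X f t)%:E
    /\ (empirical_moment p X f t)%:E <= (1 + eps)%:E * 'N[mu]_(p%:E)[EFin \o f] `^ p])%E.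
Proof.
move=> /andP[e0 e1] /andP[d0 d1] s hm.
have [N0|N0] := posnP N.
  rewrite (_ : [set t | _] = setT); last first.
    apply/seteqP; split => // t _ f /(nikolskii_dim0 nikL N0) ->.
    by rewrite Lp_zero poweR0r ?gt_eqF// moment_zero !mule0.
  by rewrite [X in (_ < X)%E]probability_setT lte_fin; lra.
have C0 : 0 <= C by exact: chaining_const_ge0.
have [_ [K [K1 KE _ _ _]]] := nikolskii_basis cptO nikL N0.
have K0 : 0 < K by lra.
have ed0 : 0 < eps * delta by exact: mulr_gt0.
have ed1 : eps * delta < 1 by rewrite mulr_ilt1// ltW.
set r := eps * delta / (8 * (C + 1) ^+ 2) in s hm.
have r0 : 0 < r by rewrite divr_gt0// mulr_gt0// exprn_gt0//; lra.
have r20 : 0 < r ^+ 2 by exact: exprn_gt0.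
have s2 : 2 <= s by rewrite /s lerDr divr_ge0// ltW.
have s0 : 0 < s by lra.
have sr : 3 / s <= r ^+ 2.
  rewrite ler_pdivrMr// /s mulrDr mulrCA divff ?gt_eqF// mulr1; move: (r ^+ 2) r20 => *; lra.
pose Q := K `^ p.
have QE : M `^ p * N%:R `^ (p / 2) = Q by rewrite /Q (nikolskii_powR p (ltW K0) KE N0).
have lK : 0 <= ln K by rewrite ln_ge0.
have lQ : ln Q = p * ln K by rewrite /Q ln_powR.
have Q1 : 1 <= Q.
  have <- : (1 : R) `^ p = 1 by rewrite powR1.
  by apply: (ge0_ler_powR (ltW p0)) => //; rewrite nnegrE ltW.
(* As [p >= 2], [p * ln (4 * K ^+ 2) = p * ln 4 + 2 * p * ln K] dominates
   [2 * ln (4 * Q) = 2 * ln 4 + 2 * p * ln K]. *)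
have hm' : 2 * s ^+ 2 * Q * ln (4 * Q) <= m%:R.
  apply: le_trans hm; have -> : 4 * M ^+ 2 * N%:R = 4 * K ^+ 2.
    by rewrite KE exprMn (sqr_sqrtr (ler0n R N)) -mulrA.
  rewrite -[p * s ^+ 2 * _ * _]mulrA QE.
  have Q0 : 0 < Q by lra.
  rewrite expr2 !lnM ?posrE// ?mulr_gt0// lQ; have l4 := ln4_ge R.
  have q0 : 0 <= s ^+ 2 * Q by rewrite mulr_ge0 ?sqr_ge0//; lra.
  have -> : 2 * s ^+ 2 * Q * (ln 4 + p * ln K) = s ^+ 2 * Q * (2 * ln 4 + 2 * (p * ln K)) by ring.
  have -> : p * s ^+ 2 * Q * (ln 4 + (ln K + ln K)) = s ^+ 2 * Q * (p * ln 4 + 2 * (p * ln K)).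
    by ring.
  by apply: ler_wpM2l => //; rewrite lerD2r ler_wpM2r//; lra.
have [sm AQ] := log_ratio_le (le_trans (ler1n _ 2) s2) Q1 hm'.
have m2 : (1 < m)%N.
  rewrite -(ltr_nat R); apply: lt_le_trans sm.
  by rewrite expr_gt1//; lra.
have AE : A = Q * ln m%:R / m%:R by rewrite -QE /A; ring.
have Asmall : 4 * C * Num.sqrt A + 4 * C ^+ 2 * A < eps * delta.
  by apply: deviation_small => //; rewrite ?ed0// A_ge0 AE (le_trans AQ).
have [V [mV V0 Vh Vmin Vint]] := nikolskii_deviation cptO p2 nikL iidX m2 N0.
rewrite (_ : [set t | _] = ~` [set t | eps < V t]); last first.
  apply/seteqP; split => [t h|t nV f Lf].
    change (~ (eps < V t)); apply/negP; rewrite -leNgt.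
    apply: Vmin => [|f Lf n nE n1]; first exact: ltW.
    have [n' [n'0 n'E _ _]] := Vh t f Lf.
    have n0 : 0 <= n by move: n'E; rewrite nE => -[->].
    have := h f Lf; rewrite nE -!EFinM !lee_fin => -[h1 h2].
    have en : eps * n <= eps by rewrite ler_piMr// ltW.
    by rewrite ler_norml; apply/andP; split; lra.
  have {}nV : V t <= eps by rewrite leNgt; apply/negP.
  have [n [n0 nE _]] := Vh t f Lf.
  rewrite nE -!EFinM !lee_fin.
  have : V t * n <= eps * n by rewrite ler_wpM2r.
  by rewrite ler_norml => h /andP[h1 h2]; split; lra.
have mE : measurable [set t | eps < V t].
  rewrite (_ : [set t | _] = V @^-1` `]eps, +oo[%classic).
    by rewrite -[_ @^-1` _]setTI; apply: mV.
  by apply/seteqP; split => t /=; rewrite in_itv/= andbT.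
have mEV : measurable_fun setT (EFin \o V) := measurableT_comp (@EFin_measurable R setT) mV.
have markovE : (eps%:E * P [set t | (eps < V t)%R] <= \int[P]_t (V t)%:E)%E.
  apply: (@le_trans _ _ (eps%:E * P (setT `&` [set t | (eps%:E <= `|(V t)%:E|)%E]))%E).
    apply: lee_wpmul2l; first by rewrite lee_fin ltW.
    apply: le_measure; rewrite ?inE//.
      by apply: emeasurable_fun_c_infty => //; exact: measurableT_comp.
    by move=> t /ltW eV; split => //; apply: le_trans (lee_abs _).
  have := @le_integral_comp_abse _ _ _ P _ measurableT (EFin \o V) eps id
    (@measurable_id _ _ _) (fun _ h => h) (fun _ _ _ _ h => h) mEV e0.
  move/le_trans; apply; rewrite le_eqVlt; apply/orP; left; apply/eqP.
  by apply: eq_integral => t _; rewrite gee0_abs// lee_fin.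
have PE : P [set t | (eps < V t)%R] \is a fin_num by exact: fin_num_measure.
rewrite [X in (_ < X)%E]probability_setC//.
move: markovE; rewrite -(fineK PE); move: (fine _) => q markovE.
have := le_trans markovE Vint; rewrite -EFinM lee_fin -EFinB lte_fin => h.
have : eps * q < eps * delta by apply: le_lt_trans h Asmall.
by rewrite ltr_pM2l//; lra.
Qed.

End nikolskii_sampling.

Theorem corollary4p5 (R : realType) (p : R) (hp : 2 <= p) :
  (exists C : R,
    forall (Omega : ptopologicalType) (mu : probability (borelType Omega) R)
      (N : nat) (M : R) (L : set (Omega -> R)),
    compact [set: Omega] -> nikolskii_subspace mu p N M L ->
    forall m : nat, (2 <= m)%N ->
    forall (d : measure_display) (T : measurableType d) (P : probability T R)
      (X : 'I_m -> {RV P >-> borelType Omega}),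
    iid_sample mu X ->
    let A := ln m%:R / m%:R * M `^ p * N%:R `^ (p / 2) in
    (\int[P]_t ereal_sup
       [set `| (empirical_moment p X f t)%:E
               - 'N[mu]_(p%:E)[EFin \o f] `^ p |
       | f in Lp_unit_ball mu p L]
     <= (C * (A + Num.sqrt A))%:E)%E)
  /\
  (forall eps delta : R, 0 < eps < 1 -> 0 < delta < 1 ->
    exists2 c : R, 0 < c &
    forall (Omega : ptopologicalType) (mu : probability (borelType Omega) R)
      (N : nat) (M : R) (L : set (Omega -> R)),
    compact [set: Omega] -> nikolskii_subspace mu p N M L ->
    forall m : nat,
    c * M `^ p * N%:R `^ (p / 2) * ln (4 * M ^+ 2 * N%:R) <= m%:R ->
    forall (d : measure_display) (T : measurableType d) (P : probability T R)
      (X : 'I_m -> {RV P >-> borelType Omega}),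
    iid_sample mu X ->
    ((1 - delta)%:E <
     P [set t | forall f, L f ->
         (1 - eps)%:E * 'N[mu]_(p%:E)[EFin \o f] `^ p
           <= (empirical_moment p X f t)%:E
         /\ (empirical_moment p X f t)%:E
           <= (1 + eps)%:E * 'N[mu]_(p%:E)[EFin \o f] `^ p])%E).
Proof.
split.
  exists (4 * chaining_const p + 4 * chaining_const p ^+ 2).
  move=> Omega mu N M L cptO nikL m m2 d T P X iidX.
  exact: (expectation_sup_deviation cptO hp nikL iidX m2).
move=> eps delta he hd.
exists (p * (3 / (eps * delta / (8 * (chaining_const p + 1) ^+ 2)) ^+ 2 + 2) ^+ 2).
  rewrite mulr_gt0 ?exprn_gt0//; first by lra.
  by rewrite ltr_wpDl// divr_ge0// sqr_ge0.
move=> Omega mu N M L cptO nikL m hm d T P X iidX.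
exact: (discretization_probability cptO hp nikL iidX he hd hm).
Qed.
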